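(* Let $\beta>0$, $m\ge1$ an integer and $\lambda_m>0$ with $\lambda_m^2:=e^{-m\beta/2}$. Let $(B_m,D(B_m)):=(\lambda_m^2X_m^*X_m+\lambda_m^{-2}X_mX_m^*,D(N^m))$, a self-adjoint, positive operator affiliated to $M=B(h)$ in its left action on $L^2(M)=L^2(h)$, $h=l^2(\mathbb N)$. Then the Markovian semigroup $\{e^{-tH_{X_m}^{\lambda_m}}:t\ge0\}$ associated to the Dirichlet form $(\mathcal E_{X_m}^{\lambda_m},\mathcal F_{X_m}^{\lambda_m})$ dominates the Markovian semigroup $\{e^{-tG_1}:t\ge0\}$, i.e. $$e^{-tG_1}\eta\le e^{-tH_{X_m}^{\lambda_m}}\eta\qquad\eta\in L^2_+(M),\ t\ge0,$$ where $(G_1,D(G_1))$ is the closed, self-adjoint operator on $L^2(h)$ given by $$D(G_1):=D(N^m)\cap JD(N^m),\qquad G_1:=(\lambda_m^2X_m^*X_m+\lambda_m^{-2}X_mX_m^* )\dot+\,j(\lambda_m^2X_m^*X_m+\lambda_m^{-2}X_mX_m^* ),$$ whose semigroup can be expressed as $$e^{-tG_1}(\eta)=e^{-tB_m}j(e^{-tB_m})(\eta)=e^{-tB_m}\eta e^{-tB_m}\qquad\eta\in L^2(M).$$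
   Context: $\mathbb N=\{0,1,2,\dots\}$, $h=l^2(\mathbb N)$ with natural basis $\{e_k\}_{k\in\mathbb N}$. $M=B(h)$ acts by left composition on $L^2(M)=L^2(h)$, the Hilbert-Schmidt operators on $h$, with cone $L^2_+(M)=L^2_+(h)$ of positive Hilbert-Schmidt operators and $J\eta=\eta^*$. For self-adjoint $\xi,\eta\in L^2(h)$, $\xi\le\eta$ means $\eta-\xi\in L^2_+(h)$. $N$ is the Number Operator, $Ne_k=ke_k$. $\rho_\beta=(1-e^{-\beta})e^{-\beta N}$ is the density matrix of the state $\omega_\beta(x)={\rm Tr}(x\rho_\beta)$, represented by $\xi_0=\rho_\beta^{1/2}$. On $D(A)=D(A^* )=D(\sqrt N)$: $Ae_0=0$, $Ae_k=\sqrt k\,e_{k-1}$ ($k\ge1$), $A^*e_k=\sqrt{k+1}\,e_{k+1}$. $X_m:=(A^* )^m$ with $D(X_m)=D(N^{m/2})$. All such operators on $h$ are also viewed as operators on $L^2(h)$ affiliated to $M$, acting by left composition (as $X\otimes I$ under $L^2(h)\cong h\otimes\bar h$), and the domains above are then domains in $L^2(h)$. $j(X):=JXJ$ with domain $JD(X)$. For a lower bounded self-adjoint operator $B$ affiliated to $M$ with form $(q_B,D(q_B))$, $B\dot+j(B)$ is the generalized (form) sum: the self-adjoint operator of the closed form $\eta\mapsto q_B[\eta]+q_B[J\eta]$ on $D(q_B)\cap JD(q_B)$. $(\mathcal E_{X_m}^{\lambda_m},\mathcal F_{X_m}^{\lambda_m})$ is the closure of the closable form $\eta\mapsto\|(\lambda_mX_m-\lambda_m^{-1}j(X_m^*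 ))\eta\|^2+\|(\lambda_m^{-1}X_m^*-\lambda_mj(X_m))\eta\|^2$ on $D(X_m)\cap D(X_m^* )\cap J(D(X_m)\cap D(X_m^* ))$; it is a completely Dirichlet form with respect to $(M,\omega_\beta)$ and $H_{X_m}^{\lambda_m}$ is its associated self-adjoint operator. A $C_0$-continuous self-adjoint semigroup $T_t$ on $L^2(h)$ is Markovian if $T_tL^2_+(h)\subseteq L^2_+(h)$ and $0\le\xi\le\xi_0$ implies $0\le T_t\xi\le\xi_0$, for all $t\ge0$. *)

(* Defs.v *)
From HB Require Import structures.
From mathcomp Require Import all_boot all_order all_algebra.
From mathcomp Require Import complex ring lra.
From mathcomp Require Import boolp classical_sets functions reals.
From mathcomp Require Import topology normedtype sequences exp.

Set Implicit Arguments.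
Unset Strict Implicit.
Unset Printing Implicit Defensive.

Import Order.TTheory GRing.Theory Num.Theory.
Import numFieldNormedType.Exports.

Local Open Scope classical_set_scope.
Local Open Scope ring_scope.
Local Open Scope complex_scope.

(* [ip x y] is linear in [x] and antilinear in [y].  The definitions of this
   section only use the operations; they are applied to the Hilbert spaces
   [l2 R] and [hs R] below.

   An operator is identified with its graph, a set of pairs [(x, A x)], and a
   nonnegative quadratic form with the set of the pairs [(x, q[x])], [x] in the
   domain.  Sums and products of operators have their natural domains. *)
Section Operators.
Context (R : realType) (V : lmodType R[i]) (ip : V -> V -> R[i]).

Definition hnorm (x : V) : R := Num.sqrt (complex.Re (ip x x)).

Definition hcvg (u : nat -> V) (x : V) : Prop :=
  (fun n => hnorm (u n - x)) @ \oo --> (0 : R).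

Definition bounded_linear (f : V -> V) : Prop :=
  linear f /\ exists M : R, forall x, hnorm (f x) <= M * hnorm x.

Definition unitary (f : V -> V) : Prop :=
  [/\ linear f, forall x y, ip (f x) (f y) = ip x y
    & forall y, exists x, f x = y].

Definition oper := set (V * V).

Implicit Types A B : oper.

Definition opdom A : set V := [set x | exists y, A (x, y)].

Definition opgraph (f : V -> V) : oper := [set p | p.2 = f p.1].

Definition opid : oper := opgraph id.

Definition oprestrict A (D : set V) : oper := [set p | A p /\ D p.1].

Definition opadd A B : oper :=
  [set p | exists y z, [/\ A (p.1, y), B (p.1, z) & p.2 = y + z]].

Definition opscale (a : R) A : oper :=
  [set p | exists2 y, A (p.1, y) & p.2 = a%:C *: y].

Definition opcomp A B : oper :=
  [set p | exists2 y, B (p.1, y) & A (y, p.2)].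

Definition opadj A : oper :=
  [set p | forall x y, A (x, y) -> ip y p.1 = ip x p.2].

Definition opclosed A : Prop :=
  forall u v x y, (forall n, A (u n, v n)) -> hcvg u x -> hcvg v y -> A (x, y).

Definition opdense A : Prop :=
  forall x, exists2 u, (forall n : nat, opdom A (u n)) & hcvg u x.

Definition selfadjoint A : Prop := opdense A /\ opadj A = A.

Definition oppositive A : Prop := forall x y, A (x, y) -> 0 <= ip y x.

Definition qform := set (V * R).

Implicit Types q : qform.

Definition qdom q : set V := [set x | exists r, q (x, r)].

Definition qval q (x : V) : R := xget 0 [set r | q (x, r)].

(* polarization: the sesquilinear form, linear in [x], of [q] *)
Definition qpolar q (x y : V) : R[i] :=
  4^-1 * ((qval q (x + y))%:C - (qval q (x - y))%:C
          + 'i * ((qval q (x + 'i *: y))%:C - (qval q (x - 'i *: y))%:C)).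

(* the smallest closed extension of a closable form *)
Definition qclosure q : qform :=
  [set p | exists u v,
    [/\ forall n : nat, q (u n, v n),
        hcvg u p.1,
        v @ \oo --> p.2
      & forall e : R, 0 < e -> exists N : nat, forall n k : nat,
          (N <= n)%N -> (N <= k)%N -> qval q (u n - u k) < e]].

(* the operator associated to a closed form: [q(x, z) = <A x, z>] for all [z]
   in the domain of [q] *)
Definition qoper q : oper :=
  [set p | qdom q p.1 /\ forall z, qdom q z -> qpolar q p.1 z = ip p.2 z].

(* the closed form of a positive self-adjoint operator, in which the domain of
   the operator is a core *)
Definition opform A : qform :=
  qclosure [set p | exists2 y, A (p.1, y) & p.2 = complex.Re (ip y p.1)].

(* Semigroups are indexed by [R], and only their values at [t >= 0] matter. *)
Definition selfadjoint_c0_semigroup (T : R -> V -> V) : Prop :=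
  [/\ forall t, 0 <= t -> bounded_linear (T t),
      forall t x y, 0 <= t -> ip (T t x) y = ip x (T t y),
      forall x, T 0 x = x,
      forall s t x, 0 <= s -> 0 <= t -> T (s + t) x = T s (T t x)
    & forall x, (fun t => hnorm (T t x - x)) @ 0^'+ --> (0 : R)].

(* the operator [A] such that [T t] is the exponential of [- t A] *)
Definition neg_generator (T : R -> V -> V) : oper :=
  [set p | (fun t : R => hnorm (t^-1%:C *: (p.1 - T t p.1) - p.2)) @ 0^'+
             --> (0 : R)].

Definition is_exp_semigroup A (T : R -> V -> V) : Prop :=
  selfadjoint_c0_semigroup T /\ neg_generator T = A.

(* [expN A t] is the exponential of [- t A] ([t >= 0]): there is at most one
   semigroup, up to its values at [t < 0], with a given generator.  Statements
   about [expN A] also assert [is_exp_semigroup A (expN A)]. *)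
Definition expN A : R -> V -> V := 
  @xget (R -> V -> V) (fun=> id) [set T | is_exp_semigroup A T].

End Operators.

Section L2.
Context (R : realType).

Definition sqmod (z : R[i]) : R := complex.Re z ^+ 2 + complex.Im z ^+ 2.

Definition square_summable (x : nat -> R[i]) : Prop :=
  cvgn (series (fun k => sqmod (x k))).

(* the sum of an absolutely convergent series of complex numbers *)
Definition csum (u : nat -> R[i]) : R[i] :=
  limn (series (fun k => complex.Re (u k))) +i*
  limn (series (fun k => complex.Im (u k))).

Definition l2_pred : {pred nat -> R[i]} := fun x => `[< square_summable x >].

Record l2 := L2 { l2val :> nat -> R[i]; l2valP : l2val \in l2_pred }.

HB.instance Definition _ := [isSub for l2val].
HB.instance Definition _ := [Choice of l2 by <:].

Lemma sqmod_ge0 z : 0 <= sqmod z.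
Proof. by rewrite addr_ge0// sqr_ge0. Qed.

Lemma sqmodD (z w : R[i]) : sqmod (z + w) <= 2 * sqmod z + 2 * sqmod w.
Proof.
case: z w => [a b] [c d]; rewrite /sqmod /=.
have := sqr_ge0 (a - c); have := sqr_ge0 (b - d); nra.
Qed.

Lemma sqmodM (z w : R[i]) : sqmod (z * w) = sqmod z * sqmod w.
Proof. by case: z w => [a b] [c d]; rewrite /sqmod /=; ring. Qed.

Let sqmod_lin (a z w : R[i]) :
  sqmod (a * z + w) <= 2 * sqmod a * sqmod z + 2 * sqmod w.
Proof. by apply: le_trans (sqmodD _ _) _; rewrite sqmodM mulrA. Qed.

Lemma l2_submod_closed : submod_closed l2_pred.
Proof.
split=> [|a x y /asboolP xs /asboolP ys]; apply/asboolP.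
  rewrite /square_summable [X in cvgn X](_ : _ = cst 0); first exact: is_cvg_cst.
  by apply/funext => n; rewrite /series /= big1 // => i _; rewrite /sqmod /= expr0n addr0.
apply: (@series_le_cvg _ _ (fun k => (2 * sqmod a) *: sqmod (x k) + 2 *: sqmod (y k))).
- by move=> k; exact: sqmod_ge0.
- by move=> k; rewrite addr_ge0// !mulr_ge0// sqmod_ge0.
- by move=> k; exact: sqmod_lin.
- by apply: is_cvg_seriesD; apply: is_cvg_seriesZ.
Qed.

HB.instance Definition _ := GRing.isSubmodClosed.Build _ _ l2_pred
  l2_submod_closed.
HB.instance Definition _ := [SubChoice_isSubLmodule of l2 by <:].

Definition l2ip (x y : l2) : R[i] := csum (fun k => x k * (y k)^*).

Let Re_mulconj (z : R[i]) : complex.Re (z * z^*) = sqmod z.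
Proof. by case: z => a b; rewrite /sqmod /=; ring. Qed.

Lemma l2ipE (x : l2) :
  complex.Re (l2ip x x) = limn (series (fun k => sqmod (x k))).
Proof.
by rewrite /l2ip /csum /=; congr (limn (series _)); apply/funext => k; exact: Re_mulconj.
Qed.

Lemma l2norm_sqr (x : l2) :
  hnorm l2ip x ^+ 2 = limn (series (fun k => sqmod (x k))).
Proof.
rewrite /hnorm l2ipE sqr_sqrtr// limr_ge //; first exact/asboolP/(l2valP x).
by near=> n; rewrite /series /= sumr_ge0// => i _; exact: sqmod_ge0.
Unshelve. all: by end_near. Qed.

Lemma l2norm_lin (a : R[i]) (x y : l2) :
  hnorm l2ip (a *: x + y) ^+ 2 <=
    2 * sqmod a * hnorm l2ip x ^+ 2 + 2 * hnorm l2ip y ^+ 2.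
Proof.
have cx : cvgn (series (fun k => sqmod (x k))) by exact/asboolP/(l2valP x).
have cy : cvgn (series (fun k => sqmod (y k))) by exact/asboolP/(l2valP y).
have cxy : cvgn (series (fun k => sqmod ((a *: x + y) k))).
  exact/asboolP/(l2valP (a *: x + y)).
rewrite !l2norm_sqr; set f := fun k => sqmod (x k); set g := fun k => sqmod (y k).
have -> : 2 * sqmod a * limn (series f) = limn (series ((2 * sqmod a) *: f)).
  by rewrite lim_seriesZ.
have -> : 2 * limn (series g) = limn (series ((2 : R) *: g)).
  by rewrite lim_seriesZ.
rewrite -lim_seriesD; [|exact: is_cvg_seriesZ..].
apply: lim_series_le => //; first by apply: is_cvg_seriesD; exact: is_cvg_seriesZ.
by move=> k; exact: sqmod_lin.
Qed.

Let basis_seq (k : nat) : nat -> R[i] := fun j => (j == k)%:R.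

Let basis_seqP k : basis_seq k \in l2_pred.
Proof.
apply/asboolP.
apply: (@series_le_cvg _ _ (geometric (2 ^+ k) (2^-1))).
- by move=> j; exact: sqmod_ge0.
- by move=> j; rewrite /geometric /= mulr_ge0 ?exprn_ge0// invr_ge0.
- move=> j; rewrite /basis_seq /geometric /sqmod /=; case: eqP => [->|_] /=.
    by rewrite expr1n expr0n addr0 exprVn divff// expf_neq0// pnatr_eq0.
  by rewrite expr0n addr0 mulr_ge0 ?exprn_ge0// invr_ge0.
- by apply: is_cvg_geometric_series; rewrite ger0_norm ?invr_ge0// invf_lt1 ?ltr1n.
Qed.

Definition e_ (k : nat) : l2 := L2 (basis_seqP k).

End L2.

Arguments e_ {R} k.



Section HilbertSchmidt.
Context (R : realType).
Local Notation h := (l2 R).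

Definition hilbert_schmidt (T : h -> h) : Prop :=
  bounded_linear (@l2ip R) T /\
  cvgn (series (fun k => hnorm (@l2ip R) (T (e_ k)) ^+ 2)).

Definition hs_pred : {pred h -> h} := fun T => `[< hilbert_schmidt T >].

Record hs := HS { hsval :> h -> h; hsvalP : hsval \in hs_pred }.

HB.instance Definition _ := [isSub for hsval].
HB.instance Definition _ := [Choice of hs by <:].

Lemma hs_submod_closed : submod_closed hs_pred.
Proof.
split=> [|a S T /asboolP[[Sl [M SM]] Sh] /asboolP[[Tl [N TN]] Th]]; apply/asboolP.
  have h0 : hnorm (@l2ip R) 0 ^+ 2 = 0.
    rewrite l2norm_sqr (_ : series _ = cst 0) ?lim_cst//.
    apply/funext => n; rewrite /series /= big1 // => i _.
    by rewrite /sqmod /= expr0n addr0.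
  split; first split.
  - by move=> a u v /=; rewrite scaler0 addr0.
  - exists 0 => x; rewrite mul0r.
    by move/eqP: h0; rewrite expf_eq0 /= => /eqP ->.
  - rewrite [X in cvgn X](_ : _ = cst 0); first exact: is_cvg_cst.
    by apply/funext => n; rewrite /series /= big1.
split; first split.
- move=> b u v /=; rewrite !fctE Sl Tl !scalerDr !scalerA (mulrC a b).
  by rewrite -!addrA; congr (_ + _); rewrite addrCA.
- exists (Num.sqrt (2 * sqmod a * M ^+ 2 + 2 * N ^+ 2)) => x.
  have n0 y : 0 <= hnorm (@l2ip R) y by exact: sqrtr_ge0.
  rewrite -(@ler_pXn2r _ 2) ?nnegrE ?mulr_ge0 ?sqrtr_ge0//.
  have K0 : 0 <= 2 * sqmod a * M ^+ 2 + 2 * N ^+ 2.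
    by rewrite addr_ge0// mulr_ge0 ?sqr_ge0// mulr_ge0// sqmod_ge0.
  rewrite exprMn (sqr_sqrtr K0).
  apply: le_trans (l2norm_lin _ _ _) _.
  rewrite [leRHS]mulrDl; apply: lerD.
    rewrite -[leRHS]mulrA; apply: ler_wpM2l; first by rewrite mulr_ge0// sqmod_ge0.
    rewrite -exprMn; apply: lerXn2r; rewrite ?nnegrE ?n0 ?SM//.
    exact: le_trans (SM x).
  rewrite -[leRHS]mulrA; apply: ler_wpM2l => //.
  rewrite -exprMn; apply: lerXn2r; rewrite ?nnegrE ?n0 ?TN//.
  exact: le_trans (TN x).
- apply: (@series_le_cvg _ _ ((2 * sqmod a) *: (fun k => hnorm (@l2ip R) (S (e_ k)) ^+ 2)
      + (2 : R) *: (fun k => hnorm (@l2ip R) (T (e_ k)) ^+ 2))).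
  + by move=> k; exact: sqr_ge0.
  + by move=> k; rewrite addr_ge0// mulr_ge0 ?sqr_ge0// mulr_ge0// sqmod_ge0.
  + by move=> k; exact: l2norm_lin.
  + by apply: is_cvg_seriesD; apply: is_cvg_seriesZ.
Qed.

HB.instance Definition _ := GRing.isSubmodClosed.Build _ _ hs_pred
  hs_submod_closed.
HB.instance Definition _ := [SubChoice_isSubLmodule of hs by <:].

(* the trace of [adjoint of y] times [x] *)
Definition hsip (x y : hs) : R[i] :=
  csum (fun k => l2ip (x (e_ k)) (y (e_ k))).

End HilbertSchmidt.

Section LeftAction.
Context (R : realType).
Local Notation h := (l2 R).
Local Notation L := (hs R).

(* [A] acting by left composition, on the [eta] with range in the domain of [A]
   and [A \o eta] Hilbert-Schmidt *)
Definition lift_op (A : oper h) : oper L :=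
  [set p : L * L | forall x : h, A (p.1 x, p.2 x)].

(* the Hilbert space adjoint of [eta]: it exists, it is unique, and it is again
   Hilbert-Schmidt, so that the default value 0 is not used *)
Definition J (eta : L) : L :=
  xget 0 [set zeta : L | forall x y : h, l2ip (eta x) y = l2ip x (zeta y)].

(* [J A J] on the domain [J D(A)], as [J] is an involution *)
Definition opj (A : oper L) : oper L := [set p : L * L | A (J p.1, J p.2)].

Definition hs_pos (eta : L) : Prop := forall x : h, 0 <= l2ip (eta x) x.

Definition hs_le (xi eta : L) : Prop := hs_pos (eta - xi).

(* [U] belongs to the commutant of the left action of the bounded operators *)
Definition in_commutant (U : L -> L) : Prop :=
  bounded_linear (@hsip R) U /\
  forall (a : h -> h) (eta zeta : L), bounded_linear (@l2ip R) a ->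
    (forall x, zeta x = a (eta x)) -> forall x, U zeta x = a (U eta x).

Definition affiliated (A : oper L) : Prop :=
  forall U : L -> L, unitary (@hsip R) U -> in_commutant U ->
    forall eta zeta, A (eta, zeta) -> A (U eta, U zeta).

Definition markovian (xi0 : L) (T : R -> L -> L) : Prop :=
  [/\ selfadjoint_c0_semigroup (@hsip R) T,
      forall t eta, 0 <= t -> hs_pos eta -> hs_pos (T t eta)
    & forall t xi, 0 <= t -> hs_le 0 xi -> hs_le xi xi0 ->
        hs_le 0 (T t xi) /\ hs_le (T t xi) xi0].

(* the form sum of [B] and [opj B], for a positive self-adjoint [B] *)
Definition form_sum (B : oper L) : oper L :=
  qoper (@hsip R) [set p : L * R | exists r s : R,
    [/\ opform (@hsip R) B (p.1, r), opform (@hsip R) B (J p.1, s)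
      & p.2 = r + s]].

End LeftAction.

Section NumberOperator.
Context (R : realType).
Local Notation h := (l2 R).
Local Notation L := (hs R).

Definition diag (f : nat -> R) : oper h :=
  [set p : h * h | forall k, p.2 k = (f k)%:C * p.1 k].

(* the power [N^s] of the number operator; [powR 0 0 = 1] *)
Definition Npow (s : R) : oper h := diag (fun k => k%:R `^ s).

Definition gibbs (beta : R) (k : nat) : R :=
  (1 - expR (- beta)) * expR (- (beta * k%:R)).

(* the vector of the Gibbs state: the square root of its density matrix; the
   diagonal operator is Hilbert-Schmidt for [0 < beta], so that the default value
   0 is not used *)
Definition xi_ (beta : R) : L :=
  xget 0 [set xi : L | opgraph xi = diag (fun k => Num.sqrt (gibbs beta k))].

(* [A^*], where [A] is the annihilation operator *)
Definition creation : oper h :=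
  [set p : h * h | opdom (Npow 2^-1) p.1 /\
    forall k, p.2 k = if k is j.+1 then (Num.sqrt j.+1%:R)%:C * p.1 j else 0].

(* the [m]-th power of [creation], with the domain of [N^(m/2)] *)
Definition X_ (m : nat) : oper h :=
  oprestrict (iter m (opcomp creation) (@opid R h)) (opdom (Npow (m%:R / 2))).

(* The natural domain of this sum is the domain of [N^m]. *)
Definition B_ (m : nat) (lam : R) : oper h :=
  opadd (opscale (lam ^+ 2) (opcomp (opadj (@l2ip R) (X_ m)) (X_ m)))
        (opscale (lam ^- 2) (opcomp (X_ m) (opadj (@l2ip R) (X_ m)))).

Definition pre_dirichlet_form (X : oper h) (lam : R) : qform L :=
  let X1 := lift_op X in
  let X2 := lift_op (opadj (@l2ip R) X) in
  [set p : L * R | exists y z : L,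
    [/\ opadd (opscale lam X1) (opscale (- lam^-1) (opj X2)) (p.1, y),
        opadd (opscale lam^-1 X2) (opscale (- lam) (opj X1)) (p.1, z)
      & p.2 = hnorm (@hsip R) y ^+ 2 + hnorm (@hsip R) z ^+ 2]].

Definition dirichlet_form (X : oper h) (lam : R) : qform L :=
  qclosure (@hsip R) (pre_dirichlet_form X lam).

Definition H_ (m : nat) (lam : R) : oper L :=
  qoper (@hsip R) (dirichlet_form (X_ m) lam).

Definition G1_ (m : nat) (lam : R) : oper L := form_sum (lift_op (B_ m lam)).

End NumberOperator.

(* Main.v *)
(* In matrix coordinates [H = G1 - 2 K], where [G1] multiplies the entry [(j, k)]
   by [b_j + b_k], with [b] the eigenvalues of [B_m], and
   [K eta = X^* eta X + X eta X^*].  The map [K] preserves positivity, and so does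
   the resolvent of [G1], since [1 / (x + y)] is a positive kernel.  By the
   arithmetic-geometric inequality, [2 K <= G1] as forms.  Truncated to an
   [n x n] corner, the resolvent equation [(1 + e G1) x = y + 2 e K x] is thus the
   fixed point equation of a contraction.  For [0 <= y], its iterates from [0]
   dominate [(1 + e G1)^-1 y] from the first one on; for [y <= xi_0] they stay
   below [xi_0], because [H xi_0 = 0] entrywise by detailed balance.  The corner
   solutions are the Galerkin approximations of [(1 + e H)^-1 y], so that both
   inequalities pass to the resolvents and, by the implicit Euler formula
   [exp (- t A) = lim_k (1 + t 2^-k A)^-(2^k)], to the semigroups.  *)

(* The form inequality [2 K <= G1] leaves no margin: it is an equality at the Gibbs vector, and the
   contraction factor obtained in a corner tends to 1 as the corner grows. The passage to infinite
   matrices therefore rests on energies and not on the iteration. The form is written as the squared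
   norm of a closed gradient with values in two copies of the Hilbert-Schmidt space, and the
   energies of the Galerkin solutions increase to a finite limit, which gives strong convergence.
   That the limit solves the equation of the closed form, and not of another extension of the matrix
   expression, is due to corner matrices being a core of the gradient. The scaling [lam] cancels in
   the cross terms of the squared norm, so [K] does not contain it; it returns only in [b] and in
   detailed balance. Since exponentials are selected through their generators, Euler limits reach
   them only after uniqueness of the semigroup with a given generator, where contractivity has to be
   proved first. Positivity is tested on finite sections of matrix entries, so it survives every
   entrywise limit. *)
Require Import Defs.
From HB Require Import structures.
From mathcomp Require Import all_boot all_order all_algebra.
From mathcomp Require Import complex ring lra.
From mathcomp Require Import boolp classical_sets functions reals.
From mathcomp Require Import topology normedtype sequences exp.

Set Implicit Arguments.
Unset Strict Implicit.
Unset Printing Implicit Defensive.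

Import Order.TTheory GRing.Theory Num.Theory.
Import numFieldNormedType.Exports.

Local Open Scope classical_set_scope.
Local Open Scope ring_scope.
Local Open Scope complex_scope.

(** * Limits of real sequences and functions *)

Section RealLimits.
Context (R : realType).

Lemma cvgn0P (u : nat -> R) : (u @ \oo --> (0 : R)) <->
  (forall e : R, 0 < e -> exists N, forall n, (N <= n)%N -> `|u n| < e).
Proof.
split=> [/cvgr0Pnorm_lt uc e e0|H].
  by have [N _ HN] := uc _ e0; exists N => n Nn; exact: HN.
apply/cvgr0Pnorm_lt => e e0; have [N HN] := H _ e0.
by exists N => // n /= Nn; exact: HN.
Qed.

Lemma cvg_right0P (f : R -> R) : (f @ 0^'+ --> (0 : R)) <->
  (forall e : R, 0 < e ->
     exists2 d : R, 0 < d & forall t, 0 < t -> t < d -> `|f t| < e).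
Proof.
split=> [/cvgr0Pnorm_lt uc e e0|H].
  have [d /= d0 Hd] := uc _ e0; exists d => // t t0 td.
  by apply: Hd => //=; rewrite sub0r normrN gtr0_norm.
apply/cvgr0Pnorm_lt => e e0; have [d d0 Hd] := H _ e0.
exists d => //= t; rewrite /= sub0r normrN => td t0.
by apply: Hd => //; rewrite -(gtr0_norm t0).
Qed.

Lemma cvgnD (u v : nat -> R) (a b : R) : (u @ \oo --> a) -> (v @ \oo --> b) ->
  (fun n => u n + v n) @ \oo --> a + b.
Proof. by move=> ua vb; exact: cvgD ua vb. Qed.

Lemma cvgnM (u v : nat -> R) (a b : R) : (u @ \oo --> a) -> (v @ \oo --> b) ->
  (fun n => u n * v n) @ \oo --> a * b.
Proof. by move=> ua vb; exact: cvgM ua vb. Qed.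

Lemma cvgnZ (c : R) (u : nat -> R) (a : R) : (u @ \oo --> a) ->
  (fun n => c * u n) @ \oo --> c * a.
Proof. by move=> ua; apply: cvgnM ua; exact: cvg_cst. Qed.

Lemma cvgn_uniq (f : nat -> R) (a b : R) : (f @ \oo --> a) -> (f @ \oo --> b) -> a = b.
Proof. by move=> H1 H2; rewrite -(cvg_lim (@norm_hausdorff _ _) H1) -(cvg_lim (@norm_hausdorff _ _) H2). Qed.

Lemma cvgn_subP (u : nat -> R) (l : R) : (u @ \oo --> l) <->
  (forall e : R, 0 < e -> exists N, forall n, (N <= n)%N -> `|u n - l| < e).
Proof.
rewrite -(cvgn0P (fun n => u n - l)); split => [H|H].
  by rewrite -(subrr l); apply: cvgnD H (cvg_cst _).
rewrite -[l in _ --> l]add0r.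
have -> : u = (fun n => (u n - l) + l) by apply/funext => n; rewrite subrK.
exact: cvgnD H (cvg_cst _).
Qed.

Lemma cvgn_le (u v : nat -> R) (a b : R) : (u @ \oo --> a) -> (v @ \oo --> b) ->
  (exists N, forall n, (N <= n)%N -> u n <= v n) -> a <= b.
Proof.
move=> ua vb [N uv]; rewrite -(cvg_lim (@norm_hausdorff _ _) ua) -(cvg_lim (@norm_hausdorff _ _) vb).
apply: ler_lim; [by apply/cvg_ex; exists a|by apply/cvg_ex; exists b|].
by exists N => // n /= Nn; exact: uv.
Qed.

Lemma ler_of_eq (x y : R) : x = y -> x <= y.
Proof. by move=> ->. Qed.

Lemma ler_gtP (x y : R) : (forall e, 0 < e -> x <= y + e) -> x <= y.
Proof. by move=> H; apply/ler_addgt0Pr. Qed.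

(* right upper Dini derivative at most 0, and left closedness in place of
   left continuity *)
Lemma dini_le (g : R -> R) :
  (forall s, 0 <= s -> forall e, 0 < e ->
     exists2 d, 0 < d & forall r, 0 < r -> r < d -> g (s + r) <= g s + e * r) ->
  (forall s C, 0 < s -> (forall r, 0 <= r -> r < s -> g r <= C) -> g s <= C) ->
  forall t, 0 <= t -> g t <= g 0.
Proof.
move=> gd gl t t0; apply: ler_gtP => e0 e00.
have [->|tn0] := eqVneq t 0; first by rewrite lerDl ltW.
have tp : 0 < t by rewrite lt_def tn0.
pose e := e0 / t.
have ep : 0 < e by rewrite divr_gt0.
have -> : e0 = e * t by rewrite /e mulfVK.
(* Continuous induction: left closedness puts the supremum of [E] into [E], and the Dini bound
   pushes beyond it unless it is [t]. The slope [e = e0 / t] spreads the allowed error [e0] over the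
   interval. *)
pose E : set R := [set s | [/\ 0 <= s, s <= t &
  forall r, 0 <= r -> r <= s -> g r <= g 0 + e * r]].
have E0 : E 0.
  split => // r r0 rl; have -> : r = 0 by apply/le_anti; rewrite r0 rl.
  by rewrite mulr0 addr0.
have Eb : has_sup E by split; [exists 0|exists t => s [_ st _]].
pose s := sup E.
have s0 : 0 <= s by apply: (sup_upper_bound Eb); exact: E0.
have st : s <= t by apply: ge_sup; [exact: (proj1 Eb)|move=> x []].
have Elt r : 0 <= r -> r < s -> g r <= g 0 + e * r.
  move=> r0 rs; have rs' : 0 < s - r by rewrite subr_gt0.
  have [x [x0 xt Hx]] := sup_adherent rs' Eb.
  by rewrite opprB addrCA subrr addr0 => /ltW rx; exact: Hx.
have Es : g s <= g 0 + e * s.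
  have [s00|sn] := eqVneq s 0; first by rewrite s00 mulr0 addr0.
  apply: gl; first by rewrite lt_def sn.
  move=> r r0 rs; apply: le_trans (Elt r r0 rs) _.
  by rewrite lerD2l ler_pM2l// ltW.
have [->|sn] := eqVneq t s; first exact: Es.
have sltt : s < t by rewrite lt_def sn.
have [d d0 Hd] := gd s s0 e ep.
pose r := Num.min (d / 2) (t - s).
have r0 : 0 < r by rewrite lt_min divr_gt0//= subr_gt0.
have rd : r < d.
  apply: le_lt_trans (_ : d / 2 < d); first by rewrite ge_min lexx.
  by rewrite ltr_pdivrMr// ltr_pMr// ltr1n.
have : E (s + r).
  split; first by rewrite addr_ge0// ltW.
    by rewrite -lerBrDl ge_min lexx orbT.
  move=> x x0 xs; have [xlt|] := ltP x s; first exact: Elt.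
  rewrite le_eqVlt => /orP[/eqP <-//|sx].
  have -> : x = s + (x - s) by rewrite addrCA subrr addr0.
  have := Hd (x - s); rewrite subr_gt0 => /(_ sx) H.
  apply: le_trans (H _) _; first by apply: le_lt_trans rd; rewrite lerBlDl.
  by move: Es; lra.
move=> /(sup_upper_bound Eb); rewrite -/s => Es2.
by move: Es2 r0; lra.
Qed.

End RealLimits.

(** * Hilbert spaces *)

(** A predicate on a bare form, so that the scalars, [l2ip], [hsip] and product forms share one
    theory without a norm structure on the carriers. *)
Record hilbert (R : realType) (V : lmodType R[i]) (ip : V -> V -> R[i]) : Prop :=
  Hilbert {
    ip_lin : forall a x y z, ip (a *: x + y) z = a * ip x z + ip y z;
    ip_conj : forall x y, ip y x = ((ip x y)^*)%R;
    ip_ge0 : forall x, 0 <= complex.Re (ip x x);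
    ip_eq0 : forall x, complex.Re (ip x x) = 0 -> x = 0;
    hcomplete : forall u : nat -> V,
      (forall e : R, 0 < e -> exists N, forall n k,
         (N <= n)%N -> (N <= k)%N -> hnorm ip (u n - u k) < e) ->
      exists x, hcvg ip u x }.

Lemma conjR (R : realType) (x : R) : ((x%:C)^*)%R = x%:C.
Proof. by apply/eqP; rewrite eq_complex/= oppr0 !eqxx. Qed.

Section HilbertTheory.
Context (R : realType) (V : lmodType R[i]) (ip : V -> V -> R[i]).
Context (hV : hilbert ip).
Local Notation Re := complex.Re.
Local Notation Im := complex.Im.
Local Notation "N[ x ]" := (hnorm ip x) (at level 0, format "N[ x ]").
Local Notation rip x y := (Re (ip x y)).
Implicit Types (x y z : V) (a : R).

Lemma ipD x y z : ip (x + y) z = ip x z + ip y z.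
Proof. by have := ip_lin hV 1 x y z; rewrite scale1r mul1r. Qed.

Lemma ip0 z : ip 0 z = 0.
Proof. by apply: (addIr (ip 0 z)); rewrite -ipD !add0r. Qed.

Lemma ipZ (c : R[i]) x z : ip (c *: x) z = c * ip x z.
Proof. by have := ip_lin hV c x 0 z; rewrite !addr0 ip0 addr0. Qed.

Lemma ipN x z : ip (- x) z = - ip x z.
Proof. by rewrite -scaleN1r ipZ mulN1r. Qed.

Lemma ipB x y z : ip (x - y) z = ip x z - ip y z.
Proof. by rewrite ipD ipN. Qed.

Lemma ip0r z : ip z 0 = 0.
Proof. by rewrite (ip_conj hV) ip0 rmorph0. Qed.

Lemma ipDr x y z : ip x (y + z) = ip x y + ip x z.
Proof. by rewrite (ip_conj hV) ipD rmorphD/= -!(ip_conj hV). Qed.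

Lemma ipZr (c : R[i]) x z : ip x (c *: z) = c^* * ip x z.
Proof. by rewrite (ip_conj hV) ipZ rmorphM/= -!(ip_conj hV). Qed.

Lemma ipZrR a x z : ip x (a%:C *: z) = a%:C * ip x z.
Proof. by rewrite ipZr; congr (_ * _); exact: conjR. Qed.

Lemma ipNr x z : ip x (- z) = - ip x z.
Proof. by rewrite (ip_conj hV) ipN rmorphN/= -!(ip_conj hV). Qed.

Lemma ipBr x y z : ip x (y - z) = ip x y - ip x z.
Proof. by rewrite ipDr ipNr. Qed.

Lemma ip_sum (I : Type) (r : seq I) (F : I -> V) z :
  ip (\sum_(i <- r) F i) z = \sum_(i <- r) ip (F i) z.
Proof. by apply: (big_morph (ip^~ z)) => [x y|]; rewrite ?ipD ?ip0. Qed.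

Lemma ReZ a (z : R[i]) : Re (a%:C * z) = a * Re z.
Proof. by case: z => c d /=; rewrite mul0r subr0. Qed.

Lemma rip_sym x y : rip x y = rip y x.
Proof. by rewrite (ip_conj hV x y); case: (ip x y). Qed.

Lemma Im_ip_self x : Im (ip x x) = 0.
Proof.
have := ip_conj hV x x; case: (ip x x) => a b [] /= H; lra.
Qed.

Lemma ip_self x : ip x x = (rip x x)%:C.
Proof. by have := Im_ip_self x; case: (ip x x) => a b /= ->. Qed.

Lemma rip_Zl a x y : rip (a%:C *: x) y = a * rip x y.
Proof. by rewrite ipZ ReZ. Qed.

Lemma rip_Zr a x y : rip x (a%:C *: y) = a * rip x y.
Proof. by rewrite rip_sym rip_Zl rip_sym. Qed.

Lemma rip_Dl x y z : rip (x + y) z = rip x z + rip y z.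
Proof. by rewrite ipD raddfD. Qed.
Lemma rip_Dr x y z : rip z (x + y) = rip z x + rip z y.
Proof. by rewrite ipDr raddfD. Qed.
Lemma rip_Nl x z : rip (- x) z = - rip x z.
Proof. by rewrite ipN raddfN. Qed.
Lemma rip_Nr x z : rip z (- x) = - rip z x.
Proof. by rewrite ipNr raddfN. Qed.
Lemma rip_Bl x y z : rip (x - y) z = rip x z - rip y z.
Proof. by rewrite rip_Dl rip_Nl. Qed.
Lemma rip_Br x y z : rip z (x - y) = rip z x - rip z y.
Proof. by rewrite rip_Dr rip_Nr. Qed.
Definition ripE := (rip_Dl, rip_Dr, rip_Nl, rip_Nr, rip_Zl, rip_Zr).

Lemma Im_ip x y : Im (ip x y) = rip x ('i *: y).
Proof. by rewrite ipZr; case: (ip x y) => c d /=; ring. Qed.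

(** The imaginary part of [ip x y] is the real part of [ip x ('i *: y)]. Complex identities thus
    reduce to real ones, for which limits of real sequences are available. *)
Lemma ip_ext x y x' y' : (forall c : R[i], rip x (c *: y) = rip x' (c *: y')) ->
  ip x y = ip x' y'.
Proof.
move=> H; apply/eqP; rewrite eq_complex !Im_ip H eqxx andbT.
by have := H 1; rewrite !scale1r => ->.
Qed.

Lemma hnorm_sqr x : N[x] ^+ 2 = rip x x.
Proof. by rewrite /hnorm sqr_sqrtr// (ip_ge0 hV). Qed.

Lemma hnorm_ge0 x : 0 <= N[x].
Proof. exact: sqrtr_ge0. Qed.

Lemma hnorm_le_of_sqr x y : N[x] ^+ 2 <= N[y] ^+ 2 -> N[x] <= N[y].
Proof. by rewrite ler_pXn2r// ?nnegrE ?hnorm_ge0. Qed.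

Lemma hnorm0 : N[0] = 0.
Proof. by rewrite /hnorm ip0 sqrtr0. Qed.

Lemma hnorm0_eq0 x : N[x] = 0 -> x = 0.
Proof. by move=> H; apply: (ip_eq0 hV); rewrite -hnorm_sqr H expr0n. Qed.

Lemma hnorm_le (x : V) a : 0 <= a -> rip x x <= a ^+ 2 -> N[x] <= a.
Proof.
move=> a0 H; rewrite -(@ler_pXn2r _ 2)// ?nnegrE ?hnorm_ge0//.
by rewrite hnorm_sqr.
Qed.

Lemma hnormN x : N[- x] = N[x].
Proof. by rewrite /hnorm rip_Nl rip_Nr opprK. Qed.

Lemma hnormBC x y : N[x - y] = N[y - x].
Proof. by rewrite -hnormN opprB. Qed.

Lemma hnormZ a x : N[a%:C *: x] = `|a| * N[x].
Proof.
rewrite /hnorm rip_Zl rip_Zr mulrA -expr2 sqrtrM ?sqr_ge0//.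
by rewrite sqrtr_sqr.
Qed.

Lemma hnormZC (c : R[i]) x : N[c *: x] ^+ 2 = sqmod c * N[x] ^+ 2.
Proof.
by rewrite !hnorm_sqr ipZ ipZr (ip_self x); case: c => a b; rewrite /sqmod /=; ring.
Qed.

Lemma hnormZsqrt (c : R[i]) x : N[c *: x] = Num.sqrt (sqmod c) * N[x].
Proof.
rewrite /hnorm -sqrtrM ?sqmod_ge0//; congr Num.sqrt.
by rewrite -!hnorm_sqr hnormZC.
Qed.

Lemma CS x y : rip x y <= N[x] * N[y].
Proof.
have [y0|yn0] := eqVneq (N[y]) 0.
  by rewrite (hnorm0_eq0 y0) ip0r hnorm0 mulr0.
have [x0|xn0] := eqVneq (N[x]) 0.
  by rewrite (hnorm0_eq0 x0) ip0 hnorm0 mul0r.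
have yp : 0 < N[y] by rewrite lt_def yn0 hnorm_ge0.
have xp : 0 < N[x] by rewrite lt_def xn0 hnorm_ge0.
have := ip_ge0 hV (N[y]%:C *: x - N[x]%:C *: y).
rewrite !ripE (rip_sym y x) -!hnorm_sqr => H.
have {}H : 0 <= 2 * (N[x] * N[y]) * (N[x] * N[y] - rip x y) by move: H; nra.
by move: H; rewrite pmulr_rge0 ?subr_ge0// !mulr_gt0.
Qed.

Lemma CSN x y : `|rip x y| <= N[x] * N[y].
Proof. by rewrite ler_norml CS andbT lerNl -rip_Nl -(hnormN x) CS. Qed.

Lemma ler_hnormD x y : N[x + y] <= N[x] + N[y].
Proof.
apply: hnorm_le; first by rewrite addr_ge0 ?hnorm_ge0.
rewrite !ripE (rip_sym y x) sqrrD !hnorm_sqr; have := CS x y; lra.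
Qed.

Lemma ler_hnormB x y : N[x - y] <= N[x] + N[y].
Proof. by rewrite -(hnormN y) ler_hnormD. Qed.

Lemma ler_hdistD z x y : N[x - y] <= N[x - z] + N[z - y].
Proof. by rewrite (_ : x - y = (x - z) + (z - y)) ?ler_hnormD// addrA subrK. Qed.

Lemma ler_hnorm_dist x y : `|N[x] - N[y]| <= N[x - y].
Proof.
rewrite ler_norml; apply/andP; split.
  rewrite lerNl opprB lerBlDr hnormBC.
  by rewrite -{1}(subrK x y) ler_hnormD.
by rewrite lerBlDr -{1}(subrK y x) ler_hnormD.
Qed.

Implicit Types (u v : nat -> V).

Lemma hcvgP u x : hcvg ip u x <->
  (forall e : R, 0 < e -> exists N, forall n, (N <= n)%N -> N[u n - x] < e).
Proof.
rewrite /hcvg cvgn0P; split=> H e /H[N HN]; exists N => n /HN.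
all: by rewrite ger0_norm ?hnorm_ge0.
Qed.

Lemma hcvg_uniq u x y : hcvg ip u x -> hcvg ip u y -> x = y.
Proof.
move=> /hcvgP ux /hcvgP uy; apply/eqP; rewrite -subr_eq0; apply/eqP.
apply: hnorm0_eq0; apply/le_anti; rewrite hnorm_ge0 andbT.
apply: ler_gtP => e e0; rewrite add0r.
have e2 : 0 < e / 2 by rewrite divr_gt0.
have [N HN] := ux _ e2; have [N' HN'] := uy _ e2.
apply: le_trans (ler_hdistD (u (maxn N N')) _ _) _.
rewrite (splitr e) hnormBC; apply: lerD; apply: ltW.
  by apply: HN; rewrite leq_maxl.
by apply: HN'; rewrite leq_maxr.
Qed.

Lemma hcvg_cst x : hcvg ip (fun=> x) x.
Proof. by apply/hcvgP => e e0; exists 0%N => n _; rewrite subrr hnorm0. Qed.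

Lemma hcvg_le u x (f : nat -> R) : (forall n, N[u n - x] <= f n) ->
  (f @ \oo --> (0 : R)) -> hcvg ip u x.
Proof.
move=> uf f0; apply/hcvgP => e e0; have [N HN] := (cvgn0P f).1 f0 _ e0.
by exists N => n /HN; apply: le_lt_trans; apply: le_trans (uf n) (ler_norm _).
Qed.

Lemma hcvg_lin (a b : R[i]) u v x y : hcvg ip u x -> hcvg ip v y ->
  hcvg ip (fun n => a *: u n + b *: v n) (a *: x + b *: y).
Proof.
move=> ux vy.
apply: (@hcvg_le _ _ (fun n => Num.sqrt (sqmod a) * N[u n - x]
  + Num.sqrt (sqmod b) * N[v n - y])) => [n|].
  rewrite opprD addrACA -!scalerBr -!hnormZsqrt; exact: ler_hnormD.
have -> : (0 : R) = Num.sqrt (sqmod a) * 0 + Num.sqrt (sqmod b) * 0.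
  by rewrite !mulr0 addr0.
by apply: cvgnD; apply: cvgnZ; [exact: ux|exact: vy].
Qed.

Lemma hcvgD u v x y : hcvg ip u x -> hcvg ip v y ->
  hcvg ip (fun n => u n + v n) (x + y).
Proof.
move=> ux vy; have := hcvg_lin 1 1 ux vy; rewrite !scale1r.
by congr hcvg; apply/funext => n; rewrite !scale1r.
Qed.

Lemma hcvgB u v x y : hcvg ip u x -> hcvg ip v y ->
  hcvg ip (fun n => u n - v n) (x - y).
Proof.
move=> ux vy; have := hcvg_lin 1 (-1) ux vy; rewrite !scale1r scaleN1r.
by congr hcvg; apply/funext => n; rewrite scale1r scaleN1r.
Qed.

Lemma hcvgZ (a : R[i]) u x : hcvg ip u x -> hcvg ip (fun n => a *: u n) (a *: x).
Proof.
move=> ux; have := hcvg_lin a 0 ux (hcvg_cst 0); rewrite ?scaler0 addr0.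
by congr hcvg; apply/funext => n; rewrite ?scaler0 addr0.
Qed.

Lemma hcvg_cauchy u x : hcvg ip u x -> forall e : R, 0 < e -> exists N,
  forall n k, (N <= n)%N -> (N <= k)%N -> N[u n - u k] < e.
Proof.
move=> /hcvgP ux e e0; have e2 : 0 < e / 2 by rewrite divr_gt0.
have [N HN] := ux _ e2; exists N => n k Nn Nk.
apply: le_lt_trans (ler_hdistD x _ _) _; rewrite (splitr e) (hnormBC x).
by apply: ltrD; apply: HN.
Qed.

(** A monotone bounded scalar sequence controls the distances. It serves with [k = 2] for energies
    and orthogonal sums, and with [k = 1] for dominated series. *)
Lemma bounded_increments_cvg (F : nat -> R) (M c : R) k u : (0 < k)%N -> 0 < c ->
  (forall n, F n <= M) ->
  (forall n p, (n <= p)%N -> c * N[u p - u n] ^+ k <= F p - F n) ->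
  exists x, hcvg ip u x.
Proof.
move=> k0 c0 FM uF; have [l Fl] : exists l : R, F @ \oo --> l.
  exists (limn F); apply: nondecreasing_is_cvgn; last by exists M => _ [n _ <-].
  move=> n p /uF H; rewrite -subr_ge0; apply: le_trans H.
  by rewrite mulr_ge0 ?(ltW c0)// exprn_ge0 ?hnorm_ge0.
apply: (hcomplete hV) => e e0.
have d0 : 0 < c * e ^+ k / 2 by rewrite divr_gt0// mulr_gt0// exprn_gt0.
have [N HN] := (cvgn_subP _ _).1 Fl _ d0.
suff K n p : (N <= n)%N -> (n <= p)%N -> N[u p - u n] < e.
  exists N => n p Nn Np; have [np|/ltnW pn] := leqP n p; last exact: K.
  by rewrite hnormBC; exact: K.
move=> Nn np; rewrite -(@ltr_pXn2r _ k)// ?nnegrE ?hnorm_ge0 ?(ltW e0)// -(ltr_pM2l c0).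
apply: le_lt_trans (uF _ _ np) _; have := HN n Nn; have := HN p (leq_trans Nn np).
rewrite !ltr_norml; set E := c * _; move=> /andP[? ?] /andP[? ?]; lra.
Qed.

Lemma hcvg_hnorm u x : hcvg ip u x -> (fun n => N[u n]) @ \oo --> N[x].
Proof.
move=> /hcvgP ux; apply/cvgn_subP => e /ux[N HN]; exists N => n /HN.
exact: le_lt_trans (ler_hnorm_dist _ _).
Qed.

Lemma hcvg_bounded u x : hcvg ip u x -> exists N, forall n, (N <= n)%N ->
  N[u n] <= N[x] + 1.
Proof.
move=> /hcvgP ux; have [N HN] := ux 1 ltr01; exists N => n /HN/ltW.
by rewrite -lerBlDl; apply: le_trans (le_trans (ler_norm _) (ler_hnorm_dist _ _)).
Qed.

Lemma hcvg_rip u v x y : hcvg ip u x -> hcvg ip v y ->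
  (fun n => rip (u n) (v n)) @ \oo --> rip x y.
Proof.
move=> ux vy; apply/cvgn_subP => e e0.
have [N0 HN0] := hcvg_bounded vy.
have K0 : 0 < N[y] + 1 + N[x] + 1 by have := hnorm_ge0 x; have := hnorm_ge0 y; lra.
have e2 : 0 < e / 2 / (N[y] + 1 + N[x] + 1) by rewrite !divr_gt0.
have [N1 HN1] := (hcvgP _ _).1 ux _ e2; have [N2 HN2] := (hcvgP _ _).1 vy _ e2.
exists (maxn N0 (maxn N1 N2)) => n; rewrite !geq_max => /and3P[n0 n1 n2].
have -> : rip (u n) (v n) - rip x y = rip (u n - x) (v n) + rip x (v n - y).
  rewrite !ripE; ring.
apply: le_lt_trans (ler_normD _ _) _.
apply: le_lt_trans (lerD (CSN _ _) (CSN _ _)) _.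
have a1 := HN1 _ n1; have a2 := HN2 _ n2; have a0 := HN0 _ n0.
have := hnorm_ge0 (v n - y); have := hnorm_ge0 (u n - x).
have := hnorm_ge0 x; have := hnorm_ge0 y; have := hnorm_ge0 (v n).
move: a0 a1 a2.
set X := N[x]; set Y := N[y]; set K := Y + 1 + X + 1; set A := N[u n - x].
set B := N[v n - y]; set C := N[v n] => CY.
rewrite !ltr_pdivlMr// => a1 a2 C0 Y0 X0 A0 B0.
have : A * C <= A * K by apply: ler_wpM2l => //; rewrite /K; lra.
have : X * B <= B * K by rewrite mulrC; apply: ler_wpM2l => //; rewrite /K; lra.
move: a1 a2; set AK := A * K; set BK := B * K; lra.
Qed.

Lemma hcvg_hnorm_le u x a : hcvg ip u x -> (forall n, N[u n] <= a) -> N[x] <= a.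
Proof.
by move=> ux ua; apply: cvgn_le (hcvg_hnorm ux) (cvg_cst a) _; exists 0%N => n _.
Qed.

End HilbertTheory.

(** * Semigroups generated by positive self-adjoint operators *)

Section Accretive.
Context (R : realType) (V : lmodType R[i]) (ip : V -> V -> R[i]).

(** Symmetry, positivity, density and surjectivity of [1 + e A] amount to positive self-adjointness.
    In this form the range condition is what Galerkin approximation supplies and what the Euler
    scheme consumes, and the spectral theorem is avoided. *)
Record accretive (A : oper V) : Prop := Accretive {
  acc_lin : forall a x y x' y', A (x, y) -> A (x', y') ->
    A (a *: x + x', a *: y + y');
  acc_sym : forall x y x' y', A (x, y) -> A (x', y') -> ip y x' = ip x y';
  acc_pos : forall x y, A (x, y) -> 0 <= complex.Re (ip y x);
  acc_dense : opdense ip A;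
  acc_range : forall e : R, 0 < e -> forall y, exists x z,
    A (x, z) /\ x + e%:C *: z = y }.

(** The case [e <= 0] covers time 0 of the Euler scheme: at [e = 0] the defining equation would have
    solutions only for [y] in the domain. *)
Definition resolvent (A : oper V) (e : R) (y : V) : V :=
  if e <= 0 then y
  else xget 0 [set x | exists2 z, A (x, z) & x + e%:C *: z = y].

End Accretive.

Lemma subrACA (V : zmodType) (a b c d : V) : (a - b) - (c - d) = (a - c) - (b - d).
Proof. by rewrite !opprB addrACA [RHS]addrACA [in RHS](addrC (- c)). Qed.

Section HilleYosida.
Context (R : realType) (V : lmodType R[i]) (ip : V -> V -> R[i]).
Context (hV : hilbert ip) (A : oper V) (hA : accretive ip A).
Local Notation Re := complex.Re.
Local Notation "N[ x ]" := (hnorm ip x) (at level 0, format "N[ x ]").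
Local Notation rip x y := (Re (ip x y)).
Local Notation res := (resolvent A).
Implicit Types (x y z : V) (a b e s t : R).

Lemma acc0 : A (0, 0).
Proof.
have [x [z [Axz _]]] := acc_range hA ltr01 0.
by have := acc_lin hA (-1) Axz Axz; rewrite !scaleN1r !addNr.
Qed.

Lemma accZ c x y : A (x, y) -> A (c *: x, c *: y).
Proof. by move=> Axy; have := acc_lin hA c Axy acc0; rewrite !addr0. Qed.

Lemma accB x y x' y' : A (x, y) -> A (x', y') -> A (x - x', y - y').
Proof.
by move=> H H'; have := acc_lin hA (-1) H' H; rewrite !scaleN1r ![- _ + _]addrC.
Qed.

Lemma acc_norm x z e : A (x, z) -> 0 <= e -> N[x] <= N[x + e%:C *: z].
Proof.
move=> Axz e0; apply: (hnorm_le hV); first exact: hnorm_ge0.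
rewrite hnorm_sqr// !(ripE hV) (rip_sym hV x z).
have := acc_pos hA Axz; have := ip_ge0 hV z; nra.
Qed.

Lemma res0 e x : e <= 0 -> res e x = x.
Proof. by rewrite /resolvent => ->. Qed.

Lemma resP e y : 0 < e -> exists2 z, A (res e y, z) & res e y + e%:C *: z = y.
Proof.
move=> e0; rewrite /resolvent leNgt e0 /=.
have [x [z [Axz xz]]] := acc_range hA e0 y.
by case: xgetP => [u _ //|/(_ x)] /= []; exists z.
Qed.

Lemma res_uniq e x z : 0 <= e -> A (x, z) -> res e (x + e%:C *: z) = x.
Proof.
rewrite le_eqVlt => /orP[/eqP <-|e0] Axz; first by rewrite res0// scale0r addr0.
have [z' Az' zz'] := resP (x + e%:C *: z) e0.
apply/eqP; rewrite -subr_eq0; apply/eqP/(hnorm0_eq0 hV)/le_anti.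
rewrite (hnorm_ge0) andbT; apply: le_trans (acc_norm (accB Az' Axz) (ltW e0)) _.
by rewrite scalerBr addrACA -opprD zz' subrr hnorm0.
Qed.

Lemma res_lin e : 0 <= e -> forall c x y, res e (c *: x + y) = c *: res e x + res e y.
Proof.
rewrite le_eqVlt => /orP[/eqP <-|e0] c x y; first by rewrite !res0.
have [x' Ax xx'] := resP x e0; have [y' Ay yy'] := resP y e0.
rewrite -{1}xx' -{1}yy' -[RHS](res_uniq (ltW e0) (acc_lin hA c Ax Ay)).
by congr (res _ _); rewrite !scalerDr !scalerA (mulrC c) addrACA.
Qed.

Lemma resZ e c x : 0 <= e -> res e (c *: x) = c *: res e x.
Proof.
move=> e0; have r0 : res e 0 = 0.
  by have := res_lin e0 (-1) 0 0; rewrite scaleN1r addNr scaleN1r addNr.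
by have := res_lin e0 c x 0; rewrite !addr0 r0 addr0.
Qed.

Lemma resD e x y : 0 <= e -> res e (x + y) = res e x + res e y.
Proof. by move=> e0; have := res_lin e0 1 x y; rewrite !scale1r. Qed.

Lemma resB e x y : 0 <= e -> res e (x - y) = res e x - res e y.
Proof. by move=> e0; rewrite -scaleN1r resD// resZ// scaleN1r. Qed.

Lemma res_norm e x : 0 <= e -> N[res e x] <= N[x].
Proof.
rewrite le_eqVlt => /orP[/eqP <-|e0]; first by rewrite res0.
have [z Az xz] := resP x e0; rewrite -{2}xz; exact: acc_norm Az (ltW e0).
Qed.

Lemma res_sym e x y : 0 <= e -> ip (res e x) y = ip x (res e y).
Proof.
rewrite le_eqVlt => /orP[/eqP <-|e0]; first by rewrite !res0.
have [x' Ax xx'] := resP x e0; have [y' Ay yy'] := resP y e0.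
rewrite -{2}xx' -{1}yy' (ipDr hV) (ipD hV) (ipZrR hV) (ipZ hV).
by rewrite (acc_sym hA Ax Ay).
Qed.

Lemma res_acc e x y : 0 <= e -> A (x, y) -> A (res e x, res e y).
Proof.
rewrite le_eqVlt => /orP[/eqP <-|e0] Axy; first by rewrite !res0.
have [w Aw xw] := resP x e0.
(* The vector [w = (x - res e x) / e] lies in the domain with image [(y - w) / e]; hence [w] solves
   the resolvent equation with right side [y]. *)
have Hd := accZ (e^-1)%:C (accB Axy Aw).
have xE : (e^-1)%:C *: (x - res e x) = w.
  by rewrite -{1}xw addrAC subrr add0r scalerA -rmorphM/= mulVf ?gt_eqF// scale1r.
rewrite xE in Hd; have := res_uniq (ltW e0) Hd.
rewrite scalerA -rmorphM/= divff ?gt_eqF// scale1r addrC subrK => ->.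
exact: Aw.
Qed.

Lemma res_step e x y : 0 <= e -> A (x, y) -> x = res e x + e%:C *: res e y.
Proof.
move=> e0 Axy; have := res_uniq e0 Axy.
by rewrite resD// resZ// => ->.
Qed.

Lemma res_comm a b x : 0 <= a -> 0 <= b -> res a (res b x) = res b (res a x).
Proof.
move=> a0; rewrite le_eqVlt => /orP[/eqP <-|b0]; first by rewrite !(res0 _ (lexx 0)).
have [z Az xz] := resP x b0.
rewrite -{2}xz resD// resZ//; rewrite (res_uniq (ltW b0))//.
exact: res_acc.
Qed.

(* consistency of the implicit Euler scheme *)
Lemma res_split a b x y z : 0 <= a -> 0 <= b -> A (x, y) -> A (y, z) ->
  N[res (a + b) x - res a (res b x)] <= a * b * N[z].
Proof.
move=> a0 b0 Axy Ayz; have ab0 := addr_ge0 a0 b0.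
pose c := a + b; pose w := res a (res b z).
suff -> : res c x - res a (res b x) = (a * b)%:C *: res c w.
  rewrite (hnormZ hV) ger0_norm ?mulr_ge0// ler_wpM2l ?mulr_ge0//.
  by apply: le_trans (res_norm _ ab0) _; apply: le_trans (res_norm _ a0) (res_norm _ b0).
set p := res a (res b x); set q := res a (res b y).
have Apq : A (p, q) by do 2!apply: res_acc => //.
(* As [q] and [w] are the images of [p] under [A] and [A^2], this expands [(1 + a A) (1 + b A) p]. A
   single step of size [c] accounts for all but the last term. *)
have xE : x = p + c%:C *: q + (a * b)%:C *: w.
  rewrite {1}(res_step b0 Axy) (res_step a0 (res_acc b0 Axy)) -/p -/q.
  rewrite (res_step a0 (res_acc b0 Ayz)) -/q -/w scalerDr scalerA -rmorphM/=.
  by rewrite /c rmorphD/= scalerDl (mulrC b) !addrA.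
by rewrite {1}xE resD// (res_uniq _ Apq)// resZ// addrAC subrr add0r.
Qed.

Lemma iter_norm (f : V -> V) n x : (forall y, N[f y] <= N[y]) -> N[iter n f x] <= N[x].
Proof. by move=> H; elim: n => //= n; apply: le_trans (H _). Qed.

Lemma iter_res_acc e n x y : 0 <= e -> A (x, y) ->
  A (iter n (res e) x, iter n (res e) y).
Proof. by move=> e0 Axy; elim: n => //= n; apply: res_acc. Qed.

Lemma iter_resB e n x y : 0 <= e ->
  iter n (res e) (x - y) = iter n (res e) x - iter n (res e) y.
Proof. by move=> e0; elim: n => //= n ->; rewrite resB. Qed.

Lemma iter_res_comm a b n x : 0 <= a -> 0 <= b ->
  iter n (res a) (res b x) = res b (iter n (res a) x).
Proof. by move=> a0 b0; elim: n => //= n ->; rewrite res_comm. Qed.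

(** Resolvents are commuting contractions that preserve the domain of [A^2], so the [n] local
    defects simply add up. *)
Lemma iter_res_split a b n x y z : 0 <= a -> 0 <= b -> A (x, y) -> A (y, z) ->
  N[iter n (res (a + b)) x - iter n (res a) (iter n (res b) x)]
    <= n%:R * (a * b) * N[z].
Proof.
move=> a0 b0 Axy Ayz; have ab0 := addr_ge0 a0 b0.
elim: n => [|n IH]; first by rewrite /= subrr hnorm0// !mul0r.
rewrite [iter n.+1 (res a) _]iterS [iter n.+1 (res b) _]iterS (iter_res_comm _ _ a0 b0).
set u := iter n (res a) (iter n (res b) x) in IH *.
apply: le_trans (ler_hdistD hV (res (a + b) u) _ _) _.
rewrite -natr1 mulrDl mul1r mulrDl; apply: lerD.
  by rewrite iterS -resB//; apply: le_trans (res_norm _ ab0) IH.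
have Au : A (u, iter n (res a) (iter n (res b) y)) by do 2!(apply: iter_res_acc => //).
have Av : A (iter n (res a) (iter n (res b) y), iter n (res a) (iter n (res b) z)).
  by do 2!(apply: iter_res_acc => //).
apply: le_trans (res_split a0 b0 Au Av) _.
apply: ler_wpM2l; first by rewrite mulr_ge0.
apply: le_trans (iter_norm _ _ _) _; first by move=> ?; exact: res_norm.
by apply: iter_norm => ?; exact: res_norm.
Qed.

Lemma iter_res_dist e n x y : 0 <= e -> A (x, y) ->
  N[x - iter n (res e) x] <= n%:R * e * N[y].
Proof.
move=> e0 Axy; elim: n => [|n IH]; first by rewrite /= subrr hnorm0// !mul0r.
apply: le_trans (ler_hdistD hV (iter n (res e) x) _ _) _.
rewrite -natr1 mulrDl mul1r mulrDl; apply: lerD => //.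
have Au := iter_res_acc n e0 Axy.
rewrite /= {1}(res_step e0 Au) addrAC subrr add0r (hnormZ hV) ger0_norm//.
apply: ler_wpM2l => //; apply: le_trans (res_norm _ e0) _.
by apply: iter_norm => ?; exact: res_norm.
Qed.

Lemma res_approx x : forall d : R, 0 < d -> exists2 e0, 0 < e0 &
  forall e, 0 < e -> e < e0 -> N[x - res e x] < d.
Proof.
move=> d d0; have [u uD /hcvgP ux] := acc_dense hA x.
have d3 : 0 < d / 3 by rewrite divr_gt0.
have [n Hn] := ux _ d3; have {Hn} := Hn n (leqnn n).
have [y Ay] := uD n; set x' := u n in Ay *; rewrite (hnormBC hV) => xx'.
exists (d / 3 / (N[y] + 1)); first by rewrite divr_gt0// ltr_wpDl// hnorm_ge0.
move=> e e0; rewrite ltr_pdivlMr ?ltr_wpDl ?hnorm_ge0// => ed.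
apply: le_lt_trans (ler_hdistD hV x' _ _) _.
have H1 : N[x' - res e x] <= N[x' - res e x'] + N[res e x' - res e x].
  exact: ler_hdistD.
have H2 : N[x' - res e x'] <= e * N[y].
  by have := iter_res_dist 1 (ltW e0) Ay; rewrite mul1r.
have H3 : N[res e x' - res e x] <= N[x - x'].
  by rewrite -(resB _ _ (ltW e0)) (hnormBC hV x); exact: (res_norm _ (ltW e0)).
have : e * N[y] <= e * (N[y] + 1) by rewrite ler_pM2l// lerDl.
move: H1 H2 H3 xx' ed.
set A1 := N[x - x']; set A2 := N[x' - res e x]; set B1 := e * _; set B2 := e * _.
lra.
Qed.

(** Applying a resolvent twice lands in the domain of [A^2], where the consistency estimate of the
    scheme is available. *)
Lemma acc2_dense x (d : R) : 0 < d -> exists x' y z,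
  [/\ A (x', y), A (y, z) & N[x - x'] < d].
Proof.
move=> d0; have d2 : 0 < d / 2 by rewrite divr_gt0.
have [e0 e00 He] := res_approx x d2.
pose e := e0 / 2; have ep : 0 < e by rewrite divr_gt0.
have ee : e < e0 by rewrite /e ltr_pdivrMr// ltr_pMr// ltr1n.
have [y Ay yE] := resP x ep.
exists (res e (res e x)), (res e y).
have [z Az zE] := resP y ep.
exists z; split => //; first exact: res_acc (ltW ep) Ay.
apply: le_lt_trans (ler_hdistD hV (res e x) _ _) _; rewrite (splitr d).
apply: ltrD; first exact: He.
by rewrite -(resB _ _ (ltW ep)); apply: le_lt_trans (res_norm _ (ltW ep)) (He _ ep ee).
Qed.

(** With dyadic step counts, passing from [k] to [k.+1] replaces each step [h + h] by two steps [h],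
    the situation of [iter_res_split] with [a = b]. *)
Definition euler (k : nat) (t : R) : V -> V := iter (2 ^ k) (res (t / 2 ^+ k)).

Lemma dyad_ge0 t k : 0 <= t -> 0 <= t / 2 ^+ k.
Proof. by move=> t0; rewrite divr_ge0// exprn_ge0. Qed.

Lemma euler_norm k t x : 0 <= t -> N[euler k t x] <= N[x].
Proof. by move=> t0; apply: iter_norm => y; apply: res_norm; exact: dyad_ge0. Qed.

Lemma eulerB k t x y : 0 <= t -> euler k t (x - y) = euler k t x - euler k t y.
Proof. by move=> t0; apply: iter_resB; exact: dyad_ge0. Qed.

Lemma euler_lin k t c x y : 0 <= t ->
  euler k t (c *: x + y) = c *: euler k t x + euler k t y.
Proof.
move=> t0; rewrite /euler; elim: (2 ^ k)%N => //= n ->.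
by rewrite res_lin// dyad_ge0.
Qed.

Lemma euler_sym k t x y : 0 <= t -> ip (euler k t x) y = ip x (euler k t y).
Proof.
move=> t0; rewrite /euler; elim: (2 ^ k)%N x y => //= n IH x y.
rewrite res_sym ?dyad_ge0// IH; congr ip.
by rewrite iter_res_comm ?dyad_ge0.
Qed.

(** There are [2 ^ k] defects of size [h ^ 2 * N[z]] with [h = t / 2 ^ k.+1], which gives the
    constant [t ^ 2 / 4]. *)
Lemma euler_succ k t x y z : 0 <= t -> A (x, y) -> A (y, z) ->
  N[euler k t x - euler k.+1 t x] <= t ^+ 2 / 4 * N[z] * 2^-1 ^+ k.
Proof.
move=> t0 Axy Ayz; pose h := t / 2 ^+ k.+1.
have h0 : 0 <= h by exact: dyad_ge0.
have -> : euler k.+1 t x = iter (2 ^ k) (res h) (iter (2 ^ k) (res h) x).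
  by rewrite -iterD addnn -mul2n -expnS.
have kE : t / 2 ^+ k = h + h.
  rewrite /h exprS; have : (2 ^+ k : R) != 0 by rewrite expf_neq0// pnatr_eq0.
  by move: (2 ^+ k) => p p0; field.
rewrite /euler kE; apply: le_trans (iter_res_split (2 ^ k) h0 h0 Axy Ayz) _.
apply: ler_of_eq; rewrite /h natrX exprVn exprS.
have : (2 ^+ k : R) != 0 by rewrite expf_neq0// pnatr_eq0.
by move: (2 ^+ k) => p p0; field.
Qed.

Lemma euler_dist k l t x y z : 0 <= t -> A (x, y) -> A (y, z) -> (k <= l)%N ->
  N[euler k t x - euler l t x] <= t ^+ 2 / 2 * N[z] * 2^-1 ^+ k.
Proof.
move=> t0 Axy Ayz kl.
(* The bound by a difference makes the induction telescope: [t ^ 2 / 2] times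
   [2^-1 ^ j - 2^-1 ^ j.+1] is exactly the bound of [euler_succ] at [j]. *)
suff : N[euler k t x - euler l t x] <=
    t ^+ 2 / 2 * N[z] * (2^-1 ^+ k - 2^-1 ^+ l).
  move=> /le_trans; apply; rewrite mulrBr gerBl.
  by rewrite !mulr_ge0 ?sqr_ge0 ?hnorm_ge0 ?exprn_ge0 ?invr_ge0.
rewrite -(subnKC kl); elim: (l - k)%N => [|n IH].
  by rewrite addn0 !subrr hnorm0// mulr0.
rewrite addnS; apply: le_trans (ler_hdistD hV (euler (k + n) t x) _ _) _.
have := euler_succ (k + n) t0 Axy Ayz; move: IH.
rewrite [2^-1 ^+ (k + n).+1]exprS.
set P := N[_]; set Q := N[_]; set n1 := N[z].
set u := 2^-1 ^+ k; set w := 2^-1 ^+ (k + n).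
move=> H1 H2; apply: le_trans (lerD H1 H2) _.
apply: ler_of_eq; lra.
Qed.

Lemma half_cvg0 (c : R) : (fun k => c * 2^-1 ^+ k) @ \oo --> (0 : R).
Proof.
rewrite -(mulr0 c); apply: cvgnZ; apply: cvg_expr.
by rewrite ger0_norm ?invr_ge0 ?invf_lt1 ?ltr1n.
Qed.

Lemma euler_cvg t x : 0 <= t -> exists y, hcvg ip (fun k => euler k t x) y.
Proof.
move=> t0; apply: (hcomplete hV) => e e0.
have e3 : 0 < e / 3 by rewrite divr_gt0.
have [x' [y [z [Axy Ayz xx']]]] := acc2_dense x e3.
have [N HN] := (cvgn0P _).1 (half_cvg0 (t ^+ 2 / 2 * N[z])) _ e3.
suff H n k : (N <= n)%N -> (n <= k)%N -> N[euler n t x - euler k t x] < e.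
  exists N => n k Nn Nk; have [nk|/ltnW kn] := leqP n k; first exact: H.
  by rewrite hnormBC//; exact: H.
move=> Nn nk; apply: le_lt_trans (ler_hdistD hV (euler n t x') _ _) _.
have H1 : N[euler n t x - euler n t x'] < e / 3.
  by rewrite -eulerB//; apply: le_lt_trans xx'; exact: euler_norm.
have H2 : N[euler k t x' - euler k t x] < e / 3.
  rewrite -eulerB//; apply: le_lt_trans xx'; rewrite (hnormBC hV x).
  exact: euler_norm.
have H3 : N[euler n t x' - euler k t x'] < e / 3.
  apply: le_lt_trans (euler_dist t0 Axy Ayz nk) _.
  exact: le_lt_trans (ler_norm _) (HN n Nn).
have H4 : N[euler n t x' - euler k t x] <=
    N[euler n t x' - euler k t x'] + N[euler k t x' - euler k t x].
  exact: ler_hdistD.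
move: H1 H2 H3 H4; set P1 := N[_]; set P2 := N[_]; set P3 := N[_]; set P4 := N[_].
lra.
Qed.

Definition hysg (t : R) (x : V) : V :=
  xget 0 [set y | hcvg ip (fun k => euler k t x) y].

Lemma hysgP t x : 0 <= t -> hcvg ip (fun k => euler k t x) (hysg t x).
Proof.
move=> t0; have [y Hy] := euler_cvg x t0; rewrite /hysg.
by case: xgetP => [u _ //|/(_ y)] /=.
Qed.

Lemma hysg_norm t x : 0 <= t -> N[hysg t x] <= N[x].
Proof.
by move=> t0; apply: (hcvg_hnorm_le hV (hysgP x t0)) => n; exact: euler_norm.
Qed.

Lemma hysg_lin t c x y : 0 <= t -> hysg t (c *: x + y) = c *: hysg t x + hysg t y.
Proof.
move=> t0; apply: (hcvg_uniq hV) (hysgP _ t0) _.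
have := hcvgD hV (hcvgZ hV c (hysgP x t0)) (hysgP y t0).
by congr hcvg; apply/funext => k; rewrite euler_lin.
Qed.

Lemma hysgB t x y : 0 <= t -> hysg t (x - y) = hysg t x - hysg t y.
Proof. by move=> t0; rewrite addrC -scaleN1r hysg_lin// scaleN1r addrC. Qed.

Lemma hysgZ t c x : 0 <= t -> hysg t (c *: x) = c *: hysg t x.
Proof.
move=> t0; have h0 : hysg t 0 = 0.
  by have := hysg_lin (-1) 0 0 t0; rewrite scaleN1r addNr scaleN1r addNr.
by have := hysg_lin c x 0 t0; rewrite !addr0 h0 addr0.
Qed.

Lemma hysg_sym t x y : 0 <= t -> ip (hysg t x) y = ip x (hysg t y).
Proof.
move=> t0; apply: (ip_ext hV) => c; rewrite -hysgZ//; set z := c *: y.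
apply: cvgn_uniq (hcvg_rip hV (hysgP x t0) (hcvg_cst hV z)) _.
rewrite (_ : (fun n => _) = (fun n => rip x (euler n t z))).
  exact: (hcvg_rip hV (hcvg_cst hV x) (hysgP z t0)).
by apply/funext => k; rewrite euler_sym.
Qed.

Lemma hysg0 x : hysg 0 x = x.
Proof.
apply: (hcvg_uniq hV) (hysgP _ (lexx 0)) _.
have -> : (fun k => euler k 0 x) = fun=> x; last exact: hcvg_cst.
apply/funext => k; rewrite /euler mul0r; elim: (2 ^ k)%N => //= n ->.
by rewrite res0.
Qed.

Lemma hysg_dist t x y : 0 <= t -> A (x, y) -> N[x - hysg t x] <= t * N[y].
Proof.
move=> t0 Axy; apply: (hcvg_hnorm_le hV (hcvgB hV (hcvg_cst hV x) (hysgP x t0))) => k.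
apply: le_trans (iter_res_dist _ (dyad_ge0 k t0) Axy) _.
by rewrite natrX mulrCA divff ?mulr1 ?lexx// expf_neq0// pnatr_eq0.
Qed.

(** At [k = 0] the scheme is a single resolvent step. The error is quadratic in [t], so the
    semigroup and the resolvent have the same difference quotient at 0. *)
Lemma hysg_dist2 t x y z : 0 <= t -> A (x, y) -> A (y, z) ->
  N[res t x - hysg t x] <= t ^+ 2 / 2 * N[z].
Proof.
move=> t0 Axy Ayz.
apply: (hcvg_hnorm_le hV (hcvgB hV (hcvg_cst hV _) (hysgP x t0))) => k.
have := euler_dist t0 Axy Ayz (leq0n k).
by rewrite expr0 mulr1 {1}/euler expn0 expr0 divr1.
Qed.

Lemma dense_zero (f : V -> V) : (forall x y, f (x - y) = f x - f y) ->
  (exists M, forall x, N[f x] <= M * N[x]) ->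
  (forall x y z, A (x, y) -> A (y, z) -> f x = 0) -> forall x, f x = 0.
Proof.
move=> fB [M fM] f0 x; apply: (hnorm0_eq0 hV); apply/le_anti.
rewrite (hnorm_ge0) andbT; apply: ler_gtP => e e0; rewrite add0r.
have M1 : 0 < `|M| + 1 by rewrite ltr_wpDl.
have eM : 0 < e / (`|M| + 1) by rewrite divr_gt0.
have [x' [y [z [Axy Ayz xx']]]] := acc2_dense x eM.
rewrite -[f x]subr0 -(f0 _ _ _ Axy Ayz) -fB; apply: le_trans (fM _) _.
move: xx'; rewrite ltr_pdivlMr// => /ltW; apply: le_trans.
rewrite mulrC ler_wpM2l ?hnorm_ge0//.
by have := ler_norm M; lra.
Qed.

(** On the domain of [A^2], [iter_res_split] with steps [s / 2 ^ k] and [t / 2 ^ k] leaves an error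
    [s * t / 2 ^ k * N[z]]; density and contractivity do the rest. *)
Lemma hysg_add s t x : 0 <= s -> 0 <= t -> hysg (s + t) x = hysg s (hysg t x).
Proof.
move=> s0 t0; have st0 := addr_ge0 s0 t0; apply/eqP; rewrite -subr_eq0; apply/eqP.
apply: (@dense_zero (fun x => hysg (s + t) x - hysg s (hysg t x))).
- by move=> {}x y; rewrite !hysgB// subrACA.
- exists 2 => {}x; apply: le_trans (ler_hnormB hV _ _) _.
  rewrite mulr2n mulrDl mul1r; apply: lerD; first exact: hysg_norm.
  by apply: le_trans (hysg_norm _ s0) (hysg_norm _ t0).
move=> {}x y z Axy Ayz; apply/eqP; rewrite subr_eq0; apply/eqP.
apply: (hcvg_uniq hV) (hysgP _ st0) _.
apply: (@hcvg_le _ _ _ _ _ (fun k => s * t * N[z] * 2^-1 ^+ k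
   + (N[euler k t x - hysg t x] + N[euler k s (hysg t x) - hysg s (hysg t x)]))).
  move=> k; apply: le_trans (ler_hdistD hV (euler k s (euler k t x)) _ _) _.
  apply: lerD.
    rewrite /euler mulrDl.
    apply: le_trans (iter_res_split _ (dyad_ge0 k s0) (dyad_ge0 k t0) Axy Ayz) _.
    apply: ler_of_eq; rewrite natrX exprVn.
    have : (2 ^+ k : R) != 0 by rewrite expf_neq0// pnatr_eq0.
    by move: (2 ^+ k) => p p0; field.
  apply: le_trans (ler_hdistD hV (euler k s (hysg t x)) _ _) _.
  by rewrite lerD2r -eulerB//; exact: euler_norm.
rewrite -[0](addr0 0); apply: cvgnD; first exact: half_cvg0.
rewrite -[0](addr0 0); apply: cvgnD; exact: hysgP.
Qed.

End HilleYosida.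

(** * The generator of the constructed semigroup, and uniqueness *)

Section Generation.
Context (R : realType) (V : lmodType R[i]) (ip : V -> V -> R[i]).
Context (hV : hilbert ip) (A : oper V) (hA : accretive ip A).
Local Notation Re := complex.Re.
Local Notation "N[ x ]" := (hnorm ip x) (at level 0, format "N[ x ]").
Local Notation rip x y := (Re (ip x y)).
Local Notation res := (resolvent A).
Implicit Types (x y z : V) (a b e s t : R).

Lemma right_cvgP (f : R -> V) x :
  ((fun t => N[f t - x]) @ 0^'+ --> (0 : R)) <->
  (forall e, 0 < e -> exists2 d, 0 < d & forall t, 0 < t -> t < d -> N[f t - x] < e).
Proof.
split => [/cvg_right0P H|H].
  move=> e /H[d d0 Hd]; exists d => // t t0 td.
  exact: le_lt_trans (ler_norm _) (Hd t t0 td).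
apply/cvg_right0P => e /H[d d0 Hd]; exists d => // t t0 td.
by rewrite ger0_norm ?hnorm_ge0 ?Hd.
Qed.

Lemma neg_generatorP (T : R -> V -> V) x y : neg_generator ip T (x, y) <->
  (forall e, 0 < e -> exists2 d, 0 < d & forall t, 0 < t -> t < d ->
     N[t^-1%:C *: (x - T t x) - y] < e).
Proof. exact: (right_cvgP (fun t => t^-1%:C *: (x - T t x)) y). Qed.

Lemma hysg_c0 x : (fun t => N[hysg ip A t x - x]) @ 0^'+ --> (0 : R).
Proof.
apply/right_cvgP => e e0; have e3 : 0 < e / 3 by rewrite divr_gt0.
have [x' [y [z [Axy _ xx']]]] := acc2_dense hV hA x e3.
have y1 : 0 < N[y] + 1 by rewrite ltr_wpDl ?hnorm_ge0.
exists (e / 3 / (N[y] + 1)); first by rewrite divr_gt0.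
move=> t t0; rewrite ltr_pdivlMr// => td.
have H1 := ler_hdistD hV (hysg ip A t x') (hysg ip A t x) x.
have H2 := ler_hdistD hV x' (hysg ip A t x') x.
have H3 : N[hysg ip A t x - hysg ip A t x'] <= N[x - x'].
  by rewrite -(hysgB hV hA _ _ (ltW t0)); exact: hysg_norm (ltW t0).
have H4 : N[hysg ip A t x' - x'] <= t * N[y].
  by rewrite (hnormBC hV); exact: hysg_dist (ltW t0) Axy.
rewrite (hnormBC hV x' x) in H2.
have : t * N[y] <= t * (N[y] + 1) by rewrite ler_pM2l// lerDl.
move: H1 H2 H3 H4 xx' td; set B1 := t * _; set B2 := t * _.
lra.
Qed.

(** The quotient of the resolvent is exact: [(x - res t x) / t = res t y]. Only the distance from
    resolvent to semigroup remains. *)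
Lemma hysg_gen_le x y z t : 0 < t -> A (x, y) -> A (y, z) ->
  N[t^-1%:C *: (x - hysg ip A t x) - y] <= N[y - res t y] + t / 2 * N[z].
Proof.
move=> t0 Axy Ayz.
have E : t^-1%:C *: (x - res t x) = res t y.
  rewrite {1}(res_step hV hA (ltW t0) Axy) addrAC subrr add0r scalerA.
  by rewrite -rmorphM/= mulVf ?gt_eqF// scale1r.
apply: le_trans (ler_hdistD hV (res t y) _ _) _.
rewrite addrC (hnormBC hV y); apply: lerD => //.
rewrite -E -scalerBr opprB addrC addrA subrK (hnormZ hV) gtr0_norm ?invr_gt0//.
rewrite ler_pdivrMl//; apply: le_trans (hysg_dist2 hV hA (ltW t0) Axy Ayz) _.
by apply: ler_of_eq; field.
Qed.

(** The previous estimate needs the domain of [A^2], so [(x, y)] is replaced by its image under a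
    small resolvent. The quotient of the difference stays below [N[y - y']], uniformly in [t], by
    [hysg_dist]. *)
Lemma hysg_generator_sub : A `<=` neg_generator ip (hysg ip A).
Proof.
move=> [x y] Axy; apply/neg_generatorP => e e0.
have e4 : 0 < e / 4 by rewrite divr_gt0.
have [d0 d00 Hd0] := res_approx hV hA y e4.
pose r := d0 / 2; have r0 : 0 < r by rewrite divr_gt0.
have rd : r < d0 by rewrite ltr_pdivrMr// ltr_pMr// ltr1n.
have yy' := Hd0 r r0 rd; set y' := res r y in yy'.
have Axy' := res_acc hV hA (ltW r0) Axy; rewrite -/y' in Axy'.
set x' := res r x in Axy'.
have [z Ayz _] := resP hA y r0; rewrite -/y' in Ayz.
have [d1 d10 Hd1] := res_approx hV hA y' e4.
have z1 : 0 < N[z] + 1 by rewrite ltr_wpDl ?hnorm_ge0.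
exists (Num.min d1 (e / 4 / (N[z] + 1))).
  by rewrite lt_min d10/= divr_gt0.
move=> t t0; rewrite lt_min => /andP[td1]; rewrite ltr_pdivlMr// => td2.
have E : t^-1%:C *: (x - hysg ip A t x) - y = (t^-1%:C *: (x' - hysg ip A t x') - y')
    + (t^-1%:C *: ((x - x') - hysg ip A t (x - x')) - (y - y')).
  rewrite (hysgB hV hA _ _ (ltW t0)) (subrACA x).
  by rewrite (scalerBr _ (x - _)) (subrACA (_ *: _) (_ *: _)) [RHS]addrC subrK.
rewrite E; apply: le_lt_trans (ler_hnormD hV _ _) _.
have H1 := hysg_gen_le t0 Axy' Ayz; have H2 := Hd1 t t0 td1.
have H3 := ler_hnormB hV (t^-1%:C *: ((x - x') - hysg ip A t (x - x'))) (y - y').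
have H4 : N[t^-1%:C *: ((x - x') - hysg ip A t (x - x'))] <= N[y - y'].
  rewrite (hnormZ hV) gtr0_norm ?invr_gt0// ler_pdivrMl//.
  exact: (hysg_dist hV hA (ltW t0) (accB hA Axy Axy')).
have : t * N[z] <= t * (N[z] + 1) by rewrite ler_pM2l// lerDl.
have : t / 2 * N[z] <= t * N[z].
  rewrite ler_wpM2r ?hnorm_ge0// ler_pdivrMr// ler_peMr ?(ltW t0)//.
  by rewrite ler1n.
move: H1 H2 H3 H4 yy' td2; set B1 := t * _; set B2 := t * _; set B3 := _ * N[z].
lra.
Qed.

(** Maximality: the generator of contractions is accretive and extends [A], while [1 + A] is already
    onto. The difference [d] of two preimages of [x + y] is sent to [- d], which forces [d = 0]. *)
Lemma hysg_generator : neg_generator ip (hysg ip A) = A.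
Proof.
apply/seteqP; split; last exact: hysg_generator_sub.
move=> [x y] Gxy; have [x' [y' [Axy' xyE]]] := acc_range hA ltr01 (x + y).
have /neg_generatorP Gxy' := hysg_generator_sub Axy'.
move/neg_generatorP : Gxy => Gxy.
rewrite scale1r in xyE; pose d := x - x'.
have yE : y - y' = - d.
  by rewrite /d opprB; apply/eqP; rewrite subr_eq addrAC eq_sym subr_eq xyE addrC.
have d0 : d = 0.
  apply: (ip_eq0 hV); apply/le_anti; rewrite (ip_ge0 hV) andbT.
  apply: ler_gtP => e e0; rewrite add0r.
  have dp : 0 < N[d] + 1 by rewrite ltr_wpDl ?hnorm_ge0.
  have e2 : 0 < e / 2 / (N[d] + 1) by rewrite !divr_gt0.
  have [d1 d10 Hd1] := Gxy _ e2; have [d2 d20 Hd2] := Gxy' _ e2.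
  pose t := Num.min d1 d2 / 2.
  have m0 : 0 < Num.min d1 d2 by rewrite lt_min d10.
  have t0 : 0 < t by rewrite divr_gt0.
  have : t < Num.min d1 d2 by rewrite ltr_pdivrMr// ltr_pMr// ltr1n.
  rewrite lt_min => /andP[td1 td2].
  have := ltrD (Hd1 t t0 td1) (Hd2 t t0 td2).
  move=> /(le_lt_trans (ler_hnormB hV _ _)).
  rewrite subrACA -scalerBr subrACA -(hysgB hV hA _ _ (ltW t0)) -/d yE opprK.
  rewrite -mulrDl -splitr ltr_pdivlMr// => H.
  have P : 0 <= rip (t^-1%:C *: (d - hysg ip A t d)) d.
    rewrite (rip_Zl hV) mulr_ge0 ?invr_ge0 ?(ltW t0)// (rip_Bl hV) subr_ge0 -(hnorm_sqr hV).
    apply: le_trans (CS hV _ _) _; rewrite expr2 ler_wpM2r ?hnorm_ge0//.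
    exact: hysg_norm (ltW t0).
  have := CS hV (t^-1%:C *: (d - hysg ip A t d) + d) d.
  rewrite (rip_Dl hV) => Q; apply: ltW; apply: le_lt_trans H.
  apply: le_trans (_ : rip (t^-1%:C *: (d - hysg ip A t d)) d + rip d d <= _).
    by rewrite lerDr.
  apply: le_trans Q _; rewrite ler_wpM2l ?hnorm_ge0// lerDl//.
move/eqP: d0; rewrite subr_eq0 => /eqP xx'.
move: yE; rewrite /d xx' subrr oppr0 => /eqP; rewrite subr_eq0 => /eqP ->.
exact: Axy'.
Qed.

Lemma hysg_semigroup : selfadjoint_c0_semigroup ip (hysg ip A).
Proof.
split.
- move=> t t0; split; first by move=> c x y; exact: (hysg_lin hV hA).
  by exists 1 => x; rewrite mul1r; exact: (hysg_norm hV hA).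
- by move=> t x y t0; exact: (hysg_sym hV hA).
- by move=> x; exact: (hysg0 hV hA).
- by move=> s t x; exact: (hysg_add hV hA).
- exact: hysg_c0.
Qed.

(* backward step: |u(s+h)| <= |u(s+h) + h A u(s+h)|, which is |u(s)| + o(h) *)
Lemma evolution_le (u v : R -> V) :
  (forall s, 0 <= s -> A (u s, v s)) ->
  (forall s, 0 <= s -> forall e, 0 < e -> exists2 d, 0 < d & forall h, 0 < h ->
     h < d -> N[h^-1%:C *: (u s - u (s + h)) - v s] < e /\ N[v (s + h) - v s] < e) ->
  (forall s C, 0 < s -> (forall r, 0 <= r -> r < s -> N[u r] <= C) -> N[u s] <= C) ->
  forall t, 0 <= t -> N[u t] <= N[u 0].
Proof.
move=> Auv ud ul; apply: dini_le => // s s0 e e0.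
have e2 : 0 < e / 2 by rewrite divr_gt0.
have [d d0 Hd] := ud s s0 _ e2; exists d => // h h0 hd.
have [H1 H2] := Hd h h0 hd.
apply: le_trans (acc_norm hV hA (Auv _ (addr_ge0 s0 (ltW h0))) (ltW h0)) _.
set w := h^-1%:C *: _ - _ in H1.
have -> : u (s + h) + h%:C *: v (s + h) = u s + h%:C *: ((v (s + h) - v s) - w).
  rewrite /w subrACA subrr subr0 scalerBr scalerA -rmorphM/= divff ?gt_eqF//.
  by rewrite scale1r opprB [RHS]addrA [RHS]addrC addrA subrK.
apply: le_trans (ler_hnormD hV _ _) _; rewrite lerD2l (hnormZ hV) gtr0_norm// mulrC.
rewrite ler_pM2r//; apply: le_trans (ler_hnormB hV _ _) _.
by rewrite (splitr e); apply: lerD; apply: ltW.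
Qed.

Section Uniqueness.
Variable T : R -> V -> V.
Hypotheses (hT : selfadjoint_c0_semigroup ip T) (gT : neg_generator ip T = A).

Lemma sgZD t : 0 <= t -> forall c x y, T t (c *: x + y) = c *: T t x + T t y.
Proof. by move=> t0 c x y; have [H _ _ _ _] := hT; have [L _] := H t t0; exact: L. Qed.

Lemma sgB t x y : 0 <= t -> T t (x - y) = T t x - T t y.
Proof. by move=> t0; rewrite addrC -scaleN1r sgZD// scaleN1r addrC. Qed.

Lemma sgZ t c x : 0 <= t -> T t (c *: x) = c *: T t x.
Proof.
move=> t0; have h0 : T t 0 = 0.
  by have := sgZD t0 (-1) 0 0; rewrite scaleN1r addNr scaleN1r addNr.
by have := sgZD t0 c x 0; rewrite !addr0 h0 addr0.
Qed.

Lemma sgadd s t x : 0 <= s -> 0 <= t -> T (s + t) x = T s (T t x).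
Proof. by have [_ _ _ H _] := hT; exact: H. Qed.

Lemma sgbd t : 0 <= t -> exists2 M, 0 < M & forall x, N[T t x] <= M * N[x].
Proof.
move=> t0; have [H _ _ _ _] := hT; have [_ [M HM]] := H t t0.
exists (`|M| + 1); first by rewrite ltr_wpDl.
move=> x; apply: le_trans (HM x) _; rewrite ler_wpM2r ?hnorm_ge0//.
by have := ler_norm M; lra.
Qed.

Lemma sggen s x y : 0 <= s -> A (x, y) -> A (T s x, T s y).
Proof.
rewrite -gT => s0 /neg_generatorP Gxy; apply/neg_generatorP => e e0.
have [M M0 HM] := sgbd s0; have eM : 0 < e / M by rewrite divr_gt0.
have [d d0 Hd] := Gxy _ eM; exists d => // t t0 td.
have -> : T t (T s x) = T s (T t x) by rewrite -!sgadd ?(ltW t0)// addrC.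
rewrite -sgB// -sgZ// -sgB//; apply: le_lt_trans (HM _) _.
by rewrite mulrC -ltr_pdivlMr// Hd.
Qed.

Lemma sgcont s x e : 0 <= s -> 0 < e ->
  exists2 d, 0 < d & forall h, 0 < h -> h < d -> N[T (s + h) x - T s x] < e.
Proof.
move=> s0 e0; have [_ _ _ _ /(_ x)/right_cvgP H] := hT.
have [M M0 HM] := sgbd s0; have eM : 0 < e / M by rewrite divr_gt0.
have [d d0 Hd] := H _ eM; exists d => // t t0 td.
rewrite sgadd ?(ltW t0)// -sgB//; apply: le_lt_trans (HM _) _.
by rewrite mulrC -ltr_pdivlMr// Hd.
Qed.

Lemma sg_right_derivative s x y : 0 <= s -> A (x, y) -> forall e, 0 < e ->
  exists2 d, 0 < d & forall h, 0 < h -> h < d ->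
    N[h^-1%:C *: (T s x - T (s + h) x) - T s y] < e /\ N[T (s + h) y - T s y] < e.
Proof.
move=> s0 Axy e e0; have := sggen s0 Axy; rewrite -{1}gT => /neg_generatorP G.
have [d1 d10 Hd1] := G _ e0; have [d2 d20 Hd2] := sgcont y s0 e0.
exists (Num.min d1 d2); first by rewrite lt_min d10.
move=> h h0; rewrite lt_min => /andP[h1 h2]; split; last exact: Hd2.
by rewrite (addrC s) sgadd ?(ltW h0)//; exact: Hd1.
Qed.

(** Each operator is bounded, but no bound uniform in time is given, so left continuity of orbits is
    not yet available. Self-adjointness provides the left closedness that [evolution_le] asks for;
    density then extends the bound from the domain of [A]. *)
Lemma sg_contraction t x : 0 <= t -> N[T t x] <= N[x].
Proof.
have H x' y' s : 0 <= s -> A (x', y') -> N[T s x'] <= N[x'].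
  move=> s0 Axy; have [_ Tsym T0 _ _] := hT.
  rewrite -{2}(T0 x'); apply: (@evolution_le (T^~ x') (T^~ y')) => //.
  - by move=> r r0; exact: sggen.
  - by move=> r r0; exact: sg_right_derivative.
  move=> r C r0 HC; have C0 : 0 <= C by apply: le_trans (HC 0 (lexx 0) r0); exact: hnorm_ge0.
  have [->//|n0] := eqVneq (N[T r x']) 0.
  have np : 0 < N[T r x'] by rewrite lt_def n0 hnorm_ge0.
  rewrite -(ler_pM2r np); apply: ler_gtP => e e0.
  have C1 : 0 < C + 1 by rewrite ltr_wpDl.
  have eC : 0 < e / (C + 1) by rewrite divr_gt0.
  have [d d0 Hd] := sgcont x' (ltW r0) eC.
  pose h := Num.min (d / 2) (r / 2).
  have h0 : 0 < h by rewrite lt_min !divr_gt0.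
  have hd : h < d.
    by apply: le_lt_trans (_ : d / 2 < d); rewrite ?ge_min ?lexx// ltr_pdivrMr// ltr_pMr// ltr1n.
  have hr : h < r.
    by apply: le_lt_trans (_ : r / 2 < r); rewrite ?ge_min ?lexx ?orbT// ltr_pdivrMr// ltr_pMr// ltr1n.
  have rh0 : 0 <= r - h by rewrite subr_ge0 ltW.
  have rh1 : 0 <= r + h by rewrite addr_ge0// ltW.
  (* By self-adjointness the square of [N[T r x']] is the pairing of [T (r + h) x'] with
     [T (r - h) x']: the past factor is at most [C] and the future one is controlled by right
     continuity. *)
  rewrite -expr2 (hnorm_sqr hV) -(Tsym _ _ _ (ltW r0)) -(sgadd _ (ltW r0) (ltW r0)).
  have -> : r + r = (r + h) + (r - h) by rewrite addrACA subrr addr0.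
  rewrite sgadd// Tsym//; apply: le_trans (CS hV _ _) _.
  apply: le_trans (ler_wpM2r (hnorm_ge0 _ _) (HC _ rh0 _)) _; first by rewrite gtrBl.
  have H1 : N[T (r + h) x'] <= N[T r x'] + e / (C + 1).
    rewrite -lerBlDl; apply: le_trans (ltW (Hd h h0 hd)).
    exact: le_trans (ler_norm _) (ler_hnorm_dist hV _ _).
  apply: le_trans (ler_wpM2l C0 H1) _; rewrite mulrDr lerD2l mulrA ler_pdivrMr//.
  by rewrite mulrC ler_pM2l// lerDl.
move=> t0; apply: ler_gtP => e e0; have [M M0 HM] := sgbd t0.
have e1 : 0 < e / (M + 1) by rewrite divr_gt0// ltr_wpDl// ltW.
have [x' [y [z [Axy _ xx']]]] := acc2_dense hV hA x e1.
have H1 := H _ _ _ t0 Axy; have H2 := ler_hnormD hV (T t (x - x')) (T t x').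
rewrite {1}sgB// subrK in H2; have H3 := HM (x - x').
have H4 : N[x'] <= N[x] + N[x - x'].
  by have := ler_hnormB hV x (x - x'); rewrite opprB addrC subrK.
move: xx'; rewrite ltr_pdivlMr ?ltr_wpDl ?(ltW M0)// mulrDr mulr1 => H5.
move: H1 H2 H3 H4 H5; rewrite (mulrC M); set B := _ * M.
lra.
Qed.

Lemma sg_left_continuous s x e : 0 < s -> 0 < e ->
  exists2 d, 0 < d & forall h, 0 < h -> h < d -> h < s -> N[T s x - T (s - h) x] < e.
Proof.
move=> s0 e0; have [_ _ _ _ /(_ x)/right_cvgP H] := hT.
have [d d0 Hd] := H _ e0; exists d => // h h0 hd hs.
have sh : 0 <= s - h by rewrite subr_ge0 ltW.
have -> : T s x = T (s - h) (T h x) by rewrite -(sgadd _ sh (ltW h0)) subrK.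
rewrite -sgB//.
by apply: le_lt_trans (sg_contraction _ sh) (Hd _ h0 hd).
Qed.

End Uniqueness.

(** The difference of two orbits starting in the domain of [A] solves [u' = - A u] with [u 0 = 0],
    so its norm cannot grow. This identifies the semigroup chosen by [expN] with the Euler limit. *)
Lemma semigroup_unique (T S : R -> V -> V) :
  selfadjoint_c0_semigroup ip T -> neg_generator ip T = A ->
  selfadjoint_c0_semigroup ip S -> neg_generator ip S = A ->
  forall t x, 0 <= t -> T t x = S t x.
Proof.
move=> hT gT hS gS t x t0.
have main x' y' : A (x', y') -> T t x' = S t x'.
  move=> Axy; have [_ _ T0 _ _] := hT; have [_ _ S0 _ _] := hS.
  apply/eqP; rewrite -subr_eq0; apply/eqP/(hnorm0_eq0 hV)/le_anti.
  rewrite hnorm_ge0 andbT.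
  suff : N[T t x' - S t x'] <= N[T 0 x' - S 0 x'] by rewrite T0 S0 subrr hnorm0.
  apply: (@evolution_le (fun r => T r x' - S r x') (fun r => T r y' - S r y')) => //.
  - move=> r r0; apply: (accB hA); first exact: (sggen hT gT).
    exact: (sggen hS gS).
  - move=> r r0 e e0; have e2 : 0 < e / 2 by rewrite divr_gt0.
    have [d1 d10 H1] := sg_right_derivative hT gT r0 Axy e2.
    have [d2 d20 H2] := sg_right_derivative hS gS r0 Axy e2.
    exists (Num.min d1 d2); first by rewrite lt_min d10.
    move=> h h0; rewrite lt_min => /andP[/(H1 _ h0)[a1 b1] /(H2 _ h0)[a2 b2]].
    rewrite (subrACA (T r x')) scalerBr subrACA (subrACA (T (r + h) y')) (splitr e).
    by split; apply: le_lt_trans (ler_hnormB hV _ _) _; apply: ltrD.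
  move=> r C r0 HC; apply: ler_gtP => e e0; have e2 : 0 < e / 2 by rewrite divr_gt0.
  have [d1 d10 H1] := sg_left_continuous hT gT x' r0 e2.
  have [d2 d20 H2] := sg_left_continuous hS gS x' r0 e2.
  pose h := Num.min d1 (Num.min d2 r) / 2.
  have m0 : 0 < Num.min d1 (Num.min d2 r) by rewrite !lt_min d10 d20.
  have h0 : 0 < h by rewrite divr_gt0.
  have : h < Num.min d1 (Num.min d2 r) by rewrite ltr_pdivrMr// ltr_pMr// ltr1n.
  rewrite !lt_min => /and3P[h1 h2 hr].
  have rh0 : 0 <= r - h by rewrite subr_ge0 ltW.
  have HC' := HC _ rh0; rewrite gtrBl in HC'; have {}HC' := HC' h0.
  have := ltrD (H1 h h0 h1 hr) (H2 h h0 h2 hr); rewrite -splitr.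
  move=> /(le_lt_trans (ler_hnormB hV _ _)); rewrite subrACA => /ltW H3.
  apply: le_trans (_ : _ <= N[(T r x' - S r x') - (T (r - h) x' - S (r - h) x')]
     + N[T (r - h) x' - S (r - h) x']) _.
    by apply: le_trans (ler_hnormD hV _ _); rewrite subrK.
  by rewrite addrC; exact: lerD.
apply/eqP; rewrite -subr_eq0; apply/eqP.
have := @dense_zero _ _ _ hV _ hA (fun x => T t x - S t x) _ _ _ x; apply.
- by move=> {}x y; rewrite (sgB hT)// (sgB hS)// subrACA.
- exists 2 => {}x; apply: le_trans (ler_hnormB hV _ _) _.
  by rewrite mulr2n mulrDl mul1r; apply: lerD; exact: sg_contraction.
by move=> {}x y z Axy _; rewrite (main _ _ Axy) subrr.
Qed.

Lemma is_exp_hysg : is_exp_semigroup ip A (hysg ip A).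
Proof. by split; [exact: hysg_semigroup|exact: hysg_generator]. Qed.

Lemma expNP : is_exp_semigroup ip A (expN ip A).
Proof.
rewrite /expN; case: xgetP => [T _ //|/(_ (hysg ip A))] /=.
by case; exact: is_exp_hysg.
Qed.

Lemma expN_eq (T : R -> V -> V) t x : is_exp_semigroup ip A T -> 0 <= t ->
  expN ip A t x = T t x.
Proof.
move=> [hT gT] t0; have [hE gE] := expNP.
exact: (semigroup_unique hE gE hT gT).
Qed.

Lemma expN_euler t x : 0 <= t -> hcvg ip (fun k => euler A k t x) (expN ip A t x).
Proof.
by move=> t0; rewrite (expN_eq _ is_exp_hysg)//; exact: hysgP.
Qed.

End Generation.

(** * Closed forms and Galerkin approximation *)

Section Forms.
Context (R : realType) (V W : lmodType R[i]).
Context (ip : V -> V -> R[i]) (jp : W -> W -> R[i]).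
Context (hV : hilbert ip) (hW : hilbert jp).
Local Notation Re := complex.Re.
Local Notation "N[ x ]" := (hnorm ip x) (at level 0, format "N[ x ]").
Local Notation "M[ x ]" := (hnorm jp x) (at level 0, format "M[ x ]").
Implicit Types (x y z : V) (w : W) (G : set (V * W)).

(* [gform G] and [gram G]: the form and the operator [G^* G], for the graph [G]
   of an operator *)
Definition gform G : qform V :=
  [set p | exists2 w, G (p.1, w) & p.2 = M[w] ^+ 2].

Definition gclosure G : set (V * W) :=
  [set p | exists u v, [/\ forall n : nat, G (u n, v n), hcvg ip u p.1
    & hcvg jp v p.2]].

Definition gram G : oper V :=
  [set p | exists2 w, G (p.1, w) & forall z w', G (z, w') -> jp w w' = ip p.2 z].

Record lin_graph G : Prop := LinGraph {
  lin_graph_lin : forall c x w x' w', G (x, w) -> G (x', w') ->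
    G (c *: x + x', c *: w + w');
  lin_graph0 : G (0, 0);
  lin_graph_fun : forall w, G (0, w) -> w = 0 }.

Section LinGraphTheory.
Variable G : set (V * W).
Hypothesis lG : lin_graph G.

Lemma lgZ c x w : G (x, w) -> G (c *: x, c *: w).
Proof.
by move=> H; have := lin_graph_lin lG c H (lin_graph0 lG); rewrite !addr0.
Qed.

Lemma lgD x w x' w' : G (x, w) -> G (x', w') -> G (x + x', w + w').
Proof. by move=> H H'; have := lin_graph_lin lG 1 H H'; rewrite !scale1r. Qed.

Lemma lgB x w x' w' : G (x, w) -> G (x', w') -> G (x - x', w - w').
Proof.
by move=> H H'; have := lgD H (lgZ (-1) H'); rewrite !scaleN1r.
Qed.

Lemma lgF x w w' : G (x, w) -> G (x, w') -> w = w'.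
Proof.
move=> H H'; apply/eqP; rewrite -subr_eq0; apply/eqP/(lin_graph_fun lG).
by have := lgB H H'; rewrite subrr.
Qed.

Lemma qval_gform x w : G (x, w) -> qval (gform G) x = M[w] ^+ 2.
Proof.
move=> Gw; rewrite /qval; case: xgetP => [r _ [w' Gw' /= ->]|/(_ (M[w] ^+ 2))/=].
  by rewrite (lgF Gw Gw').
by case; exists w.
Qed.

Lemma qdom_gform x : qdom (gform G) x <-> exists w, G (x, w).
Proof.
split=> [[r [w Gw _]]|[w Gw]]; first by exists w.
by exists (M[w] ^+ 2), w.
Qed.

Lemma qpolar_gform x w x' w' : G (x, w) -> G (x', w') ->
  qpolar (gform G) x x' = jp w w'.
Proof.
move=> Gw Gw'; have Gi := lgZ 'i Gw'.
rewrite /qpolar (qval_gform (lgD Gw Gw')) (qval_gform (lgB Gw Gw')).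
rewrite (qval_gform (lgD Gw Gi)) (qval_gform (lgB Gw Gi)).
have E v : M[w + v] ^+ 2 - M[w - v] ^+ 2 = 4 * Re (jp w v).
  by rewrite !(hnorm_sqr hW) !(ripE hW) (rip_sym hW v w); ring.
have n4 : (4 : R[i]) != 0 by rewrite pnatr_eq0.
apply: (mulfI n4); rewrite mulrA divff// mul1r -!rmorphB/= !E -(Im_ip hW).
by case: (jp w w') => a b; apply/eqP; rewrite eq_complex/=; apply/andP; split; apply/eqP; ring.
Qed.

Lemma qoper_gform : qoper ip (gform G) = gram G.
Proof.
apply/seteqP; split=> -[x y] /=.
  move=> [/qdom_gform[w Gw] H]; exists w => // z w' Gw'.
  by rewrite -(qpolar_gform Gw Gw') H//; apply/qdom_gform; exists w'.
move=> [w Gw H]; split; first by apply/qdom_gform; exists w.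
by move=> z /qdom_gform[w' Gw']; rewrite (qpolar_gform Gw Gw'); exact: H.
Qed.

(** A sequence that is Cauchy for the form has Cauchy images in [W]. By completeness, closing the
    form is the same as closing the graph. *)
Lemma qclosure_gform : qclosure ip (gform G) = gform (gclosure G).
Proof.
apply/seteqP; split=> -[x r] /=.
  move=> [u [v [Gu ux vr Hc]]]; have /choice[w Hw] : forall n, exists w,
      G (u n, w) /\ v n = M[w] ^+ 2 by move=> n; have [w] := Gu n; exists w.
  have [l wl] : exists l, hcvg jp w l.
    apply: (hcomplete hW) => e e0; have e2 : 0 < e ^+ 2 by rewrite exprn_gt0.
    have [N HN] := Hc _ e2; exists N => n k Nn Nk.
    have := HN n k Nn Nk; rewrite (qval_gform (lgB (Hw n).1 (Hw k).1)).
    by rewrite ltr_pXn2r// nnegrE ?hnorm_ge0 ?ltW.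
  exists l => /=; first by exists u, w; split => // n; case: (Hw n).
  apply: cvgn_uniq vr _; rewrite (_ : v = fun n => M[w n] * M[w n]).
    by rewrite expr2; apply: cvgnM; exact: hcvg_hnorm wl.
  by apply/funext => n; rewrite (Hw n).2 expr2.
move=> [w [u [v [Guv ux vw]]] /= ->]; exists u, (fun n => M[v n] ^+ 2); split => //.
- by move=> n; exists (v n) => //=; exact: Guv.
- rewrite (_ : (fun n => _) = fun n => M[v n] * M[v n]).
    by rewrite expr2; apply: cvgnM; exact: hcvg_hnorm vw.
  by apply/funext => n; rewrite expr2.
move=> e e0; have se : 0 < Num.sqrt e by rewrite sqrtr_gt0.
have [N HN] := hcvg_cauchy hW vw se; exists N => n k Nn Nk.
rewrite (qval_gform (lgB (Guv n) (Guv k))).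
by rewrite -(sqr_sqrtr (ltW e0)) ltr_pXn2r ?nnegrE ?hnorm_ge0 ?sqrtr_ge0//; exact: HN.
Qed.

End LinGraphTheory.

Lemma gclosure_mono G G' : G `<=` G' -> gclosure G `<=` gclosure G'.
Proof. by move=> GG p [u [v [H ux vy]]]; exists u, v; split => // n; exact: GG. Qed.

Lemma gclosure_sub G : G `<=` gclosure G.
Proof.
move=> [x w] Gx; exists (fun=> x), (fun=> w); split => //=; exact: hcvg_cst.
Qed.

(** A diagonal choice with errors below [1 / (n + 1)] in both components. *)
Lemma gclosure_idem G : gclosure (gclosure G) `<=` gclosure G.
Proof.
move=> [x w] [u [v [/= Huv ux vw]]].
have H (n : nat) : exists p : V * W, [/\ G p, N[p.1 - x] < n.+1%:R^-1 & M[p.2 - w] < n.+1%:R^-1].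
  have e0 : 0 < (n.+1%:R^-1 / 2 : R) by rewrite divr_gt0// invr_gt0 ltr0n.
  have [n1 H1] := (hcvgP _ _ _).1 ux _ e0; have [n2 H2] := (hcvgP _ _ _).1 vw _ e0.
  pose k := maxn n1 n2; have [a [b [/= Hab au bv]]] := Huv k.
  have [n3 H3] := (hcvgP _ _ _).1 au _ e0; have [n4 H4] := (hcvgP _ _ _).1 bv _ e0.
  pose l := maxn n3 n4; exists (a l, b l); split => //=.
    apply: le_lt_trans (ler_hdistD hV (u k) _ _) _; rewrite [ltRHS]splitr; apply: ltrD.
      by apply: H3; rewrite leq_maxl.
    by apply: H1; rewrite leq_maxl.
  apply: le_lt_trans (ler_hdistD hW (v k) _ _) _; rewrite [ltRHS]splitr; apply: ltrD.
    by apply: H4; rewrite leq_maxr.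
  by apply: H2; rewrite leq_maxr.
have [f Hf] := choice H; exists (fun n => (f n).1), (fun n => (f n).2); split => /=.
- by move=> n; have [+ _ _] := Hf n; case: (f n).
- by apply: (hcvg_le (f := fun n => n.+1%:R^-1)) => [n|]; [have [_ /ltW] := Hf n|exact: cvg_harmonic].
- by apply: (hcvg_le (f := fun n => n.+1%:R^-1)) => [n|]; [have [_ _ /ltW] := Hf n|exact: cvg_harmonic].
Qed.

Lemma gclosure_lin G : lin_graph G -> (forall w, gclosure G (0, w) -> w = 0) ->
  lin_graph (gclosure G).
Proof.
move=> lG H; split => //.
  move=> c x w x' w' [u [v [/= Guv ux vw]]] [u' [v' [/= Guv' ux' vw']]].
  exists (fun n => c *: u n + u' n), (fun n => c *: v n + v' n); split => /=.
  - by move=> n; apply: (lin_graph_lin lG).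
  - by apply: (hcvgD hV) => //; exact: hcvgZ.
  - by apply: (hcvgD hW) => //; exact: hcvgZ.
exists (fun=> 0), (fun=> 0); split => /=; [by move=> _; exact: lin_graph0|..].
  exact: hcvg_cst.
exact: hcvg_cst.
Qed.

(* For [x] in the form domain, testing the resolvent equation of [r] against
   [x - r] gives [|x - r|^2 = e Re <w, w' - w> <= e |w'|^2]. *)
Lemma gram_accretive G : lin_graph G ->
  (forall x, exists2 u, (forall n : nat, exists w, G (u n, w)) & hcvg ip u x) ->
  (forall e : R, 0 < e -> forall y, exists x z, gram G (x, z) /\ x + e%:C *: z = y) ->
  accretive ip (gram G).
Proof.
move=> lG dG rG; split => //.
- move=> a x y x' y' [w Gw H] [w' Gw' H'].
  exists (a *: w + w'); first exact: (lin_graph_lin lG).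
  by move=> z v Gv /=; rewrite (ip_lin hW) (ip_lin hV) (H _ _ Gv) (H' _ _ Gv).
- move=> x y x' y' [w Gw H] [w' Gw' H'] /=.
  rewrite -(H _ _ Gw') (ip_conj hV) -(H' _ _ Gw); exact: ip_conj hW _ _.
- by move=> x y [w Gw H] /=; rewrite -(H _ _ Gw); exact: (ip_ge0 hW).
have approx x w e : G (x, w) -> 0 < e -> exists r v, gram G (r, v) /\
    N[x - r] ^+ 2 <= e * M[w] ^+ 2.
  move=> Gw e0; have [r [v [Gr rv]]] := rG _ e0 x; exists r, v; split => //.
  have [w' Gw' H] := Gr; have E := H _ _ (lgB lG Gw Gw').
  have xr : x - r = e%:C *: v by rewrite -rv addrAC subrr add0r.
  rewrite (hnorm_sqr hV) {1}xr (rip_Zl hV) -E ler_wpM2l ?(ltW e0)//.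
  rewrite (rip_Br hW) -(hnorm_sqr hW).
  by have := CS hW w' w; have := sqr_ge0 (M[w'] - M[w]); have := hnorm_ge0 jp w; have := hnorm_ge0 jp w'; nra.
move=> x.
suff H (n : nat) : exists r, (exists v, gram G (r, v)) /\ N[r - x] < n.+1%:R^-1.
  have /choice[u Hu] := H; exists u; first by move=> n; case: (Hu n).
  apply: hcvg_le (fun n => ltW (Hu n).2) _; exact: cvg_harmonic.
have e0 : 0 < (n.+1%:R^-1 : R) by rewrite invr_gt0 ltr0n.
have e2 : 0 < n.+1%:R^-1 / 2 :> R by rewrite divr_gt0.
have [u uG /hcvgP /(_ _ e2)[k /(_ k (leqnn k)) ukx]] := dG x.
have [w Gw] := uG k.
have W1 : 0 < M[w] ^+ 2 + 1 by rewrite ltr_wpDl ?sqr_ge0.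
have d0 : 0 < (n.+1%:R^-1 / 2) ^+ 2 / (M[w] ^+ 2 + 1) :> R by rewrite divr_gt0 ?exprn_gt0.
have [r [v [Gr H]]] := approx _ _ _ Gw d0.
exists r; split; first by exists v.
apply: le_lt_trans (ler_hdistD hV (u k) _ _) _; rewrite (splitr (n.+1%:R^-1)).
apply: ler_ltD => //; rewrite (hnormBC hV) -(@ler_pXn2r _ 2)// ?nnegrE ?hnorm_ge0 ?(ltW e2)//.
apply: le_trans H _; rewrite mulrAC ler_pdivrMr//.
by rewrite ler_wpM2l ?sqr_ge0// lerDl.
Qed.

Lemma complex_ext (X Y : R[i]) : (forall c : R[i], Re (c * X) = Re (c * Y)) -> X = Y.
Proof.
move=> H; have := H 1; have := H 'i; rewrite !mul1r.
by case: X Y {H} => a b [c d] /= H1 H2; congr (_ +i* _); lra.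
Qed.

(* The Galerkin solutions are projections of the solution for the form inner
   product, so their energies increase to a finite limit. *)
Lemma galerkin G (D : nat -> set V) (e : R) y (x : nat -> V) (w : nat -> W) :
  lin_graph G -> gclosure G `<=` G -> 0 < e ->
  (forall n p, (n <= p)%N -> D n `<=` D p) ->
  (forall n, D n (x n)) -> (forall n, G (x n, w n)) ->
  (forall n z w', D n z -> G (z, w') ->
     ip (x n) z + e%:C * jp (w n) w' = ip y z) ->
  G `<=` gclosure [set p | G p /\ exists n, D n p.1] ->
  exists2 x0, hcvg ip x x0 & gram G (x0, (e^-1)%:C *: (y - x0)).
Proof.
move=> lG cG e0 Dm Dx Gx Hx core.
pose En n := N[x n] ^+ 2 + e * M[w n] ^+ 2.
(* Both the equation of level [p] and that of level [n] may be tested against [x n], and the right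
   side is [ip y (x n)] in both. This is the Pythagorean relation behind [diff]. *)
have cross n p : (n <= p)%N -> Re (ip (x p) (x n)) + e * Re (jp (w p) (w n)) = En n.
  move=> np; have H1 := Hx p _ _ (Dm _ _ np _ (Dx n)) (Gx n).
  have H2 := Hx n _ _ (Dx n) (Gx n); rewrite -H1 in H2; move/(congr1 (@complex.Re R)): H2.
  by rewrite !raddfD/= !ReZ /En !hnorm_sqr.
have diff n p : (n <= p)%N ->
    N[x p - x n] ^+ 2 + e * M[w p - w n] ^+ 2 = En p - En n.
  move=> np; have C := cross _ _ np.
  rewrite !hnorm_sqr// !(ripE hV) !(ripE hW) (rip_sym hV (x n) (x p)) (rip_sym hW (w n) (w p)).
  have := cross n n (leqnn n); have := cross p p (leqnn p); move: C.
  by set Ep := En p; set Enn := En n; nra.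
have Enb n : En n <= N[y] ^+ 2.
  have H2 := Hx n _ _ (Dx n) (Gx n); move/(congr1 (@complex.Re R)): H2.
  rewrite raddfD/= ReZ -!hnorm_sqr// => H2.
  have := CS hV y (x n); rewrite -H2 -/(En n).
  have : N[x n] ^+ 2 <= En n by rewrite lerDl mulr_ge0 ?sqr_ge0 ?(ltW e0).
  have := hnorm_ge0 ip (x n); have := hnorm_ge0 ip y.
  have : 0 <= e * M[w n] ^+ 2 by rewrite mulr_ge0 ?sqr_ge0 ?(ltW e0).
  rewrite /En; set a := N[x n]; set b := N[y]; set c := e * _.
  move=> c0 b0 a0 _ H3; have [ba|ab] := ltP b a; last by nra.
  by exfalso; nra.
have [x0 xx0] : exists x0, hcvg ip x x0.
  apply: (bounded_increments_cvg hV (k := 2) (c := 1) isT ltr01 Enb) => n p /diff <-.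
  by rewrite mul1r lerDl mulr_ge0 ?sqr_ge0 ?(ltW e0).
have [w0 ww0] : exists w0, hcvg jp w w0.
  apply: (bounded_increments_cvg hW (k := 2) isT e0 Enb) => n p /diff <-.
  by rewrite lerDr sqr_ge0.
exists x0 => //; exists w0; first by apply: cG; exists x, w.
have key0 z w' n : D n z -> G (z, w') ->
    Re (ip x0 z) + e * Re (jp w0 w') = Re (ip y z).
  move=> Dz Gz; apply: cvgn_uniq (_ : (fun=> Re (ip y z)) @ \oo --> Re (ip y z)); last first.
    exact: cvg_cst.
  have := cvgnD (hcvg_rip hV xx0 (hcvg_cst hV z))
    (cvgnZ (c := e) (hcvg_rip hW ww0 (hcvg_cst hW w'))).
  move/cvgn_subP => H; apply/cvgn_subP => d /H[N0 HN]; exists (maxn N0 n) => p.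
  rewrite geq_max => /andP[Np np]; have := HN p Np.
  by have := Hx p _ _ (Dm _ _ np _ Dz) Gz; move/(congr1 (@complex.Re R)); rewrite raddfD/= ReZ => ->.
(* The core hypothesis approximates any test vector together with its image, which carries the
   equation from finite levels to the whole graph. *)
have key z w' : G (z, w') -> Re (ip x0 z) + e * Re (jp w0 w') = Re (ip y z).
  move=> /core[u [v [/= Huv uz vw]]].
  apply: cvgn_uniq (hcvg_rip hV (hcvg_cst hV y) uz).
  rewrite (_ : (fun n => Re (ip y (u n))) =
     fun n => Re (ip x0 (u n)) + e * Re (jp w0 (v n))).
    apply: cvgnD; first exact: (hcvg_rip hV (hcvg_cst hV _)).
    by apply: cvgnZ; exact: (hcvg_rip hW (hcvg_cst hW _)).
  by apply/funext => n; have [Gu [k Du]] := Huv n; rewrite (key0 _ _ k).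
move=> z w' Gz /=; apply: complex_ext => c.
have := key _ _ (lgZ lG (c^*)%R  Gz); rewrite !(ipZr hV) !(ipZr hW) conjCK => H.
have : e * Re (c * jp w0 w') = Re (c * ip (y - x0) z).
  by rewrite (ipB hV) mulrBr raddfB/= -H addrC addKr.
move=> K; rewrite (ipZ hV) mulrCA ReZ -K mulrA mulVf ?gt_eqF// mul1r//.
Qed.

End Forms.

(** * Multiplication operators in an orthonormal basis *)

Section OrthonormalBasis.
Context (R : realType) (V : lmodType R[i]) (ip : V -> V -> R[i]).
Context (hV : hilbert ip) (I : eqType) (E : I -> V) (S : nat -> seq I).
Local Notation Re := complex.Re.
Local Notation "N[ x ]" := (hnorm ip x) (at level 0, format "N[ x ]").
Implicit Types (x y z : V) (i j : I) (a : I -> R[i]) (f g : I -> R).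

(** The increasing finite sets [S n] replace unordered summation. One theory then covers basis
    vectors with initial segments and matrix units with squares. *)
Record onb : Prop := Onb {
  onb_orth : forall i j, ip (E i) (E j) = (i == j)%:R;
  onb_total : forall x, (forall i, ip x (E i) = 0) -> x = 0;
  onb_uniq : forall n, uniq (S n);
  onb_sub : forall n, {subset S n <= S n.+1};
  onb_exh : forall i, exists n, i \in S n }.

Hypothesis hE : onb.

Definition fsum (s : seq I) a : V := \sum_(i <- s) a i *: E i.

Definition proj (s : seq I) x : V := fsum s (fun i => ip x (E i)).

(** The maximal multiplication operator: its domain is hidden in the existence of a vector with the
    prescribed coordinates, so it is closed and self-adjoint for every real symbol. *)
Definition mulop f : oper V :=
  [set p | forall i, ip p.2 (E i) = (f i)%:C * ip p.1 (E i)].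

Lemma sqmodE (c : R[i]) : sqmod c = Re (c * (c^*)%R).
Proof. by case: c => u v; rewrite /sqmod /=; ring. Qed.

Lemma sqmodZ (r : R) (c : R[i]) : sqmod (r%:C * c) = r ^+ 2 * sqmod c.
Proof. by rewrite sqmodM /sqmod /= expr0n addr0. Qed.

Lemma coef_fsum s a j : uniq s -> ip (fsum s a) (E j) = if j \in s then a j else 0.
Proof.
move=> us; rewrite /fsum (ip_sum hV).
case: ifP => js.
  rewrite (bigD1_seq j)//= (ipZ hV) (onb_orth hE) eqxx mulr1 big1 ?addr0// => i /negPf ij.
  by rewrite (ipZ hV) (onb_orth hE) ij mulr0.
rewrite big_seq big1// => i si; rewrite (ipZ hV) (onb_orth hE).
by case: eqP => [ij|_]; [rewrite -ij si in js|rewrite mulr0].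
Qed.

Lemma ip_fsum s a x : ip x (fsum s a) = \sum_(i <- s) (a i)^* * ip x (E i).
Proof.
rewrite (ip_conj hV) /fsum (ip_sum hV) rmorph_sum/=; apply: eq_bigr => i _.
by rewrite (ipZ hV) rmorphM/= -(ip_conj hV).
Qed.

Lemma fsum_norm s a : uniq s -> N[fsum s a] ^+ 2 = \sum_(i <- s) sqmod (a i).
Proof.
move=> us; rewrite (hnorm_sqr hV) ip_fsum raddf_sum/=.
rewrite !big_seq; apply: eq_bigr => i si.
by rewrite coef_fsum// si sqmodE mulrC.
Qed.

Lemma proj_dist s x : uniq s ->
  N[x - proj s x] ^+ 2 = N[x] ^+ 2 - \sum_(i <- s) sqmod (ip x (E i)).
Proof.
move=> us; rewrite -(fsum_norm _ us) -/(proj s x) !(hnorm_sqr hV).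
have H : Re (ip x (proj s x)) = Re (ip (proj s x) (proj s x)).
  rewrite -(hnorm_sqr hV) fsum_norm// ip_fsum raddf_sum/=; apply: eq_bigr => i _.
  by rewrite sqmodE mulrC.
by rewrite !(ripE hV) (rip_sym hV (proj s x) x) H; ring.
Qed.

Lemma bessel s x : uniq s -> \sum_(i <- s) sqmod (ip x (E i)) <= N[x] ^+ 2.
Proof. by move=> us; rewrite -subr_ge0 -proj_dist// sqr_ge0. Qed.

Lemma coef_ext x y : (forall i, ip x (E i) = ip y (E i)) -> x = y.
Proof.
move=> H; apply/eqP; rewrite -subr_eq0; apply/eqP/(onb_total hE) => i.
by rewrite (ipB hV) H subrr.
Qed.

Lemma onb_mono n p : (n <= p)%N -> {subset S n <= S p}.
Proof.
move=> /subnKC <-; elim: (p - n)%N => [|k IH]; first by rewrite addn0.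
by move=> i /IH; rewrite addnS; exact: onb_sub.
Qed.

Lemma fsum_sub n p a : (n <= p)%N ->
  fsum (S p) a - fsum (S n) a = fsum (S p) (fun i => if i \in S n then 0 else a i).
Proof.
move=> np; apply: coef_ext => i.
rewrite (ipB hV) !coef_fsum ?(onb_uniq hE)//.
case: (boolP (i \in S n)) => [/(onb_mono np) ->|_]; first by rewrite subrr.
by rewrite subr0.
Qed.

Lemma riesz_fischer a :
  (exists M, forall n, \sum_(i <- S n) sqmod (a i) <= M) ->
  exists2 x, (forall i, ip x (E i) = a i) & hcvg ip (fun n => fsum (S n) a) x.
Proof.
move=> [M HM]; pose F n := \sum_(i <- S n) sqmod (a i).
have D n p : (n <= p)%N -> N[fsum (S p) a - fsum (S n) a] ^+ 2 = F p - F n.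
  move=> np; rewrite fsum_sub// fsum_norm ?(onb_uniq hE)//.
  rewrite /F (bigID (fun i => i \in S n))/= big1 ?add0r; last first.
    by move=> i ->; rewrite /sqmod /= expr0n addr0.
  rewrite [X in _ = X - _](bigID (fun i => i \in S n))/=.
  rewrite -[X in _ = X + _ - _]big_filter [X in _ = X + _ - _](perm_big (S n)); last first.
    apply: uniq_perm; rewrite ?filter_uniq ?(onb_uniq hE)// => i.
    by rewrite mem_filter; case: (boolP (i \in S n)) => //= /(onb_mono np) ->.
  by rewrite addrC addKr; apply: eq_bigr => i /negPf ->.
have [x Hx] : exists x, hcvg ip (fun n => fsum (S n) a) x.
  apply: (bounded_increments_cvg hV (k := 2) (c := 1) isT ltr01 HM) => n p np.
  by rewrite mul1r D.
exists x => // i; have [n0 Hn0] := onb_exh hE i.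
apply: complex_ext => c.
have := hcvg_rip hV (hcvgZ hV c Hx) (hcvg_cst hV (E i)); rewrite (ipZ hV).
move=> /cvgn_uniq; apply; apply/cvgn_subP => e e0; exists n0 => n nn.
by rewrite (ipZ hV) coef_fsum ?(onb_uniq hE)// (onb_mono nn Hn0) subrr normr0.
Qed.

Lemma proj_cvg x : hcvg ip (fun n => proj (S n) x) x.
Proof.
have [|y yx Hy] := @riesz_fischer (fun i => ip x (E i)).
  by exists (N[x] ^+ 2) => n; apply: bessel; exact: (onb_uniq hE).
by move: Hy; rewrite (coef_ext yx).
Qed.

Lemma coef_bounded_norm x M : 0 <= M ->
  (forall n, \sum_(i <- S n) sqmod (ip x (E i)) <= M ^+ 2) -> N[x] <= M.
Proof.
move=> M0 H; apply: (hcvg_hnorm_le hV (proj_cvg x)) => n.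
by rewrite -(@ler_pXn2r _ 2)// ?nnegrE ?hnorm_ge0// fsum_norm ?(onb_uniq hE).
Qed.

Lemma parseval x : (fun n => \sum_(i <- S n) sqmod (ip x (E i))) @ \oo --> N[x] ^+ 2.
Proof.
rewrite (_ : (fun n => _) = fun n => N[proj (S n) x] * N[proj (S n) x]).
  by rewrite expr2; apply: cvgnM; exact: hcvg_hnorm hV _ _ (proj_cvg x).
by apply/funext => n; rewrite -expr2 fsum_norm ?(onb_uniq hE).
Qed.

Lemma rip_series x y :
  (fun n => \sum_(i <- S n) Re (ip x (E i) * (ip y (E i))^*)) @ \oo --> Re (ip x y).
Proof.
have := hcvg_rip hV (hcvg_cst hV x) (proj_cvg y).
rewrite [X in X @ _ --> _ -> _](_ : _ =
  (fun n => \sum_(i <- S n) Re (ip x (E i) * (ip y (E i))^*)))//.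
apply/funext => n; rewrite ip_fsum raddf_sum/=; apply: eq_bigr => i _.
by rewrite mulrC.
Qed.

(** Shifts of indices are partial injections; [None] marks the positions that receive nothing.
    Injectivity makes the reindexed sum a Bessel sum over distinct indices. *)
Lemma sum_shift_le x (q : I -> option I) :
  (forall i j k, q i = Some k -> q j = Some k -> i = j) ->
  forall n, \sum_(i <- S n) sqmod (if q i is Some j then ip x (E j) else 0) <= N[x] ^+ 2.
Proof.
move=> qi n; pose s := pmap q (S n).
have us : uniq s.
  rewrite /s; elim: (S n) (onb_uniq hE n) => //= i t IH /andP[it ut].
  case qE : (q i) => [k|] /=; last exact: IH.
  rewrite IH// andbT mem_pmap; apply/negP => /mapP[j jt jE].
  by move: it; rewrite (qi _ _ _ qE (esym jE)) jt.
apply: le_trans (bessel x us); rewrite /s big_pmap.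
apply: ler_of_eq; apply: eq_bigr => i _.
by case: (q i) => //=; rewrite /sqmod /= expr0n addr0.
Qed.

Lemma norm_le_shift x y (q : I -> option I) :
  (forall i, ip y (E i) = if q i is Some j then ip x (E j) else 0) ->
  (forall i j k, q i = Some k -> q j = Some k -> i = j) -> N[y] <= N[x].
Proof.
move=> H qi; apply: coef_bounded_norm; first exact: hnorm_ge0.
by move=> n; under eq_bigr do rewrite H; exact: sum_shift_le.
Qed.

Lemma exists_shift x (q : I -> option I) :
  (forall i j k, q i = Some k -> q j = Some k -> i = j) ->
  exists y, forall i, ip y (E i) = if q i is Some j then ip x (E j) else 0.
Proof.
move=> /(sum_shift_le x) H.
by have [|y ya _] := @riesz_fischer (fun i => if q i is Some j then ip x (E j) else 0);
  [exists (N[x] ^+ 2)|exists y].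
Qed.

Lemma exists_dominated a (x y : V) K :
  (forall i, sqmod (a i) <= K * (sqmod (ip x (E i)) + sqmod (ip y (E i)))) ->
  0 <= K -> exists z, forall i, ip z (E i) = a i.
Proof.
move=> H K0; have [|z za _] := @riesz_fischer a; last by exists z.
exists (K * (N[x] ^+ 2 + N[y] ^+ 2)) => n.
apply: le_trans (ler_sum _ (fun i _ => H i)) _.
rewrite -mulr_sumr big_split/= ler_wpM2l// lerD// bessel//; exact: onb_uniq.
Qed.

Lemma mulop_dom f g x y K : mulop f (x, y) -> 0 <= K ->
  (forall i, g i ^+ 2 <= K * (1 + f i ^+ 2)) -> exists z, mulop g (x, z).
Proof.
move=> H K0 gf; have [|//|z zE] := @exists_dominated (fun i => (g i)%:C * ip x (E i)) x y K.
  move=> i; rewrite sqmodZ (H i) sqmodZ.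
  have := gf i; have := sqmod_ge0 (ip x (E i)); set s := sqmod _.
  by move=> s0 gi; apply: le_trans (ler_wpM2r s0 gi) _; apply: ler_of_eq; ring.
by exists z; apply: zE.
Qed.

Lemma mulop_fsum f s a : uniq s ->
  mulop f (fsum s a, fsum s (fun i => (f i)%:C * a i)).
Proof.
by move=> us i /=; rewrite !coef_fsum//; case: ifP => _ //; rewrite mulr0.
Qed.

Lemma mulop_proj f s x y : mulop f (x, y) -> uniq s -> mulop f (proj s x, proj s y).
Proof.
move=> H us i /=; rewrite /proj !coef_fsum//; case: ifP => _; first exact: H.
by rewrite mulr0.
Qed.

Lemma mulop_lin f : lin_graph (mulop f).
Proof.
split.
- by move=> c x y x' y' H H' i /=; rewrite !(ip_lin hV) (H i) (H' i) /=; ring.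
- by move=> i /=; rewrite (ip0 hV) mulr0.
- by move=> y H; apply: (onb_total hE) => i; rewrite (H i)/= (ip0 hV) mulr0.
Qed.

Lemma mulop_sym f x y x' y' : mulop f (x, y) -> mulop f (x', y') -> ip y x' = ip x y'.
Proof.
move=> H H'; have K c : mulop f (c *: x', c *: y').
  by move=> i /=; rewrite !(ipZ hV) (H' i)/= mulrCA.
apply: (ip_ext hV) => c; move: (K c); move: (c *: x') (c *: y') => x1 y1 {}K.
apply: cvgn_uniq (@rip_series y x1) _.
rewrite (_ : (fun n => _) = (fun n => \sum_(i <- S n) Re (ip x (E i) * (ip y1 (E i))^*))).
  exact: rip_series.
apply/funext => n; apply: eq_bigr => i _; rewrite (H i) (K i)/= rmorphM/=.
by congr complex.Re; rewrite mulrAC mulrA conjR; ring.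
Qed.

Lemma mulop_closed f : gclosure ip ip (mulop f) `<=` mulop f.
Proof.
move=> [x y] [u [v [/= Huv ux vy]]] i /=; apply: complex_ext => c.
have := hcvg_rip hV (hcvgZ hV c vy) (hcvg_cst hV (E i)); rewrite (ipZ hV).
move=> /cvgn_uniq; apply.
have := hcvg_rip hV (hcvgZ hV (c * (f i)%:C) ux) (hcvg_cst hV (E i)).
rewrite (ipZ hV) mulrA; rewrite [X in X @ _ --> _ -> _](_ : _ =
  (fun n => Re (ip (c *: v n) (E i))))//.
by apply/funext => n; rewrite !(ipZ hV) (Huv n i)/= mulrA.
Qed.

Lemma gclosure_mulop f (D : set V) : (forall n x, D (proj (S n) x)) ->
  gclosure ip ip [set p | mulop f p /\ D p.1] = mulop f.
Proof.
move=> HD; apply/seteqP; split=> -[x y].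
  move=> [u [v [/= Huv ux vy]]]; apply: mulop_closed; exists u, v; split => //= n.
  by case: (Huv n).
move=> H; exists (fun n => proj (S n) x), (fun n => proj (S n) y); split => /=.
- by move=> n; split => //; apply: mulop_proj => //; exact: onb_uniq.
- exact: proj_cvg.
- exact: proj_cvg.
Qed.

Lemma mulop_dense f x : exists2 u, (forall n : nat, exists w, mulop f (u n, w)) & hcvg ip u x.
Proof.
exists (fun n => proj (S n) x); last exact: proj_cvg.
by move=> n; eexists; apply: mulop_fsum; exact: onb_uniq.
Qed.

Lemma mulop_selfadjoint f : selfadjoint ip (mulop f).
Proof.
split; first exact: mulop_dense.
apply/seteqP; split=> -[x y] H; last by move=> u v Huv /=; exact: (mulop_sym Huv H).
move=> i /=; have Hi : mulop f (E i, (f i)%:C *: E i).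
  by move=> j /=; rewrite (ipZ hV) (onb_orth hE); case: eqP => [->//|_]; rewrite !mulr0.
have := H _ _ Hi; rewrite /= (ipZ hV) => /(congr1 Num.conj).
by rewrite rmorphM/= conjR -!(ip_conj hV).
Qed.

Lemma mulop_inv f (f1 : forall i, 1 <= f i) y : exists x, mulop f (x, y).
Proof.
have [||x xE] := @exists_dominated (fun i => ((f i)^-1)%:C * ip y (E i)) y y 1;
  [|exact: ler01|]; last first.
  exists x => i /=; rewrite xE mulrA -rmorphM/= divff ?mul1r//.
  by rewrite gt_eqF// (lt_le_trans ltr01).
move=> i; rewrite mul1r sqmodZ.
have : (f i)^-1 ^+ 2 <= 1.
  rewrite expr_le1// ?invr_ge0 ?invf_le1// ?(le_trans ler01)//.
  by rewrite (lt_le_trans ltr01).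
by have := sqmod_ge0 (ip y (E i)); set s := sqmod _; set t := _ ^+ 2; nra.
Qed.

Lemma mulop_gram f : gram ip ip (mulop f) = mulop (fun i => f i ^+ 2).
Proof.
apply/seteqP; split=> -[x y].
  move=> [w Hw H] i /=.
  have Hi : mulop f (E i, (f i)%:C *: E i).
    by move=> j /=; rewrite (ipZ hV) (onb_orth hE); case: eqP => [->//|_]; rewrite !mulr0.
  by rewrite -(H _ _ Hi) (ipZrR hV) (Hw i)/= expr2 rmorphM/= mulrA.
(* The domain of the square lies in the domain of [mulop f], because [t <= 1 + t ^ 2] for
   [t = f i ^+ 2]. *)
move=> H; have [w Hw] : exists w, mulop f (x, w).
  apply: (mulop_dom H (ler01)) => i; rewrite mul1r.
  by have := sqr_ge0 (f i ^+ 2 - 1); have := sqr_ge0 (f i); set t := f i ^+ 2; nra.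
exists w => // z w' Hz /=; apply: esym.
have Hwy : mulop f (w, y) by move=> i /=; rewrite (H i) (Hw i)/= expr2 rmorphM/= mulrA.
exact: (mulop_sym Hwy Hz).
Qed.

Lemma mulop_accretive f : (forall i, 0 <= f i) -> accretive ip (mulop f).
Proof.
move=> f0; split.
- by move=> a x y x' y'; exact: (lin_graph_lin (mulop_lin f)).
- by move=> x y x' y'; exact: mulop_sym.
- move=> x y H; have sqf : mulop (fun i => Num.sqrt (f i) ^+ 2) (x, y).
    by move=> i; rewrite sqr_sqrtr.
  rewrite -mulop_gram in sqf; have [w Hw K] := sqf.
  by rewrite /= -(K _ _ Hw) (ip_ge0 hV).
- exact: mulop_dense.
move=> e e0 y.
have f1 i : 1 <= 1 + e * f i by rewrite lerDl mulr_ge0 ?(ltW e0).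
have [x Hx] := mulop_inv f1 y.
exists x, ((e^-1)%:C *: (y - x)); split; last first.
  by rewrite scalerA -rmorphM/= divff ?gt_eqF// scale1r addrC subrK.
move=> i /=; rewrite (ipZ hV) (ipB hV) (Hx i)/= rmorphD/= mulrDl mul1r addrC addKr.
by rewrite mulrA -rmorphM/= mulrA mulVf ?gt_eqF// mul1r.
Qed.

(** [opform] closes the form from the domain of [mulop f] only. Finite projections lie in this
    domain and converge in the graph of the square root, so the closure reaches the whole domain of
    the square root. *)
Lemma opform_mulop f : (forall i, 0 <= f i) ->
  opform ip (mulop f) = gform ip (mulop (fun i => Num.sqrt (f i))).
Proof.
move=> f0; pose D : set V := [set x | exists y, mulop f (x, y)].
pose G := [set p | mulop (fun i => Num.sqrt (f i)) p /\ D p.1].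
have PD n x : D (proj (S n) x) by eexists; apply: mulop_fsum; exact: onb_uniq.
have ff : (fun i => Num.sqrt (f i) ^+ 2) = f by apply/funext => i; rewrite sqr_sqrtr.
have lG : lin_graph G.
  have L := mulop_lin (fun i => Num.sqrt (f i)); have L' := mulop_lin f.
  split; last by move=> w [] /(lin_graph_fun L).
    move=> c x w x' w' [H [y Hy]] [H' [y' Hy']]; split; first exact: (lin_graph_lin L).
    by exists (c *: y + y'); exact: (lin_graph_lin L').
  split; first exact: (lin_graph0 L); by exists 0; exact: (lin_graph0 L').
rewrite -(gclosure_mulop (fun i => Num.sqrt (f i)) PD) -/G -(qclosure_gform ip hV lG) /opform; congr (qclosure ip _).
apply/seteqP; split=> -[x r] /=.
  move=> [y Hy ->]; have := Hy; rewrite -{1}ff -mulop_gram => -[w Hw K].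
  exists w; first by split => //; exists y.
  by rewrite /= (hnorm_sqr hV) (K _ _ Hw).
move=> [w [Hw [y Hy]] /= ->]; exists y => //; rewrite (hnorm_sqr hV).
have := Hy; rewrite -{1}ff -mulop_gram => -[w' Hw' K].
by rewrite -(K _ _ Hw); rewrite (lgF (mulop_lin _) Hw Hw').
Qed.

Lemma mulop_resolvent f e x i : (forall i, 0 <= f i) -> 0 <= e ->
  ip (resolvent (mulop f) e x) (E i) = ((1 + e * f i)^-1)%:C * ip x (E i).
Proof.
move=> f0; rewrite le_eqVlt => /orP[/eqP <-|e0].
  by rewrite res0// mul0r addr0 invr1 mul1r.
have [z Hz xE] := resP (mulop_accretive f0) x e0.
have p0 : 1 + e * f i != 0 by rewrite gt_eqF// ltr_wpDr// mulr_ge0 ?(ltW e0).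
rewrite -{2}xE (ipD hV) (ipZ hV) (Hz i)/= mulrA -rmorphM/=.
rewrite -{2}[ip (resolvent _ _ _) _]mul1r -mulrDl -rmorphD/= mulrA -rmorphM/=.
by rewrite mulVf// mul1r.
Qed.

(** Squeeze with [h = s / 2 ^ k]: from below [1 + h <= exp h], from above [1 / (1 + h) <= 1 - h + h
    ^ 2 <= exp (- h + h ^ 2)]. After [2 ^ k] factors the upper exponent is [- s + s ^ 2 / 2 ^ k]. *)
Lemma euler_exp_cvg (s : R) : 0 <= s ->
  (fun k => (1 + s / 2 ^+ k)^-1 ^+ (2 ^ k)) @ \oo --> expR (- s).
Proof.
move=> s0; apply: (@squeeze_cvgr _ _ _ _ (fun k => expR (- s))
   (fun k => expR (- s + s ^+ 2 * 2^-1 ^+ k))).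
- near=> k; have p0 : 0 < 2 ^+ k :> R by rewrite exprn_gt0.
  have h0 : 0 <= s / 2 ^+ k by rewrite divr_ge0 ?(ltW p0).
  have hp : 0 < 1 + s / 2 ^+ k by rewrite ltr_pwDl.
  have pE : (s / 2 ^+ k) * (2 ^ k)%:R = s by rewrite natrX mulfVK ?gt_eqF.
  apply/andP; split.
    rewrite expRN exprVn lef_pV2 ?posrE ?expR_gt0 ?exprn_gt0//.
    rewrite -{2}pE expRM_natr lerXn2r ?nnegrE ?(ltW hp) ?expR_ge0//.
    exact: expR_ge1Dx.
  have -> : - s + s ^+ 2 * 2^-1 ^+ k = (- (s / 2 ^+ k) + (s / 2 ^+ k) ^+ 2) * (2 ^ k)%:R.
    by rewrite natrX exprVn; move: p0; move: (2 ^+ k) => p /gt_eqF/negbT pn; field.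
  rewrite expRM_natr lerXn2r ?nnegrE ?invr_ge0 ?(ltW hp) ?expR_ge0//.
  apply: le_trans (expR_ge1Dx _); rewrite -(@ler_pM2r _ (1 + s / 2 ^+ k))// mulVf ?gt_eqF//.
  by move: h0; set h := s / _ => h0; have := exprn_ge0 3 h0; nra.
- exact: cvg_cst.
- have H : (fun k => - s + s ^+ 2 * 2^-1 ^+ k) @ \oo --> - s.
    rewrite -[X in _ --> X]addr0; apply: cvgnD; first exact: cvg_cst.
    exact: half_cvg0.
  by apply: (cvg_comp _ _ H); exact: continuous_expR.
Unshelve. all: by end_near. Qed.

Lemma mulop_expN f t x i : (forall i, 0 <= f i) -> 0 <= t ->
  ip (expN ip (mulop f) t x) (E i) = (expR (- (t * f i)))%:C * ip x (E i).
Proof.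
move=> f0 t0; have Hc := expN_euler hV (mulop_accretive f0) x t0.
have co k : ip (euler (mulop f) k t x) (E i) =
    ((1 + (t * f i) / 2 ^+ k)^-1 ^+ (2 ^ k))%:C * ip x (E i).
  rewrite /euler; elim: (2 ^ k)%N => [|n IH]; first by rewrite expr0 mul1r.
  rewrite iterS mulop_resolvent ?dyad_ge0// IH mulrA -rmorphM/= exprS mulrAC.
  by [].
apply: complex_ext => c.
have := hcvg_rip hV (hcvgZ hV c Hc) (hcvg_cst hV (E i)); rewrite (ipZ hV).
move=> /cvgn_uniq; apply.
rewrite mulrCA ReZ; rewrite (_ : (fun n => _) = (fun k =>
   (1 + (t * f i) / 2 ^+ k)^-1 ^+ (2 ^ k) * Re (c * ip x (E i)))).
  apply: cvgnM; last exact: cvg_cst.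
  by apply: euler_exp_cvg; rewrite mulr_ge0.
by apply/funext => k; rewrite (ipZ hV) co mulrCA ReZ.
Qed.

End OrthonormalBasis.

(** * The Hilbert spaces [l2 R] and [hs R] *)

Section ComplexSums.
Context (R : realType).
Local Notation Re := complex.Re.
Local Notation Im := complex.Im.
Implicit Types (u v : nat -> R[i]) (z w : R[i]).

(** Unlike an equation for [csum], this records convergence: [limn] of a divergent series is only a
    default value. *)
Definition csums u z : Prop :=
  series (fun k => Re (u k)) @ \oo --> Re z /\
  series (fun k => Im (u k)) @ \oo --> Im z.

Lemma csums_csum u z : csums u z -> csum u = z.
Proof.
move=> [ur ui]; rewrite /csum (cvg_lim (@norm_hausdorff _ _) ur).
by rewrite (cvg_lim (@norm_hausdorff _ _) ui); case: z {ur ui}.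
Qed.

Lemma csums_lin c u v z w : csums u z -> csums v w ->
  csums (fun k => c * u k + v k) (c * z + w).
Proof.
move=> [ur ui] [vr vi]; split.
  have -> : series (fun k => Re (c * u k + v k)) =
     (fun n => (Re c * series (fun k => Re (u k)) n
       + (- Im c) * series (fun k => Im (u k)) n) + series (fun k => Re (v k)) n).
    apply/funext => n; rewrite /series /= !mulr_sumr -!big_split/=.
    by apply: eq_bigr => k _; case: c (u k) (v k) => ? ? [? ?] [? ?] /=; ring.
  have -> : Re (c * z + w) = (Re c * Re z + (- Im c) * Im z) + Re w.
    by case: c z w {ur ui vr vi} => ? ? [? ?] [? ?] /=; ring.
  by do 2!(apply: cvgnD => //); apply: cvgnZ.
have -> : series (fun k => Im (c * u k + v k)) =
   (fun n => (Re c * series (fun k => Im (u k)) n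
     + (Im c) * series (fun k => Re (u k)) n) + series (fun k => Im (v k)) n).
  apply/funext => n; rewrite /series /= !mulr_sumr -!big_split/=.
  by apply: eq_bigr => k _; case: c (u k) (v k) => ? ? [? ?] [? ?] /=; ring.
have -> : Im (c * z + w) = (Re c * Im z + (Im c) * Re z) + Im w.
  by case: c z w {ur ui vr vi} => ? ? [? ?] [? ?] /=; ring.
by do 2!(apply: cvgnD => //); apply: cvgnZ.
Qed.

Lemma csums_conj u z : csums u z -> csums (fun k => (u k)^*)%R (z^*)%R.
Proof.
move=> [ur ui]; split.
  rewrite (_ : Re _ = Re z); last by case: z {ur ui}.
  by rewrite (_ : (fun k => _) = (fun k => Re (u k)))//; apply/funext => k; case: (u k).
rewrite (_ : Im _ = -1 * Im z); last by case: z {ur ui} => ? ? /=; rewrite mulN1r.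
rewrite (_ : series _ = (fun n => -1 * series (fun k => Im (u k)) n)); first exact: cvgnZ.
apply/funext => n; rewrite /series /= mulr_sumr; apply: eq_bigr => k _.
by case: (u k) => ? ? /=; rewrite mulN1r.
Qed.

Lemma csum_single u k : (forall j, j != k -> u j = 0) -> csum u = u k.
Proof.
move=> H; apply: csums_csum.
have S (F : R[i] -> R) n : F 0 = 0 -> (k < n)%N -> series (fun j => F (u j)) n = F (u k).
  move=> F0 kn; rewrite /series /= big_mkord (bigD1 (Ordinal kn))//= big1 ?addr0// => j jk.
  by rewrite H.
by split; apply/cvgn_subP => e e0; exists k.+1 => n kn; rewrite S// subrr normr0.
Qed.

Lemma real_complete (f : nat -> R) :
  (forall e : R, 0 < e -> exists N, forall n k, (N <= n)%N -> (N <= k)%N ->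
     `|f n - f k| < e) -> exists l : R, f @ \oo --> l.
Proof.
move=> H; exists (lim (f @ \oo)); apply/cauchy_cvgP/cauchy_exP => e e0.
have [N HN] := H _ e0; exists (f N); exists N => // n /= Nn.
by rewrite /ball /=; exact: HN.
Qed.

(** The scalars as a Hilbert space, so that [l2] and [hs] are both instances of the same direct sum:
    of scalars, and of columns in [l2]. *)
Definition cip (z w : R[i]^o) : R[i] := z * (w^*)%R.

Lemma cip_hnorm_sqr (z : R[i]^o) : hnorm cip z ^+ 2 = sqmod z.
Proof.
rewrite /hnorm /cip sqr_sqrtr -?sqmodE//; first exact: sqmod_ge0.
Qed.

Lemma cip_hnorm (z : R[i]^o) : hnorm cip z = Num.sqrt (sqmod z).
Proof. by rewrite /hnorm /cip -sqmodE. Qed.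

Lemma cip_hilbert : hilbert cip.
Proof.
split.
- by move=> a x y z; rewrite /cip mulrDl -mulrA.
- by move=> x y; rewrite /cip rmorphM/= conjCK mulrC.
- by move=> x; rewrite /cip -sqmodE sqmod_ge0.
- move=> x; rewrite /cip -sqmodE /sqmod => /eqP.
  rewrite paddr_eq0 ?sqr_ge0// !sqrf_eq0; case: x => a b /= /andP[/eqP -> /eqP ->].
  by [].
move=> u H.
have nr (z : R[i]^o) : `|Re z| <= hnorm cip z.
  by rewrite cip_hnorm -sqrtr_sqr ler_sqrt ?sqmod_ge0// lerDl sqr_ge0.
have ni (z : R[i]^o) : `|Im z| <= hnorm cip z.
  by rewrite cip_hnorm -sqrtr_sqr ler_sqrt ?sqmod_ge0// lerDr sqr_ge0.
have [a ua] : exists l : R, (fun n => Re (u n)) @ \oo --> l.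
  apply: real_complete => e e0; have [N HN] := H _ e0; exists N => n k Nn Nk.
  rewrite (_ : _ - _ = Re (u n - u k)); last by case: (u n) (u k) => ? ? [].
  exact: le_lt_trans (nr _) (HN _ _ Nn Nk).
have [b ub] : exists l : R, (fun n => Im (u n)) @ \oo --> l.
  apply: real_complete => e e0; have [N HN] := H _ e0; exists N => n k Nn Nk.
  rewrite (_ : _ - _ = Im (u n - u k)); last by case: (u n) (u k) => ? ? [].
  exact: le_lt_trans (ni _) (HN _ _ Nn Nk).
exists (a +i* b); apply: (@hcvg_le _ _ _ _ _ (fun n => `|Re (u n) - a| + `|Im (u n) - b|)).
  move=> n; rewrite cip_hnorm -[leRHS]ger0_norm ?addr_ge0// -sqrtr_sqr ler_sqrt ?sqr_ge0//.
  rewrite /sqmod; case: (u n) => p q /=.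
  have h1 : `|p - a| ^+ 2 = (p - a) ^+ 2 by rewrite real_normK ?num_real.
  have h2 : `|q - b| ^+ 2 = (q - b) ^+ 2 by rewrite real_normK ?num_real.
  by rewrite -h1 -h2; have := normr_ge0 (p - a); have := normr_ge0 (q - b); nra.
rewrite -[X in _ --> X](addr0 0); apply: cvgnD; apply/cvgn0P => e e0.
  have [N HN] := (cvgn_subP _ _).1 ua _ e0; exists N => n /HN.
  by rewrite normr_id.
have [N HN] := (cvgn_subP _ _).1 ub _ e0; exists N => n /HN.
by rewrite normr_id.
Qed.

End ComplexSums.

(** * Countable Hilbert direct sums *)

Section DirectSum.
Context (R : realType) (K V : lmodType R[i]) (kp : K -> K -> R[i]).
Context (ip : V -> V -> R[i]) (col : V -> nat -> K).
Local Notation Re := complex.Re.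
Local Notation Im := complex.Im.
Local Notation "N[ x ]" := (hnorm ip x) (at level 0, format "N[ x ]").
Local Notation "K[ x ]" := (hnorm kp x) (at level 0, format "K[ x ]").
Hypotheses (hK : hilbert kp)
  (ipE : forall x y, ip x y = csum (fun k => kp (col x k) (col y k)))
  (col_lin : forall a x y k, col (a *: x + y) k = a *: col x k + col y k)
  (col_inj : forall x, (forall k, col x k = 0) -> x = 0)
  (col_sum : forall x, cvgn (series (fun k => K[col x k] ^+ 2)))
  (col_ex : forall a : nat -> K,
    (exists M, forall n, \sum_(0 <= k < n) K[a k] ^+ 2 <= M) ->
    exists x, forall k, col x k = a k).

Let Re_cvg x y : cvgn (series (fun k => Re (kp (col x k) (col y k)))).
Proof.
apply: normed_cvg; apply: (@series_le_cvg _ _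
  (fun k => K[col x k] ^+ 2 + K[col y k] ^+ 2)).
- by move=> k; exact: normr_ge0.
- by move=> k; rewrite addr_ge0 ?sqr_ge0.
- move=> k; apply: le_trans (CSN hK _ _) _.
  have := sqr_ge0 (K[col x k] - K[col y k]).
  by have := hnorm_ge0 kp (col x k); have := hnorm_ge0 kp (col y k); nra.
- by apply: is_cvg_seriesD; exact: col_sum.
Qed.

Let colZ a x k : col (a *: x) k = a *: col x k.
Proof.
have c0 : col 0 k = 0.
  by have := col_lin (-1) 0 0 k; rewrite scaleN1r addNr scaleN1r addNr.
by have := col_lin a x 0 k; rewrite !addr0 c0 addr0.
Qed.

Lemma direct_sum_csums x y : csums (fun k => kp (col x k) (col y k)) (ip x y).
Proof.
have C : csums (fun k => kp (col x k) (col y k))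
    (limn (series (fun k => Re (kp (col x k) (col y k)))) +i*
     limn (series (fun k => Im (kp (col x k) (col y k))))).
  split => /=; first exact: Re_cvg.
  rewrite (_ : (fun k => Im _) = (fun k => Re (kp (col x k) (col ('i *: y) k)))).
    exact: Re_cvg.
  by apply/funext => k; rewrite colZ (Im_ip hK).
by rewrite ipE (csums_csum C).
Qed.

Let partial_le x n : \sum_(0 <= k < n) K[col x k] ^+ 2 <= Re (ip x x).
Proof.
have [H _] := direct_sum_csums x x; apply: (cvgn_le (cvg_cst _) H).
exists n => p np; rewrite /series /= (big_cat_nat (leq0n n) np)/=.
under [X in _ <= X + _]eq_bigr do rewrite -(hnorm_sqr hK).
by rewrite lerDl sumr_ge0// => k _; exact: (ip_ge0 hK).
Qed.

Let norm_le x M : 0 <= M -> (forall n, \sum_(0 <= k < n) K[col x k] ^+ 2 <= M ^+ 2) ->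
  N[x] <= M.
Proof.
move=> M0 H; have [L _] := direct_sum_csums x x.
rewrite -[leRHS]ger0_norm// -sqrtr_sqr /hnorm ler_sqrt ?sqr_ge0//.
apply: (cvgn_le L (cvg_cst _)); exists 0%N => n _.
by apply: le_trans (H n); rewrite /series /=; under [leRHS]eq_bigr do rewrite (hnorm_sqr hK).
Qed.

(** Completeness: columns converge one by one, and a bound on finite partial sums of squares passes
    to the limit columns ([lim_sum]). This is used once to see that the limit columns form a vector,
    and once for the distance to it. *)
Lemma direct_sum_hilbert : hilbert ip.
Proof.
have ge0 x : 0 <= Re (ip x x) by have := partial_le x 0; rewrite big_nil.
have lin a x y z : ip (a *: x + y) z = a * ip x z + ip y z.
  rewrite ipE; apply: csums_csum.
  have := csums_lin a (direct_sum_csums x z) (direct_sum_csums y z).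
  by congr csums; apply/funext => k; rewrite col_lin (ip_lin hK).
split => //.
- move=> x y; rewrite (ipE y x); apply: csums_csum.
  have := csums_conj (direct_sum_csums x y).
  by congr csums; apply/funext => k; rewrite -(ip_conj hK).
- move=> x x0; apply: col_inj => k; apply: (hnorm0_eq0 hK).
  apply/eqP; rewrite -sqrf_eq0; apply/eqP/le_anti; rewrite sqr_ge0 andbT -x0.
  by apply: le_trans (partial_le x k.+1); rewrite big_nat_recr//= lerDr sumr_ge0// => i _; exact: sqr_ge0.
move=> u Hu.
have sq_le x n : \sum_(0 <= k < n) K[col x k] ^+ 2 <= N[x] ^+ 2.
  by rewrite /hnorm sqr_sqrtr// partial_le.
have col_le x k : K[col x k] <= N[x].
  rewrite -(@ler_pXn2r _ 2)// ?nnegrE ?hnorm_ge0//; apply: le_trans (sq_le x k.+1).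
  by rewrite big_nat_recr//= lerDr sumr_ge0// => i _; exact: sqr_ge0.
have colB x y k : col (x - y) k = col x k - col y k.
  by rewrite addrC -scaleN1r col_lin scaleN1r addrC.
have /choice[a Ha] : forall k, exists l, hcvg kp (fun n => col (u n) k) l.
  move=> k; apply: (hcomplete hK) => e e0; have [N HN] := Hu _ e0; exists N => n p Nn Np.
  by rewrite -colB; apply: le_lt_trans (col_le _ _) (HN _ _ Nn Np).
have lim_sum (g : nat -> nat -> K) (c : nat -> K) p M :
    (forall k, hcvg kp (g^~ k) (c k)) ->
    (exists N, forall n, (N <= n)%N -> \sum_(0 <= k < p) K[g n k] ^+ 2 <= M) ->
    \sum_(0 <= k < p) K[c k] ^+ 2 <= M.
  move=> Hc HM; apply: (cvgn_le _ (cvg_cst M) HM).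
  elim: p {HM} => [|p IH].
    by rewrite big_nil (_ : (fun n => _) = fun=> 0); [exact: cvg_cst|apply/funext => n; rewrite big_nil].
  rewrite big_nat_recr//= (_ : (fun n => _) = (fun n =>
    \sum_(0 <= k < p) K[g n k] ^+ 2 + K[g n p] * K[g n p])).
    by apply: (cvgnD IH); rewrite expr2; apply: cvgnM; exact: (hcvg_hnorm hK (Hc p)).
  by apply/funext => n; rewrite big_nat_recr//= expr2.
have [N1 HN1] := Hu _ ltr01.
have [x xa] : exists x, forall k, col x k = a k.
  apply: col_ex; exists (2 * 1 ^+ 2 + 2 * N[u N1] ^+ 2) => p.
  apply: (@lim_sum (fun n => col (u n))) => //; exists N1 => n Nn.
  apply: le_trans (_ : _ <= 2 * \sum_(0 <= k < p) K[col (u n - u N1) k] ^+ 2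
     + 2 * \sum_(0 <= k < p) K[col (u N1) k] ^+ 2) _.
    rewrite !mulr_sumr -big_split/=; apply: ler_sum => k _.
    have := ler_hnormD hK (col (u n - u N1) k) (col (u N1) k).
    rewrite {1}colB subrK; have := hnorm_ge0 kp (col (u n - u N1) k).
    have := hnorm_ge0 kp (col (u N1) k); have := hnorm_ge0 kp (col (u n) k).
    have := sqr_ge0 (K[col (u n - u N1) k] - K[col (u N1) k]).
    set p1 := K[_]; set p2 := K[_]; set p3 := K[_] => H *; nra.
  apply: lerD; rewrite ler_pM2l//; apply: le_trans (sq_le _ _) _ => //.
  by rewrite lerXn2r ?nnegrE ?hnorm_ge0 ?ler01// ltW// HN1.
exists x; apply/hcvgP => e e0; have e2 : 0 < e / 2 by rewrite divr_gt0.
have [N HN] := Hu _ e2; exists N => n Nn; apply: le_lt_trans (_ : e / 2 < e).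
  apply: norm_le (ltW e2) _ => p.
  apply: (@lim_sum (fun l k => col (u n) k - col (u l) k)).
    move=> k; rewrite colB xa; apply: (hcvgB hK) => //; exact: hcvg_cst.
  exists N => l Nl; under eq_bigr do rewrite -colB.
  apply: le_trans (sq_le _ _) _.
  by rewrite lerXn2r ?nnegrE ?hnorm_ge0 ?(ltW e2)// ltW// HN.
by rewrite ltr_pdivrMr// ltr_pMr// ltr1n.
Qed.

End DirectSum.

Section L2Space.
Context (R : realType).
Local Notation Re := complex.Re.
Local Notation h := (l2 R).
Local Notation "N[ x ]" := (hnorm (@l2ip R) x) (at level 0, format "N[ x ]").
Implicit Types (x y : h) (a : nat -> R[i]).

Lemma l2_ex a : (exists M, forall n, \sum_(0 <= k < n) sqmod (a k) <= M) ->
  exists x : h, forall k, x k = a k.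
Proof.
move=> [M HM]; have aP : a \in @l2_pred R.
  apply/asboolP; apply: nondecreasing_is_cvgn; last first.
    by exists M => _ [n _ <-]; exact: HM.
  by apply: nondecreasing_series => k _ _; exact: sqmod_ge0.
by exists (L2 aP).
Qed.

Lemma l2_eq0 x : (forall k, x k = 0) -> x = 0.
Proof.
by move=> H; apply: val_inj; apply/funext => k; rewrite /= H.
Qed.

Lemma l2_hilbert : hilbert (@l2ip R).
Proof.
apply: (@direct_sum_hilbert R R[i]^o _ (@cip R) (@l2ip R) (fun x k => x k)).
- exact: cip_hilbert.
- by [].
- by [].
- exact: l2_eq0.
- move=> x; rewrite (_ : (fun k => _) = (fun k => sqmod (x k))).
    exact/asboolP/(l2valP x).
  by apply/funext => k; rewrite cip_hnorm_sqr.
- move=> a [M HM]; apply: l2_ex; exists M => n.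
  by under eq_bigr do rewrite -cip_hnorm_sqr; exact: HM.
Qed.

Lemma eE k j : (e_ k : h) j = (j == k)%:R.
Proof. by []. Qed.

Lemma l2ip_e x k : l2ip x (e_ k) = x k.
Proof.
rewrite /l2ip (@csum_single _ _ k) ?eE ?eqxx ?rmorph1 ?mulr1// => j /negPf jk.
by rewrite eE jk rmorph0 mulr0.
Qed.

Lemma l2_onb : onb (@l2ip R) (@e_ R) (iota 0).
Proof.
split.
- by move=> i j; rewrite l2ip_e eE eq_sym.
- by move=> x H; apply: l2_eq0 => k; rewrite -l2ip_e.
- by move=> n; exact: iota_uniq.
- by move=> n i; rewrite !mem_iota /= !add0n => /leqW.
- by move=> i; exists i.+1; rewrite mem_iota/= add0n.
Qed.

Lemma diagE (f : nat -> R) : diag f = mulop (@l2ip R) (@e_ R) f.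
Proof.
apply/seteqP; split=> -[x y] H k /=; first by rewrite !l2ip_e; exact: H.
by have := H k; rewrite /= !l2ip_e.
Qed.

Lemma l2_ext x y : (forall k, x k = y k) -> x = y.
Proof. by move=> H; apply: val_inj; apply/funext. Qed.

Lemma l2valD x y k : (x + y) k = x k + y k.
Proof. by []. Qed.

Lemma l2valZ (c : R[i]) x k : (c *: x) k = c * x k.
Proof. by []. Qed.

Definition bounded_functional (F : h -> R[i]) : Prop :=
  (forall (a : R[i]) x y, F (a *: x + y) = a * F x + F y) /\
  exists2 M : R, 0 <= M & forall x, sqmod (F x) <= M * N[x] ^+ 2.

Lemma bounded_functional_cvg F u x (c : R[i]) : bounded_functional F ->
  hcvg (@l2ip R) u x -> (fun n => Re (c * F (u n))) @ \oo --> Re (c * F x).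
Proof.
move=> [Fl [M M0 FM]] /hcvgP ux; apply/cvgn_subP => e e0.
have K0 : 0 < Num.sqrt (sqmod c * M) + 1 by rewrite ltr_wpDl ?sqrtr_ge0.
have eK : 0 < e / (Num.sqrt (sqmod c * M) + 1) by rewrite divr_gt0.
have [N HN] := ux _ eK; exists N => n /HN; rewrite ltr_pdivlMr// => H.
have FB : F (u n) - F x = F (u n - x).
  by rewrite [u n - x]addrC -(scaleN1r x) Fl mulN1r addrC.
rewrite -raddfB/= -mulrBr FB; apply: le_lt_trans H.
apply: le_trans (_ : Num.sqrt (sqmod (c * F (u n - x))) <= _).
  by rewrite -sqrtr_sqr ler_sqrt ?sqmod_ge0// /sqmod lerDl sqr_ge0.
apply: le_trans (_ : Num.sqrt (sqmod c * M * N[u n - x] ^+ 2) <= _).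
  rewrite ler_sqrt ?mulr_ge0 ?sqmod_ge0 ?hnorm_ge0 ?sqr_ge0//.
  rewrite sqmodM -mulrA.
  by rewrite ler_wpM2l ?sqmod_ge0.
rewrite sqrtrM ?mulr_ge0 ?sqmod_ge0// sqrtr_sqr ger0_norm ?hnorm_ge0// mulrC.
by rewrite ler_wpM2l ?hnorm_ge0// lerDl.
Qed.

(** The tool that upgrades identities of matrix entries, which only see basis vectors, to identities
    on all of [l2]. *)
Lemma bounded_functional_ext F G : bounded_functional F -> bounded_functional G ->
  (forall k, F (e_ k) = G (e_ k)) -> forall x, F x = G x.
Proof.
move=> bF bG FG x; apply: complex_ext => c.
have px := proj_cvg l2_hilbert l2_onb x.
have F0 H : bounded_functional H -> H 0 = 0.
  by move=> [L _]; have := L (-1) 0 0; rewrite scaler0 addr0 mulN1r addNr.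
have Hsum H s (a : nat -> R[i]) : bounded_functional H ->
    H (fsum (@e_ R) s a) = \sum_(i <- s) a i * H (e_ i).
  move=> bH; rewrite /fsum; elim: s => [|i s IH]; first by rewrite !big_nil F0.
  by rewrite !big_cons (proj1 bH) IH.
apply: cvgn_uniq (@bounded_functional_cvg F _ _ c bF px) _.
rewrite (_ : (fun n => _) = (fun n => Re (c * G (proj (@l2ip R) (@e_ R) (iota 0 n) x)))).
  exact: bounded_functional_cvg.
apply/funext => n; congr (Re (c * _)); rewrite !Hsum//.
by apply: eq_bigr => i _; rewrite FG.
Qed.

Lemma bounded_functional_ip (T : h -> h) y (c : R[i]) : bounded_linear (@l2ip R) T ->
  bounded_functional (fun x => c * l2ip (T x) y).
Proof.
move=> [Tl [M TM]]; split=> [a x z|].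
  by rewrite Tl (ip_lin l2_hilbert); ring.
exists (sqmod c * (2 * (`|M| * N[y]) ^+ 2)).
  by apply: mulr_ge0; [exact: sqmod_ge0|apply: mulr_ge0 => //; exact: sqr_ge0].
move=> x; rewrite sqmodM -[leRHS]mulrA ler_wpM2l ?sqmod_ge0//.
have B z : `|Re (l2ip (T x) z)| <= `|M| * N[x] * N[z].
  apply: le_trans (CSN l2_hilbert _ _) _; rewrite ler_wpM2r ?hnorm_ge0//.
  by apply: le_trans (TM x) _; rewrite ler_wpM2r ?hnorm_ge0// ler_norm.
have B1 := B y; have B2 := B ('i *: y); rewrite -(Im_ip l2_hilbert) in B2.
rewrite (hnormZsqrt l2_hilbert) (_ : sqmod 'i = 1) ?sqrtr1 ?mul1r in B2; last first.
  by rewrite /sqmod /= expr0n expr1n add0r.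
rewrite /sqmod -[Re _ ^+ 2]real_normK ?num_real// -[complex.Im _ ^+ 2]real_normK ?num_real//.
move: B1 B2; set P := `|M| * _ * _ => B1 B2.
rewrite [leRHS](_ : _ = P ^+ 2 + P ^+ 2); last by rewrite /P; ring.
by apply: lerD; rewrite lerXn2r ?nnegrE// (le_trans _ B1).
Qed.

Lemma bounded_linear_id : bounded_linear (@l2ip R) id.
Proof. by split => //; exists 1 => x; rewrite mul1r. Qed.

End L2Space.

Section HSSpace.
Context (R : realType).
Local Notation h := (l2 R).
Local Notation L := (hs R).
Local Notation "N[ x ]" := (hnorm (@l2ip R) x) (at level 0, format "N[ x ]").
Local Notation hV := (@l2_hilbert R).
Implicit Types (x y : h) (eta zeta : L).

Lemma hs_bounded eta : bounded_linear (@l2ip R) eta.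
Proof. by have /asboolP[] := hsvalP eta. Qed.

Lemma hs_linear eta (a : R[i]) x y : eta (a *: x + y) = a *: eta x + eta y.
Proof. by have [H _] := hs_bounded eta; exact: H. Qed.

Lemma hsD eta zeta x : (eta + zeta) x = eta x + zeta x. Proof. by []. Qed.
Lemma hs_ext0 eta zeta : (forall x, eta x = zeta x) -> eta = zeta.
Proof. by move=> H; apply: val_inj; apply/funext. Qed.

(** Lifted operators are defined by a condition at every vector, whereas computations use entries.
    Each row of a Hilbert-Schmidt operator is a bounded functional, hence determined on the
    basis. *)
Lemma hs_row (a : R[i]) eta zeta j i : (forall k, zeta (e_ k) j = a * eta (e_ k) i) ->
  forall x, zeta x j = a * eta x i.
Proof.
move=> H x; rewrite -!l2ip_e -[LHS]mul1r.
apply: (bounded_functional_ext (F := fun x => 1 * l2ip (zeta x) (e_ j))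
  (G := fun x => a * l2ip (eta x) (e_ i))).
- exact: (bounded_functional_ip _ _ (hs_bounded zeta)).
- exact: (bounded_functional_ip _ _ (hs_bounded eta)).
- by move=> k; rewrite !l2ip_e mul1r.
Qed.

Lemma hs_ext eta zeta : (forall k j, eta (e_ k) j = zeta (e_ k) j) -> eta = zeta.
Proof.
move=> H; apply: hs_ext0 => x; apply: l2_ext => j; rewrite -[RHS]mul1r.
by apply: hs_row => k; rewrite mul1r.
Qed.

(** The operator is the sum of [x k *: a k], which converges because each term has norm at most
    [sqmod (x k) + N[a k] ^+ 2]. *)
Lemma hs_ex (a : nat -> h) : (exists M, forall n, \sum_(0 <= k < n) N[a k] ^+ 2 <= M) ->
  exists eta : L, forall k, eta (e_ k) = a k.
Proof.
move=> [M HM]; pose u x n := \sum_(0 <= k < n) x k *: a k.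
have sub_sum (V : zmodType) (F : nat -> V) n p : (n <= p)%N ->
    \sum_(0 <= k < p) F k - \sum_(0 <= k < n) F k = \sum_(n <= k < p) F k.
  by move=> np; rewrite (big_cat_nat (leq0n n) np)/= addrAC subrr add0r.
have nle x n p : N[\sum_(n <= k < p) x k *: a k] <=
    \sum_(n <= k < p) (sqmod (x k) + N[a k] ^+ 2).
  elim/big_ind2 : _ => [|? ? ? ? H1 H2|k _]; first by rewrite (hnorm0 hV).
    by apply: le_trans (ler_hnormD hV _ _) _; exact: lerD.
  rewrite (hnormZsqrt hV) -{2}(sqr_sqrtr (sqmod_ge0 (x k))).
  have := sqrtr_ge0 (sqmod (x k)); have := hnorm_ge0 (@l2ip R) (a k).
  by have := sqr_ge0 (Num.sqrt (sqmod (x k)) - N[a k]); nra.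
have xs x : cvgn (series (fun k => sqmod (x k))) by exact/asboolP/(l2valP x).
have as_ : cvgn (series (fun k => N[a k] ^+ 2)).
  apply: nondecreasing_is_cvgn; last by exists M => _ [n _ <-]; exact: HM.
  by apply: nondecreasing_series => k _ _; exact: sqr_ge0.
have Fb x n : \sum_(0 <= k < n) (sqmod (x k) + N[a k] ^+ 2) <= N[x] ^+ 2 + M.
  rewrite big_split/=; apply: lerD => //; rewrite l2norm_sqr.
  apply: nondecreasing_cvgn_le => //.
  by apply: nondecreasing_series => k _ _; exact: sqmod_ge0.
have /choice[T HT] : forall x, exists y, hcvg (@l2ip R) (u x) y.
  move=> x; apply: (bounded_increments_cvg hV (k := 1) isT ltr01 (Fb x)) => n p np.
  by rewrite mul1r /u !sub_sum//; exact: nle.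
have Tl : linear T.
  move=> c x y; apply: (hcvg_uniq hV) (HT _) _.
  have -> : u (c *: x + y) = (fun n => c *: u x n + u y n).
    apply/funext => n; rewrite /u scaler_sumr -big_split/=.
    by apply: eq_bigr => k _; rewrite scalerDl scalerA.
  exact: (hcvgD hV (hcvgZ hV c (HT x)) (HT y)).
have Tb x : N[T x] <= N[x] ^+ 2 + M.
  by apply: (hcvg_hnorm_le hV (HT x)) => n; exact: le_trans (nle _ _ _) (Fb _ _).
have Te k : T (e_ k) = a k.
  apply: (hcvg_uniq hV) (HT _) _; apply/hcvgP => e e0; exists k.+1 => n kn.
  suff -> : u (e_ k) n = a k by rewrite subrr (hnorm0 hV).
  rewrite /u big_mkord (bigD1 (Ordinal kn))// eE eqxx scale1r big1 => [|i ik]; first by rewrite /= addr0.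
  by rewrite eE (_ : (i == k :> nat) = false) ?scale0r//; apply/negbTE.
have M0 : 0 <= M by have := HM 0%N; rewrite big_nil.
have TP : T \in @hs_pred R.
  apply/asboolP; split; first split => //.
    have T0 : T 0 = 0 by have := Tl (-1) 0 0; rewrite scaler0 addr0 scaleN1r addNr.
    have TZ c y : T (c *: y) = c *: T y by have := Tl c y 0; rewrite !addr0 T0 addr0.
    (* The bound [Tb] is not homogeneous; at the normalized vector it reads [1 + M], and scaling
       back gives a linear bound. *)
    exists (1 + M) => x; have [->|x0] := eqVneq x 0.
      by rewrite T0 (hnorm0 hV) mulr0.
    have nx : 0 < N[x].
      rewrite lt_def hnorm_ge0 andbT; apply: contra_neq x0; exact: (hnorm0_eq0 hV).
    have := Tb ((N[x]^-1)%:C *: x); rewrite TZ !(hnormZ hV) gtr0_norm ?invr_gt0//.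
    rewrite mulVf ?gt_eqF// expr1n ler_pdivrMl// mulrC.
    by [].
  by rewrite (_ : (fun k => _) = (fun k => N[a k] ^+ 2))//; apply/funext => k; rewrite Te.
by exists (HS TP) => k; exact: Te.
Qed.

Lemma hs_hilbert : hilbert (@hsip R).
Proof.
apply: (@direct_sum_hilbert R h L (@l2ip R) (@hsip R) (fun eta k => eta (e_ k))).
- exact: l2_hilbert.
- by [].
- by [].
- by move=> eta H; apply: hs_ext => k j; rewrite H.
- by move=> eta; have /asboolP[_] := hsvalP eta.
- exact: hs_ex.
Qed.

Fact E_key (p : nat * nat) : exists eta : L, forall k, eta (e_ k) = (k == p.2)%:R *: e_ p.1.
Proof.
apply: hs_ex; exists 1 => n.
have e1 : N[e_ p.1] ^+ 2 = 1 by rewrite (hnorm_sqr hV) l2ip_e eE eqxx.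
have H (k : nat) : N[(k == p.2)%:R *: e_ p.1] ^+ 2 = (k == p.2)%:R.
  case: eqP => _; first by rewrite scale1r e1.
  by rewrite scale0r (hnorm0 hV) expr0n.
under eq_bigr do rewrite H.
have [pn|np] := ltnP p.2 n.
  rewrite big_mkord (bigD1 (Ordinal pn))//= eqxx big1 ?addr0// => i ip.
  by rewrite (_ : (i == p.2 :> nat) = false)//; apply/negbTE.
rewrite big_nat big1 ?ler01// => i /andP[_ ik].
by rewrite (_ : (i == p.2) = false)//; apply/negbTE; rewrite neq_ltn (leq_trans ik np).
Qed.

Definition Emx (p : nat * nat) : L := projT1 (cid (E_key p)).

Lemma EmxE p k j : Emx p (e_ k) j = ((j == p.1) && (k == p.2))%:R.
Proof.
rewrite /Emx; case: cid => eta /= ->; rewrite l2valZ eE mulrC -natrM mulnb; by [].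
Qed.

Definition coef eta (p : nat * nat) : R[i] := eta (e_ p.2) p.1.

Lemma hsip_E eta p : hsip eta (Emx p) = coef eta p.
Proof.
rewrite /hsip (@csum_single _ _ p.2).
  rewrite (_ : Emx p (e_ p.2) = e_ p.1) ?l2ip_e//.
  by apply: l2_ext => j; rewrite EmxE eqxx andbT.
move=> j /negPf jp; rewrite (_ : Emx p (e_ j) = 0) ?(ip0r hV)//.
by apply: l2_ext => i; rewrite EmxE jp andbF.
Qed.

Definition square (n : nat) : seq (nat * nat) := [seq (j, k) | j <- iota 0 n, k <- iota 0 n].

Lemma mem_square n p : (p \in square n) = (p.1 < n)%N && (p.2 < n)%N.
Proof.
case: p => j k; rewrite /square; apply/allpairsP/andP => [[[j' k'] /= [+ + [-> ->]]]|[/= jn kn]].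
  by rewrite !mem_iota /= !add0n.
by exists (j, k); rewrite !mem_iota /= !add0n.
Qed.

Lemma hs_onb : onb (@hsip R) Emx square.
Proof.
split.
- by move=> i j; rewrite hsip_E /coef EmxE eq_sym [j.2 == _]eq_sym -xpair_eqE -!surjective_pairing.
- move=> eta H; apply: hs_ext => k j; have := H (j, k); rewrite hsip_E /coef /= => ->.
  by [].
- by move=> n; apply: allpairs_uniq; rewrite ?iota_uniq// => -[? ?] [? ?].
- by move=> n p; rewrite !mem_square => /andP[a b]; rewrite !leqW.
- move=> p; exists (maxn p.1 p.2).+1; rewrite mem_square !ltnS.
  by rewrite leq_maxl leq_maxr.
Qed.

Lemma sum_square n (F : nat * nat -> R) :
  \sum_(p <- square n) F p = \sum_(0 <= j < n) \sum_(0 <= k < n) F (j, k).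
Proof. by rewrite /square big_allpairs /index_iota subn0. Qed.

(** The conjugate transpose has the same square sum, so Riesz-Fischer provides the operator. The
    adjoint relation holds on basis vectors and extends by boundedness, one slot at a time. *)
Lemma J_ex eta : exists zeta : L, forall x y, l2ip (eta x) y = l2ip x (zeta y).
Proof.
have [|zeta zE _] := @riesz_fischer _ _ _ hs_hilbert _ _ _ hs_onb
    (fun p => (coef eta (p.2, p.1))^*)%R.
  exists (hnorm (@hsip R) eta ^+ 2) => n.
  apply: le_trans (bessel hs_hilbert hs_onb eta (onb_uniq hs_onb n)).
  rewrite !sum_square exchange_big/=.
  apply: ler_of_eq.
  apply: eq_bigr => j _; apply: eq_bigr => k _; rewrite hsip_E.
  by case: (coef eta _) => ? ?; rewrite /sqmod /= sqrrN.
exists zeta.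
have S1 x j : l2ip (eta x) (e_ j) = l2ip x (zeta (e_ j)).
  rewrite -[LHS]mul1r -[RHS]mul1r; move: x.
  apply: bounded_functional_ext.
  - exact: (bounded_functional_ip _ _ (hs_bounded eta)).
  - exact: (bounded_functional_ip _ _ (@bounded_linear_id R)).
  - move=> k; rewrite (ip_conj hV (zeta _)) !l2ip_e !mul1r.
    by have := zE (k, j); rewrite hsip_E /coef /= => ->; rewrite conjCK.
move=> x y; rewrite (ip_conj hV y) (ip_conj hV (zeta y)); congr (_^*)%R.
rewrite -[LHS]mul1r -[RHS]mul1r; move: y; apply: bounded_functional_ext.
- exact: (bounded_functional_ip _ _ (@bounded_linear_id R)).
- exact: (bounded_functional_ip _ _ (hs_bounded zeta)).
- by move=> k; rewrite (ip_conj hV) S1 -(ip_conj hV).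
Qed.

Lemma JP eta x y : l2ip (eta x) y = l2ip x (J eta y).
Proof.
by rewrite /J; case: xgetP => [z _ ->//|]; have [z Hz] := J_ex eta; move/(_ z) => [].
Qed.

Lemma coefJ eta j k : coef (J eta) (j, k) = ((coef eta (k, j))^*)%R.
Proof. by rewrite /coef /= -!l2ip_e (ip_conj hV (e_ j)) -JP. Qed.

Lemma hs_coef_ext eta zeta : (forall j k, coef eta (j, k) = coef zeta (j, k)) -> eta = zeta.
Proof. by move=> H; apply: hs_ext => k j; exact: H. Qed.

Lemma JK eta : J (J eta) = eta.
Proof. by apply: hs_coef_ext => j k; rewrite !coefJ conjCK. Qed.

Lemma hs_coefD eta zeta p : coef (eta + zeta) p = coef eta p + coef zeta p.
Proof. by []. Qed.
Lemma hs_coefB eta zeta p : coef (eta - zeta) p = coef eta p - coef zeta p.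
Proof. by []. Qed.
Lemma hs_coefZ (c : R[i]) eta p : coef (c *: eta) p = c * coef eta p.
Proof. by []. Qed.

End HSSpace.

(** * Powers of the creation operator *)

Section CreationOperators.
Context (R : realType).
Local Notation Re := complex.Re.
Local Notation h := (l2 R).
Local Notation hV := (@l2_hilbert R).
Local Notation oV := (@l2_onb R).
Implicit Types (x y : h) (m i k : nat).

(* [||(A^* )^m e_k||^2] *)
Definition rfact m k : nat := \prod_(i < m) (k + i.+1).

Definition rfact_sqrt m k : R := Num.sqrt (rfact m k)%:R.

Lemma rfact_gt0 m k : (0 < rfact m k)%N.
Proof. by apply: prodn_gt0 => i; rewrite addnS. Qed.

Lemma rfactS m k : rfact m.+1 k = (rfact m k * (k + m.+1))%N.
Proof. by rewrite /rfact big_ord_recr. Qed.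

Lemma rfact_ge_expn m k : (k ^ m <= rfact m k)%N.
Proof.
elim: m => [|m IH]; first by rewrite expn0 rfact_gt0.
by rewrite rfactS expnSr leq_mul// leq_addr.
Qed.

Lemma rfact_le_expn m k : (rfact m k <= m.+1 ^ m * (1 + k ^ m))%N.
Proof.
(* Each factor satisfies [k + i + 1 <= (m + 1) * max 1 k], as [i < m]; the maximum keeps this true
   at [k = 0]. *)
have H : (rfact m k <= \prod_(i < m) (m.+1 * maxn 1 k))%N.
  apply: leq_prod => i _.
  rewrite mulSn leq_add ?leq_maxr//; apply: leq_trans (ltn_ord i) _.
  by rewrite leq_pmulr// leq_maxl.
apply: leq_trans H _; rewrite prod_nat_const card_ord expnMn leq_mul2l.
apply/orP; right; rewrite /maxn; case: ifP => _; first by rewrite leq_addl.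
by rewrite exp1n leq_addr.
Qed.

Lemma rfact_mono_index m i k : (i <= m)%N -> (rfact i k <= rfact m k)%N.
Proof.
move=> /subnKC <-; elim: (m - i)%N => [|j IH]; first by rewrite addn0.
by rewrite addnS rfactS; apply: leq_trans IH _; rewrite leq_pmulr// addnS.
Qed.

Lemma rfact_mono m k j : (k <= j)%N -> (rfact m k <= rfact m j)%N.
Proof. by move=> kj; apply: leq_prod => i _; rewrite leq_add2r. Qed.

Lemma rfact_sqrt_sqr m k : rfact_sqrt m k ^+ 2 = (rfact m k)%:R.
Proof. by rewrite sqr_sqrtr. Qed.

Lemma rfact_sqrtS m k : rfact_sqrt m.+1 k = rfact_sqrt m k * Num.sqrt (k + m.+1)%:R.
Proof. by rewrite /rfact_sqrt rfactS natrM sqrtrM. Qed.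

Lemma l2_shift_up i x : exists y : h, forall k, y k = if (i <= k)%N then x (k - i)%N else 0.
Proof.
pose q k := if (i <= k)%N then Some (k - i)%N else None.
have [|y yE] := exists_shift hV oV x (q := q).
  move=> a b k; rewrite /q; case: ifP => // ia [<-]; case: ifP => // ib [] E.
  by rewrite -(subnK ia) -E subnK.
by exists y => k; rewrite -l2ip_e yE /q; case: ifP => // _; rewrite l2ip_e.
Qed.

Lemma l2_shift_down i x : exists y : h, forall k, y k = x (k + i)%N.
Proof.
have [|y yE] := exists_shift hV oV x (q := fun k => Some (k + i)%N).
  by move=> a b k [<-] [] /addIn.
by exists y => k; rewrite -l2ip_e yE l2ip_e.
Qed.

Lemma l2_dominated (a : nat -> R[i]) (x y : h) (K : R) : 0 <= K ->
  (forall k, sqmod (a k) <= K * (sqmod (x k) + sqmod (y k))) ->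
  exists z : h, forall k, z k = a k.
Proof.
move=> K0 H; have [|//|z zE] := exists_dominated hV oV (a := a) (x := x) (y := y) (K := K).
  by move=> k; rewrite !l2ip_e; exact: H.
by exists z => k; rewrite -l2ip_e zE.
Qed.

Lemma Npow_half_sqr m k : (0 < m)%N -> (k%:R `^ (m%:R / 2) : R) ^+ 2 = k%:R ^+ m.
Proof.
move=> m0; rewrite -powR_mulrn ?powR_ge0// -powRrM mulfVK ?pnatr_eq0//.
by rewrite powR_mulrn.
Qed.

Lemma Npow_natE m k : (k%:R `^ m%:R : R) = k%:R ^+ m.
Proof. by rewrite powR_mulrn. Qed.

Local Notation create i := (iter i (opcomp (@creation R)) (@opid R h)).

Lemma iter_creation_coef i x y : create i (x, y) ->
  forall k, y k = if (i <= k)%N then (rfact_sqrt i (k - i))%:C * x (k - i)%N else 0.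
Proof.
elim: i y => [|i IH] y /=.
  rewrite /opid /opgraph /= => -> k; rewrite subn0 /rfact_sqrt /rfact big_ord0.
  by rewrite sqrtr1 mul1r.
move=> [z /IH Hz [_ Hy]] [|k]; first by rewrite Hy.
rewrite Hy Hz ltnS subSS; case: ifP => [ik|_]; last by rewrite mulr0.
by rewrite rfact_sqrtS addnS subnK// rmorphM/= mulrCA mulrA.
Qed.

(** Every intermediate power must exist as a vector and lie in the domain of the square root of the
    number operator. Since [rfact i k] increases with [i], summability at the last power [m]
    controls them all. *)
Lemma iter_creation_ex m x (u : h) i : (forall k, u k = (rfact_sqrt m k)%:C * x k) ->
  (i <= m)%N -> exists y, create i (x, y).
Proof.
move=> uE; elim: i => [|i IH] im; first by exists x.
have [z Hz] := IH (ltnW im); have zE := iter_creation_coef Hz.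
have [v vE] : exists v : h, forall k, v k = (rfact_sqrt i.+1 k)%:C * x k.
  apply: (@l2_dominated (fun k => (rfact_sqrt i.+1 k)%:C * x k) u u 1) => // k; rewrite mul1r uE !sqmodZ !rfact_sqrt_sqr.
  apply: le_trans (_ : (rfact m k)%:R * sqmod (x k) <= _).
    by rewrite ler_wpM2r ?sqmod_ge0// ler_nat rfact_mono_index.
  by rewrite lerDl mulr_ge0 ?sqmod_ge0.
have [w wE] := l2_shift_up i.+1 v.
exists w => /=; exists z => //; split; last first.
  move=> [|k] /=; rewrite wE// zE ltnS subSS vE; case: ifP => [ik|_]; last by rewrite mulr0.
  by rewrite rfact_sqrtS addnS subnK// rmorphM/= mulrAC mulrC.
have [v' v'E] := l2_shift_up i v.
(* With [j = k - i], the weight of [N] is absorbed by one more factor: [k * rfact i j <= (k + 1) *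
   rfact i j = rfact i.+1 j]. *)
have [p pE] : exists p : h, forall k, p k = (k%:R `^ 2^-1 : R)%:C * z k.
  apply: (@l2_dominated (fun k => (k%:R `^ 2^-1 : R)%:C * z k) v' v' 1) => // k; rewrite mul1r sqmodZ.
  have -> : (k%:R `^ 2^-1 : R) ^+ 2 = k%:R.
    by have := @Npow_half_sqr 1 k isT; rewrite mul1r expr1.
  rewrite zE v'E; case: ifP => [ik|_]; last by rewrite /sqmod /= expr0n addr0 mulr0 addr0.
  rewrite vE !sqmodZ !rfact_sqrt_sqr rfactS addnS subnK// natrM.
  apply: le_trans (_ : (rfact i (k - i))%:R * k.+1%:R * sqmod (x (k - i)%N) <= _).
    rewrite mulrA (mulrC k%:R) ler_wpM2r ?sqmod_ge0// ler_wpM2l//.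
    by rewrite ler_nat.
  by rewrite lerDl !mulr_ge0 ?sqmod_ge0.
by exists p.
Qed.

(** [X_ m] is the maximal weighted shift: if the shifted sequence is a vector [y], then
    [k ^ m <= rfact m k] puts [x] into the domain of [N^(m/2)], and the intermediate powers exist as
    well. *)
Lemma X_P m x y : (0 < m)%N -> @X_ R m (x, y) <->
  (forall k, y k = if (m <= k)%N then (rfact_sqrt m (k - m))%:C * x (k - m)%N else 0).
Proof.
move=> m0; split=> [[H _]|yE]; first exact: iter_creation_coef.
have [u uE] := l2_shift_down m y.
have {}uE k : u k = (rfact_sqrt m k)%:C * x k by rewrite uE yE leq_addl addnK.
split => /=.
  have [z Hz] := iter_creation_ex uE (leqnn m).
  rewrite (_ : y = z)//; apply: l2_ext => k.
  by rewrite yE (iter_creation_coef Hz).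
have [z zE] : exists z : h, forall k, z k = (k%:R `^ (m%:R / 2) : R)%:C * x k.
  apply: (@l2_dominated (fun k => (k%:R `^ (m%:R / 2) : R)%:C * x k) u u 1) => // k; rewrite mul1r uE !sqmodZ rfact_sqrt_sqr.
  rewrite Npow_half_sqr//; apply: le_trans (_ : (rfact m k)%:R * sqmod (x k) <= _).
    by rewrite ler_wpM2r ?sqmod_ge0// -natrX ler_nat rfact_ge_expn.
  by rewrite lerDl mulr_ge0 ?sqmod_ge0.
by exists z.
Qed.

(** Testing the adjoint relation on basis vectors gives the entries. Conversely, Parseval proves the
    relation for every maximal solution, so the adjoint is the maximal backward shift. *)
Lemma X_adjP m x y : (0 < m)%N -> opadj (@l2ip R) (@X_ R m) (x, y) <->
  (forall k, y k = (rfact_sqrt m k)%:C * x (k + m)%N).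
Proof.
move=> m0; split=> [H k|yE u v /(X_P _ _ m0) vE].
  have : @X_ R m (e_ k, (rfact_sqrt m k)%:C *: e_ (k + m)).
    apply/X_P => // j; rewrite l2valZ !eE; case: leqP => mj.
      have -> : (j == k + m)%N = (j - m == k)%N by rewrite -[RHS](eqn_add2r m) subnK//.
      by case: eqP => [->//|_]; rewrite !mulr0.
    by rewrite (_ : (j == k + m)%N = false) ?mulr0//; apply/negbTE; rewrite neq_ltn (leq_trans mj) ?leq_addl.
  move=> /H /=; rewrite (ipZ hV) => /(congr1 Num.conj).
  by rewrite rmorphM/= conjR -!(ip_conj hV) !l2ip_e => ->.
suff K x1 y1 : (forall k, y1 k = (rfact_sqrt m k)%:C * x1 (k + m)%N) ->
    Re (l2ip v x1) = Re (l2ip u y1).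
  apply: (ip_ext hV) => c; apply: K => k; rewrite !l2valZ yE mulrCA//.
move=> {}yE; apply: cvgn_uniq (@rip_series _ _ _ hV _ _ _ oV v x1) _.
(* The two Parseval series match after a shift by [m], because the first [m] coordinates of [v]
   vanish. *)
rewrite -(cvg_shiftn m); have := @rip_series _ _ _ hV _ _ _ oV u y1.
rewrite [X in X @ _ --> _ -> _](_ : _ = (fun n =>
  \sum_(i <- iota 0 (n + m)) Re (l2ip v (e_ i) * (l2ip x1 (e_ i))^*)))//.
have Z : \sum_(i <- iota 0 m) Re (l2ip v (e_ i) * (l2ip x1 (e_ i))^*) = 0.
  rewrite big_seq big1// => i; rewrite mem_iota add0n => /andP[_ im].
  by rewrite (l2ip_e v) vE leqNgt im mul0r.
apply/funext => n; rewrite (addnC n) iotaD big_cat; apply: esym.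
apply: (etrans (congr1 (fun z => z + _) Z)); rewrite add0r add0n; apply: esym.
rewrite (_ : iota m n = map (addn m) (iota 0 n)); last by rewrite -iotaDl addn0.
rewrite big_map.
  apply: eq_bigr => i _.
have cM (a : R) (z : R[i]) : ((a%:C * z)^*)%R = a%:C * (z^*)%R.
  by rewrite rmorphM/= conjR.
rewrite !l2ip_e vE yE leq_addr addKn (addnC i) cM.
by congr Re; rewrite mulrCA mulrA.
Qed.

Section NumberPolynomial.
Variables (m : nat) (lam : R).
Hypotheses (m_gt0 : (0 < m)%N) (lam_gt0 : 0 < lam).

(* the coefficient of [X_m^*]: [0] below [m] *)
Definition fall_sqrt k : R := if (m <= k)%N then rfact_sqrt m (k - m) else 0.

(** On [e_ k], the adjoint of [X] after [X] has eigenvalue [rfact m k], and the product in the other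
    order has [rfact m (k - m)], or 0 when [k < m]. *)
Definition Bev k : R := lam ^+ 2 * rfact_sqrt m k ^+ 2 + lam ^- 2 * fall_sqrt k ^+ 2.

Lemma fall_sqrt_sqr_le k : fall_sqrt k ^+ 2 <= rfact_sqrt m k ^+ 2.
Proof.
rewrite /fall_sqrt; case: ifP => [mk|_]; last by rewrite expr0n sqr_ge0.
by rewrite !rfact_sqrt_sqr ler_nat rfact_mono// leq_subr.
Qed.

Lemma Bev_ge0 k : 0 <= Bev k.
Proof. by rewrite addr_ge0// mulr_ge0 ?sqr_ge0// invr_ge0 sqr_ge0. Qed.

Let lam2 : 0 < lam ^+ 2. Proof. exact: exprn_gt0. Qed.
Let lamV2 : 0 < lam ^- 2. Proof. by rewrite invr_gt0. Qed.

Lemma rfact_le_Bev k : rfact_sqrt m k ^+ 2 <= lam ^- 2 * Bev k.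
Proof.
rewrite /Bev mulrDr [X in X + _]mulrA mulVf ?gt_eqF// mul1r lerDl.
by apply: mulr_ge0; [exact: ltW|apply: mulr_ge0; [exact: ltW|exact: sqr_ge0]].
Qed.

Lemma fall_le_Bev k : fall_sqrt k ^+ 2 <= lam ^+ 2 * Bev k.
Proof.
rewrite /Bev mulrDr [X in _ + X]mulrA divff ?gt_eqF// mul1r lerDr.
by apply: mulr_ge0; [exact: ltW|apply: mulr_ge0; [exact: ltW|exact: sqr_ge0]].
Qed.

Lemma Bev_le_rfact k : Bev k <= (lam ^+ 2 + lam ^- 2) * rfact_sqrt m k ^+ 2.
Proof. by rewrite /Bev mulrDl lerD2l ler_wpM2l ?(ltW lamV2)// fall_sqrt_sqr_le. Qed.

(** The sum has its natural domain, so all four intermediate vectors must be produced from [x] and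
    [Bev x]. Both weights and their squares are dominated through [rfact_le_Bev] and
    [fall_le_Bev]. *)
Lemma B_E : B_ m lam = diag Bev.
Proof.
apply/seteqP; split=> -[x y].
  move=> [y1 [y2 [[z1 [w1 /= /(X_P _ _ m_gt0) Hw1 /(X_adjP _ _ m_gt0) Hz1] ->]
    [z2 [w2 /= /(X_adjP _ _ m_gt0) Hw2 /(X_P _ _ m_gt0) Hz2] ->] ->]]] k.
  change (((lam ^+ 2)%:C *: z1 + (lam ^- 2)%:C *: z2 : h) k = (Bev k)%:C * x k).
  rewrite !l2valD !l2valZ Hz1 Hw1 leq_addl addnK Hz2 /Bev /fall_sqrt.
  rewrite rmorphD/= mulrDl mulrA -!rmorphM/= mulrA -rmorphM/=; congr (_ + _).
    by rewrite expr2 mulrA.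
  case: ifP => mk; last by rewrite expr0n !mulr0 mul0r.
  by rewrite Hw2 subnK// !mulrA -!rmorphM/= -mulrA -expr2.
move=> H; have yE k : y k = (Bev k)%:C * x k by exact: H.
have dom (f : nat -> R) K : 0 <= K -> (forall k, f k ^+ 2 <= K * (1 + Bev k ^+ 2)) ->
    exists z : h, forall k, z k = (f k)%:C * x k.
  move=> K0 fK; have Hm : mulop (@l2ip R) (@e_ R) Bev (x, y) by rewrite -diagE.
  have [z Hz] := mulop_dom hV oV Hm K0 fK.
  by exists z => k; have := Hz k; rewrite /= !l2ip_e.
have b1 k : Bev k <= 1 + Bev k ^+ 2 by have := sqr_ge0 (Bev k - 1); nra.
have [u uE] := dom (rfact_sqrt m) (lam ^- 2) (ltW lamV2)
  (fun k => le_trans (rfact_le_Bev k) (ler_wpM2l (ltW lamV2) (b1 k))).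
have [u' u'E] := dom fall_sqrt (lam ^+ 2) (ltW lam2)
  (fun k => le_trans (fall_le_Bev k) (ler_wpM2l (ltW lam2) (b1 k))).
have sq (f : nat -> R) K k : 0 <= K -> f k ^+ 2 <= K * Bev k ->
    (f k ^+ 2) ^+ 2 <= K ^+ 2 * (1 + Bev k ^+ 2).
  move=> K0 fK; rewrite mulrDr mulr1; apply: le_trans (_ : (K * Bev k) ^+ 2 <= _).
    by rewrite lerXn2r ?nnegrE ?sqr_ge0// mulr_ge0 ?Bev_ge0.
  by rewrite exprMn lerDr sqr_ge0.
have [v vE] := dom (fun k => rfact_sqrt m k ^+ 2) _ (sqr_ge0 (lam ^- 2))
  (fun k => sq (rfact_sqrt m) _ k (ltW lamV2) (rfact_le_Bev k)).
have [v' v'E] := dom (fun k => fall_sqrt k ^+ 2) _ (sqr_ge0 (lam ^+ 2))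
  (fun k => sq fall_sqrt _ k (ltW lam2) (fall_le_Bev k)).
have [w wE] := l2_shift_up m u; have [w' w'E] := l2_shift_down m u'.
exists ((lam ^+ 2)%:C *: v), ((lam ^- 2)%:C *: v'); split => /=.
- exists v => //; exists w => /=.
    by apply/X_P => // k; rewrite wE; case: ifP => // _; rewrite uE.
  by apply/X_adjP => // k; rewrite wE leq_addl addnK uE vE mulrA -rmorphM/= expr2.
- exists v' => //; exists w' => /=.
    by apply/X_adjP => // k; rewrite w'E u'E /fall_sqrt leq_addl addnK.
  apply/X_P => // k; rewrite v'E /fall_sqrt; case: ifP => mk; last by rewrite expr0n mul0r.
  by rewrite w'E u'E /fall_sqrt subnK// mk mulrA -rmorphM/= expr2.
- apply: l2_ext => k; rewrite l2valD !l2valZ yE vE v'E /Bev rmorphD/= mulrDl.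
  by congr (_ + _); rewrite [RHS]mulrA; congr (_ * _); exact: rmorphM.
Qed.

(** With its converse [Bev_le_expn], this says that [B_m] and [N^m] have comparable symbols, hence
    equal domains, on [l2] as well as in the left action. *)
Lemma expn_le_Bev : exists2 K : R, 0 <= K &
  forall k, (k%:R `^ m%:R) ^+ 2 <= K * (1 + Bev k ^+ 2).
Proof.
exists (lam ^- 2 ^+ 2); first exact: sqr_ge0.
move=> k; rewrite Npow_natE -natrX.
have H : (k ^ m)%:R <= lam ^- 2 * Bev k.
  apply: le_trans (rfact_le_Bev k); by rewrite rfact_sqrt_sqr ler_nat rfact_ge_expn.
apply: le_trans (_ : (lam ^- 2 * Bev k) ^+ 2 <= _).
  by rewrite lerXn2r ?nnegrE// mulr_ge0 ?(ltW lamV2)// Bev_ge0.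
by rewrite exprMn ler_wpM2l ?sqr_ge0// lerDr.
Qed.

Lemma Bev_le_expn : exists2 K : R, 0 <= K &
  forall k, Bev k ^+ 2 <= K * (1 + (k%:R `^ m%:R) ^+ 2).
Proof.
pose K0 : R := (lam ^+ 2 + lam ^- 2) * (m.+1 ^ m)%:R.
have K00 : 0 <= K0 by rewrite mulr_ge0// addr_ge0// ltW.
exists (K0 ^+ 2 * 2); first by rewrite mulr_ge0// sqr_ge0.
move=> k; rewrite Npow_natE -natrX.
have H : Bev k <= K0 * (1 + (k ^ m)%:R).
  apply: le_trans (Bev_le_rfact k) _; rewrite /K0 -mulrA ler_wpM2l//.
    by rewrite addr_ge0// ltW.
  by rewrite rfact_sqrt_sqr -(natrD _ 1) -natrM ler_nat rfact_le_expn.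
apply: le_trans (_ : (K0 * (1 + (k ^ m)%:R)) ^+ 2 <= _).
  by rewrite lerXn2r ?nnegrE ?Bev_ge0// mulr_ge0// addr_ge0.
rewrite exprMn -mulrA ler_wpM2l ?sqr_ge0//.
by set t : R := (k ^ m)%:R; have := sqr_ge0 (t - 1); nra.
Qed.

Lemma B_dom : opdom (B_ m lam) = opdom (Npow (m%:R : R)).
Proof.
rewrite B_E; have [K K0 HK] := expn_le_Bev; have [K' K'0 HK'] := Bev_le_expn.
rewrite /Npow !diagE; apply/seteqP; split=> x [y Hy].
  exact: (mulop_dom hV oV Hy K0 HK).
exact: (mulop_dom hV oV Hy K'0 HK').
Qed.

End NumberPolynomial.

End CreationOperators.

(** * Products of two Hilbert spaces, the target of the gradient *)

Section ProductSpace.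
Context (R : realType) (V W : lmodType R[i]).
Context (ip : V -> V -> R[i]) (jp : W -> W -> R[i]).
Context (hV : hilbert ip) (hW : hilbert jp).

Definition prod_ip (p q : V * W) : R[i] := ip p.1 q.1 + jp p.2 q.2.

Lemma prod_hnorm_sqr p : hnorm prod_ip p ^+ 2 = hnorm ip p.1 ^+ 2 + hnorm jp p.2 ^+ 2.
Proof.
rewrite (hnorm_sqr hV) (hnorm_sqr hW) /hnorm /prod_ip raddfD/= sqr_sqrtr//.
by rewrite addr_ge0// ?(ip_ge0 hV) ?(ip_ge0 hW).
Qed.

Lemma prod_hilbert : hilbert prod_ip.
Proof.
have fst_le p : hnorm ip p.1 <= hnorm prod_ip p.
  by rewrite -(@ler_pXn2r _ 2)// ?nnegrE ?hnorm_ge0// prod_hnorm_sqr lerDl sqr_ge0.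
have snd_le p : hnorm jp p.2 <= hnorm prod_ip p.
  by rewrite -(@ler_pXn2r _ 2)// ?nnegrE ?hnorm_ge0// prod_hnorm_sqr lerDr sqr_ge0.
split.
- by move=> a x y z; rewrite /prod_ip /= (ip_lin hV) (ip_lin hW) mulrDr addrACA.
- move=> x y; rewrite /prod_ip rmorphD/=; congr (_ + _).
    exact: ip_conj hV _ _.
  exact: ip_conj hW _ _.
- by move=> x; rewrite /prod_ip raddfD addr_ge0// ?(ip_ge0 hV) ?(ip_ge0 hW).
- move=> [x y]; rewrite /prod_ip raddfD/= => /eqP; rewrite paddr_eq0.
  + by move=> /andP[/eqP /(ip_eq0 hV) -> /eqP /(ip_eq0 hW) ->].
  + exact: (ip_ge0 hV).
  + exact: (ip_ge0 hW).
move=> u Hu.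
have [x ux] : exists x, hcvg ip (fun n => (u n).1) x.
  apply: (hcomplete hV) => e /Hu[N HN]; exists N => n k Nn Nk.
  exact: le_lt_trans (fst_le (u n - u k)) (HN n k Nn Nk).
have [y uy] : exists y, hcvg jp (fun n => (u n).2) y.
  apply: (hcomplete hW) => e /Hu[N HN]; exists N => n k Nn Nk.
  exact: le_lt_trans (snd_le (u n - u k)) (HN n k Nn Nk).
exists (x, y); apply: (@hcvg_le _ _ _ _ _
    (fun n => hnorm ip ((u n).1 - x) + hnorm jp ((u n).2 - y))).
  move=> n; rewrite -(@ler_pXn2r _ 2)// ?nnegrE ?addr_ge0 ?hnorm_ge0//.
  rewrite prod_hnorm_sqr /= sqrrD; have := hnorm_ge0 ip ((u n).1 - x).
  have := hnorm_ge0 jp ((u n).2 - y).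
  set a := hnorm jp _; set b := hnorm ip _ => a0 b0; have := mulr_ge0 a0 b0; lra.
by rewrite -[X in _ --> X](addr0 0); apply: cvgnD.
Qed.

Lemma prod_hcvg_fst (u : nat -> V * W) p : hcvg prod_ip u p ->
  hcvg ip (fun n => (u n).1) p.1.
Proof.
move=> up; apply: (hcvg_le (f := fun n => hnorm prod_ip (u n - p))) => // n.
rewrite -(@ler_pXn2r _ 2)// ?nnegrE ?hnorm_ge0// prod_hnorm_sqr lerDl sqr_ge0//.
Qed.

Lemma prod_hcvg_snd (u : nat -> V * W) p : hcvg prod_ip u p ->
  hcvg jp (fun n => (u n).2) p.2.
Proof.
move=> up; apply: (hcvg_le (f := fun n => hnorm prod_ip (u n - p))) => // n.
rewrite -(@ler_pXn2r _ 2)// ?nnegrE ?hnorm_ge0// prod_hnorm_sqr lerDr sqr_ge0//.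
Qed.

End ProductSpace.

(** * Diagonal operators in the left action *)

Section LeftActionOperators.
Context (R : realType).
Local Notation h := (l2 R).
Local Notation L := (hs R).
Local Notation hL := (@hs_hilbert R).
Local Notation oL := (@hs_onb R).
Local Notation "N[ x ]" := (hnorm (@hsip R) x) (at level 0, format "N[ x ]").
Local Notation Mul f := (mulop (@hsip R) (@Emx R) f).
Implicit Types (eta zeta : L).

Lemma Mul_coef f eta zeta : Mul f (eta, zeta) <->
  (forall p, coef zeta p = (f p)%:C * coef eta p).
Proof. by split=> H p; have := H p; rewrite /= !hsip_E. Qed.

Lemma lift_diag (f : nat -> R) : lift_op (diag f) = Mul (fun p => f p.1).
Proof.
apply/seteqP; split=> -[eta zeta] H.
  by apply/Mul_coef => -[j k]; exact: (H (e_ k) j).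
by move=> x j; apply: hs_row => k; have /Mul_coef/(_ (j, k)) := H.
Qed.

Lemma hs_dominated (a : nat * nat -> R[i]) eta zeta (K : R) : 0 <= K ->
  (forall p, sqmod (a p) <= K * (sqmod (coef eta p) + sqmod (coef zeta p))) ->
  exists z : L, forall p, coef z p = a p.
Proof.
move=> K0 H; have [|//|z zE] := exists_dominated hL oL (a := a) (x := eta) (y := zeta) (K := K).
  by move=> k; rewrite !hsip_E; exact: H.
by exists z => k; rewrite -hsip_E zE.
Qed.

Lemma hs_shift eta (q : nat * nat -> option (nat * nat)) :
  (forall i j k, q i = Some k -> q j = Some k -> i = j) ->
  exists y : L, forall p, coef y p = if q p is Some r then coef eta r else 0.
Proof.
move=> qi; have [y yE] := exists_shift hL oL eta qi.
by exists y => p; rewrite -hsip_E yE; case: (q p) => // r; rewrite hsip_E.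
Qed.

Lemma hs_parseval eta :
  (fun n => \sum_(p <- square n) sqmod (coef eta p)) @ \oo --> N[eta] ^+ 2.
Proof.
have := @parseval _ _ _ hL _ _ _ oL eta.
rewrite (_ : (fun n => \sum_(i <- square n) sqmod (hsip eta (Emx R i))) =
  (fun n => \sum_(p <- square n) sqmod (coef eta p)))//.
by apply/funext => n; apply: eq_bigr => p _; rewrite hsip_E.
Qed.

Lemma hs_norm_le eta zeta : (forall p, sqmod (coef eta p) <= sqmod (coef zeta p)) ->
  N[eta] <= N[zeta].
Proof.
move=> H; apply: hnorm_le_of_sqr.
apply: (cvgn_le (@hs_parseval eta) (@hs_parseval zeta)); exists 0%N => n _.
exact: ler_sum.
Qed.

Lemma hs_norm_le_shift eta zeta (q : nat * nat -> option (nat * nat)) :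
  (forall p, coef zeta p = if q p is Some r then coef eta r else 0) ->
  (forall i j k, q i = Some k -> q j = Some k -> i = j) -> N[zeta] <= N[eta].
Proof.
move=> H qi; apply: (norm_le_shift hL oL (q := q)) => // p; rewrite hsip_E H.
by case: (q p) => // r; rewrite hsip_E.
Qed.

Lemma sqmodJ (z : R[i]) : sqmod (z^*)%R = sqmod z.
Proof. by case: z => ? ?; rewrite /sqmod /= sqrrN. Qed.

Lemma hnormJ_sqr eta : N[J eta] ^+ 2 = N[eta] ^+ 2.
Proof.
apply: cvgn_uniq (@hs_parseval (J eta)) _.
rewrite (_ : (fun n => \sum_(i <- square n) sqmod (coef (J eta) i)) =
  (fun n => \sum_(p <- square n) sqmod (coef eta p))); first exact: hs_parseval.
apply/funext => n; rewrite !sum_square exchange_big/=.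
apply: eq_bigr => j _; apply: eq_bigr => k _; rewrite coefJ sqmodJ.
by [].
Qed.

Lemma Mul_oppositive f : (forall p, 0 <= f p) -> oppositive (@hsip R) (Mul f).
Proof.
move=> f0 eta zeta H; have A := mulop_accretive hL oL f0.
(* Nonnegativity in [R[i]] includes being real, which comes from symmetry. *)
have K : complex.Im (hsip zeta eta) = 0.
  have E := acc_sym A H H; have := ip_conj hL eta zeta; rewrite -E.
  by move=> /(congr1 (@complex.Im R)); case: (hsip zeta eta) => a b /= ?; lra.
by rewrite lecE; apply/andP; split; [apply/eqP; exact: K|exact: (acc_pos A H)].
Qed.

Lemma diag_bounded_inv (f : nat -> R) : (forall k, 0 <= f k) ->
  exists a : h -> h, bounded_linear (@l2ip R) a /\
    forall x k, a x k = ((1 + f k)^-1)%:C * x k.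
Proof.
move=> f0; pose A := mulop (@l2ip R) (@e_ R) f.
have acc : accretive (@l2ip R) A := mulop_accretive (@l2_hilbert R) (@l2_onb R) f0.
exists (resolvent A 1); split; first split.
- by move=> c x y; exact: (res_lin (@l2_hilbert R) acc ler01).
- by exists 1 => x; rewrite mul1r; exact: (res_norm (@l2_hilbert R) acc _ ler01).
move=> x k; rewrite -[LHS]l2ip_e (mulop_resolvent (@l2_hilbert R) (@l2_onb R))//.
by rewrite l2ip_e mul1r.
Qed.

(** Elements of the commutant commute with the bounded inverse [a] of [1 + f]. Since [zeta] is the
    image of [eta] exactly when [eta = a (eta + zeta)], the graph is preserved. *)
Lemma lift_diag_affiliated (f : nat -> R) : (forall k, 0 <= f k) ->
  affiliated (lift_op (diag f)).
Proof.
move=> f0 U _ [[Ul _] Ucomm] eta zeta H x k.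
have [a [ba aE]] := diag_bounded_inv f0.
have n0 j : 1 + f j != 0 by rewrite gt_eqF// ltr_wpDr.
have E : forall x, eta x = a ((eta + zeta) x).
  move=> y; apply: l2_ext => j; rewrite aE hsD l2valD (H y j)/=.
  by rewrite -[X in _ = _ * (X + _)]mul1r -mulrDl -rmorphD/= mulrA -rmorphM/= mulVf// mul1r.
have := Ucomm a _ _ ba E x.
have -> : U (eta + zeta) = U eta + U zeta by rewrite -[eta]scale1r Ul !scale1r.
move=> K; have {K} : (1 + f k)%:C * U eta x k = (U eta + U zeta) x k.
  by rewrite {1}K aE mulrA -rmorphM/= divff// mul1r.
by rewrite hsD l2valD rmorphD/= mulrDl mul1r => /addrI <-.
Qed.

(** [J] exchanges the indices, so the second form weighs the column index. By Parseval the sum is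
    the squared norm of multiplication by [sqrt (f j + f k)], whose domain is the intersection of
    the two form domains. *)
Lemma opform_lift_sum (f : nat -> R) : (forall k, 0 <= f k) ->
  form_sum (lift_op (diag f)) = Mul (fun p => f p.1 + f p.2).
Proof.
move=> f0; have f10 (p : nat * nat) : 0 <= f p.1 by [].
have fs0 (p : nat * nat) : 0 <= f p.1 + f p.2 by rewrite addr_ge0.
rewrite /form_sum lift_diag (opform_mulop hL oL f10).
pose g p := Num.sqrt (f p.1 + f p.2).
have -> : [set p | exists r s : R, [/\ gform (@hsip R) (Mul (fun p => Num.sqrt (f p.1))) (p.1, r),
     gform (@hsip R) (Mul (fun p => Num.sqrt (f p.1))) (J p.1, s) & p.2 = r + s]] =
    gform (@hsip R) (Mul g).
  have key eta w1 w2 w : Mul (fun p => Num.sqrt (f p.1)) (eta, w1) ->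
      Mul (fun p => Num.sqrt (f p.1)) (J eta, w2) -> Mul g (eta, w) ->
      N[w] ^+ 2 = N[w1] ^+ 2 + N[w2] ^+ 2.
    move=> /Mul_coef H1 /Mul_coef H2 /Mul_coef H; rewrite -(hnormJ_sqr w2).
    apply: cvgn_uniq (@hs_parseval w) _.
    rewrite (_ : (fun n => \sum_(i <- square n) sqmod (coef w i)) =
      (fun n => \sum_(p <- square n) sqmod (coef w1 p) + \sum_(p <- square n) sqmod (coef (J w2) p))).
      by apply: cvgnD; exact: hs_parseval.
    apply/funext => n; rewrite -big_split; apply: eq_bigr => -[j k] _; have /= fjk := fs0 (j, k).
    rewrite coefJ sqmodJ H H1 H2 coefJ !sqmodZ sqmodJ !sqr_sqrtr//=.
    by rewrite mulrDl.
  apply/seteqP; split=> -[eta r].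
    move=> [r1 [r2 [[w1 /= H1 ->] [w2 /= H2 ->] ->]]].
    have [|w wE] := @hs_dominated (fun p => (g p)%:C * coef eta p) w1 (J w2) 1 ler01.
      move=> [j k]; have /= fjk := fs0 (j, k); rewrite mul1r coefJ sqmodJ (proj1 (Mul_coef _ _ _) H1).
      rewrite (proj1 (Mul_coef _ _ _) H2) coefJ !sqmodZ sqmodJ !sqr_sqrtr//=.
      by rewrite mulrDl.
    have Hw : Mul g (eta, w) by apply/Mul_coef.
    by exists w => //; rewrite (key _ _ _ _ H1 H2 Hw).
  move=> [w /= Hw ->].
  have [w1 w1E] : exists z : L, forall p, coef z p = (Num.sqrt (f p.1))%:C * coef eta p.
    apply: (@hs_dominated _ w w 1 ler01) => p; rewrite mul1r (proj1 (Mul_coef _ _ _) Hw).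
    rewrite !sqmodZ !sqr_sqrtr// -mulrDl ler_wpM2r ?sqmod_ge0//.
    by have := f0 p.1; have := f0 p.2; lra.
  have [w2 w2E] : exists z : L, forall p, coef z p = (Num.sqrt (f p.2))%:C * coef eta p.
    apply: (@hs_dominated _ w w 1 ler01) => p; rewrite mul1r (proj1 (Mul_coef _ _ _) Hw).
    rewrite !sqmodZ !sqr_sqrtr// -mulrDl ler_wpM2r ?sqmod_ge0//.
    by have := f0 p.1; have := f0 p.2; lra.
  have H1 : Mul (fun p => Num.sqrt (f p.1)) (eta, w1) by apply/Mul_coef.
  have H2 : Mul (fun p => Num.sqrt (f p.1)) (J eta, J w2).
    by apply/Mul_coef => -[j k]; rewrite !coefJ w2E rmorphM/= conjR.
  exists (N[w1] ^+ 2), (N[J w2] ^+ 2); split.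
  - by exists w1.
  - by exists (J w2).
  - by rewrite (key _ _ _ _ H1 H2 Hw).
rewrite (qoper_gform _ hL (mulop_lin hL oL g)) (mulop_gram hL oL).
by congr (mulop _ _ _); apply/funext => p; rewrite sqr_sqrtr.
Qed.

End LeftActionOperators.

Lemma sqr_add_le8 (R : realType) (u v w : R) : 0 <= u -> 0 <= v ->
  u <= w + w -> v <= w + w -> u ^+ 2 + v ^+ 2 <= 8 * w ^+ 2.
Proof. by move=> u0 v0 uw vw; nra. Qed.

(** * The Dirichlet form *)

Section DirichletForm.
Context (R : realType) (m : nat) (lam : R).
Hypotheses (m_gt0 : (0 < m)%N) (lam_gt0 : 0 < lam).
Local Notation Re := complex.Re.
Local Notation L := (hs R).
Local Notation hL := (@hs_hilbert R).
Local Notation oL := (@hs_onb R).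
Local Notation "N[ x ]" := (hnorm (@hsip R) x) (at level 0, format "N[ x ]").
Local Notation Mul f := (mulop (@hsip R) (@Emx R) f).
Local Notation pip := (prod_ip (@hsip R) (@hsip R)).
Local Notation hP := (prod_hilbert hL hL).
Local Notation c := (rfact_sqrt R m).
Local Notation d := (fall_sqrt R m).
Local Notation b := (Bev m lam).
Local Notation X1 := (lift_op (@X_ R m)).
Local Notation X2 := (lift_op (opadj (@l2ip R) (@X_ R m))).
Implicit Types (eta zeta : L).

Lemma lift_X_P eta zeta : X1 (eta, zeta) <-> forall j k,
  coef zeta (j, k) = if (m <= j)%N then (c (j - m))%:C * coef eta ((j - m)%N, k) else 0.
Proof.
split=> [H j k|H x]; first by have /(X_P _ _ m_gt0)/(_ j) := H (e_ k).
apply/X_P => // j; have := H j; case: ifP => _ Hj.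
  by apply: hs_row => k; exact: Hj.
rewrite -[RHS](mul0r (eta x j)); apply: hs_row => k; rewrite mul0r; exact: Hj.
Qed.

Lemma lift_Xadj_P eta zeta : X2 (eta, zeta) <-> forall j k,
  coef zeta (j, k) = (c j)%:C * coef eta ((j + m)%N, k).
Proof.
split=> [H j k|H x]; first by have /(X_adjP _ _ m_gt0)/(_ j) := H (e_ k).
by apply/X_adjP => // j; apply: hs_row => k; exact: H.
Qed.

Lemma opj_X_P eta zeta : opj X1 (eta, zeta) <-> forall j k,
  coef zeta (j, k) = if (m <= k)%N then (c (k - m))%:C * coef eta (j, (k - m)%N) else 0.
Proof.
rewrite /opj /=; split=> [/lift_X_P H j k|H].
  rewrite -[coef zeta _]conjCK -coefJ H; case: ifP => _; last by rewrite rmorph0.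
  by rewrite coefJ rmorphM/= conjR conjCK.
apply/lift_X_P => j k; rewrite coefJ H; case: ifP => _; last by rewrite rmorph0.
by rewrite coefJ rmorphM/= conjR.
Qed.

Lemma opj_Xadj_P eta zeta : opj X2 (eta, zeta) <-> forall j k,
  coef zeta (j, k) = (c k)%:C * coef eta (j, (k + m)%N).
Proof.
rewrite /opj /=; split=> [/lift_Xadj_P H j k|H].
  by rewrite -[coef zeta _]conjCK -coefJ H coefJ rmorphM/= conjR conjCK.
by apply/lift_Xadj_P => j k; rewrite coefJ H coefJ rmorphM/= conjR.
Qed.

(* the graph of [eta |-> ((lam X - lam^-1 j(X^* )) eta, (lam^-1 X^* - lam j(X)) eta)] *)
Definition pregrad : set (L * (L * L)) :=
  [set p | opadd (opscale lam X1) (opscale (- lam^-1) (opj X2)) (p.1, p.2.1) /\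
           opadd (opscale lam^-1 X2) (opscale (- lam) (opj X1)) (p.1, p.2.2)].

Lemma pre_dirichlet_formE : pre_dirichlet_form (@X_ R m) lam = gform pip pregrad.
Proof.
apply/seteqP; split=> -[eta r].
  move=> [y [z [Hy Hz rE]]]; exists (y, z); first by split.
  by rewrite (prod_hnorm_sqr hL hL).
move=> [[y z] [/= Hy Hz] rE]; exists y, z; split => //.
by rewrite rE (prod_hnorm_sqr hL hL).
Qed.

(** Entries of [lam X eta - lam^-1 eta X]: applying [opj] to the adjoint of [X] gives right
    multiplication by [X]. Likewise [grad2] involves the adjoint on either side. *)
Definition grad1 (a : nat * nat -> R[i]) (p : nat * nat) : R[i] :=
  (if (m <= p.1)%N then (lam * c (p.1 - m))%:C * a ((p.1 - m)%N, p.2) else 0)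
  - (lam^-1 * c p.2)%:C * a (p.1, (p.2 + m)%N).

Definition grad2 (a : nat * nat -> R[i]) (p : nat * nat) : R[i] :=
  (lam^-1 * c p.1)%:C * a ((p.1 + m)%N, p.2)
  - (if (m <= p.2)%N then (lam * c (p.2 - m))%:C * a (p.1, (p.2 - m)%N) else 0).

Lemma pregrad_coef eta y z : pregrad (eta, (y, z)) ->
  (forall p, coef y p = grad1 (coef eta) p) /\ (forall p, coef z p = grad2 (coef eta) p).
Proof.
move=> [[/= s1 [s2 [[a1 /= /lift_X_P H1 ->] [a2 /= /opj_Xadj_P H2 ->] ->]]]
  [s3 [s4 [[a3 /= /lift_Xadj_P H3 ->] [a4 /= /opj_X_P H4 ->] ->]]]].
split=> -[j k]; rewrite hs_coefD !hs_coefZ.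
  rewrite H1 H2 /grad1 /= rmorphN/= mulNr; congr (_ - _).
    by case: ifP => _; rewrite ?mulr0// mulrA -rmorphM.
  by rewrite mulrA -rmorphM.
rewrite H3 H4 /grad2 /= rmorphN/= mulNr; congr (_ - _).
  by rewrite mulrA -rmorphM.
by case: ifP => _; rewrite ?mulr0// mulrA -rmorphM.
Qed.

(** The square root of the symbol of [G1]. Multiplication by it has the form domain of [G1], which
    proves to be the domain of [pregrad]. *)
Definition weight (p : nat * nat) : R := Num.sqrt (b p.1 + b p.2).

Lemma weight_sqr p : weight p ^+ 2 = b p.1 + b p.2.
Proof. by rewrite sqr_sqrtr// addr_ge0// Bev_ge0. Qed.

Lemma weight_dom (g : nat * nat -> R) eta zeta :
  (forall p, g p ^+ 2 <= b p.1 + b p.2) -> Mul weight (eta, zeta) ->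
  exists v : L, (forall p, coef v p = (g p)%:C * coef eta p) /\ N[v] <= N[zeta].
Proof.
move=> gb /Mul_coef H.
have D p : sqmod ((g p)%:C * coef eta p) <= sqmod (coef zeta p).
  by rewrite H !sqmodZ weight_sqr ler_wpM2r ?sqmod_ge0.
have [|v vE] := @hs_dominated R (fun p => (g p)%:C * coef eta p) zeta zeta 1 ler01.
  by move=> p; rewrite mul1r; apply: le_trans (D p) _; rewrite lerDl sqmod_ge0.
by exists v; split => //; apply: hs_norm_le => p; rewrite vE.
Qed.

Let lam_neq0 : lam != 0. Proof. by rewrite gt_eqF. Qed.

Let c_le k : (lam * c k) ^+ 2 <= b k.
Proof.
by rewrite exprMn lerDl; apply: mulr_ge0; [rewrite invr_ge0|]; exact: sqr_ge0.
Qed.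

Let d_le k : (lam^-1 * d k) ^+ 2 <= b k.
Proof.
by rewrite exprMn exprVn lerDr; apply: mulr_ge0; exact: sqr_ge0.
Qed.

(** The two raising terms suffice: shifted back, they carry the weights [c j] and [c k], and
    [Bev_le_rfact] bounds [b] by a multiple of [c ^ 2]. *)
Lemma pregrad_weight eta w : pregrad (eta, w) -> exists zeta, Mul weight (eta, zeta).
Proof.
move: w => [y z] [[/= s1 [s2 [[a1 /= /lift_X_P H1 _] _ _]]] [s3 [s4 [_ [a4 /= /opj_X_P H4 _] _]]]].
have [|u1 u1E] := hs_shift a1 (q := fun p => Some ((p.1 + m)%N, p.2)).
  by move=> [? ?] [? ?] k [<-] [] /addIn -> ->.
have [|u4 u4E] := hs_shift a4 (q := fun p => Some (p.1, (p.2 + m)%N)).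
  by move=> [? ?] [? ?] k [<-] [] -> /addIn ->.
have K0 : 0 <= lam ^+ 2 + lam ^- 2 by rewrite addr_ge0 ?invr_ge0 ?sqr_ge0.
have [|zeta zE] := @hs_dominated R (fun p => (weight p)%:C * coef eta p) u1 u4 _ K0.
  move=> [j k]; rewrite u1E u4E H1 H4 !leq_addl !addnK !sqmodZ weight_sqr -mulrDl mulrA.
  by rewrite ler_wpM2r ?sqmod_ge0// mulrDr lerD//; exact: Bev_le_rfact.
by exists zeta; apply/Mul_coef.
Qed.

(** Each of the four terms is a shift of a matrix dominated by [zeta]. The lowering shifts start
    from the weight [d], because [d (k + m) = c k]. Each component has norm at most [2 * N[zeta]],
    whence [4 + 4 = 8]. *)
Lemma pregrad_ex eta zeta : Mul weight (eta, zeta) ->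
  exists w, pregrad (eta, w) /\ hnorm pip w ^+ 2 <= 8 * N[zeta] ^+ 2.
Proof.
move=> H.
have b1 p : b p.1 <= b p.1 + b p.2 by rewrite lerDl Bev_ge0.
have b2 p : b p.2 <= b p.1 + b p.2 by rewrite lerDr Bev_ge0.
have [v1 [v1E n1]] := weight_dom (fun p => le_trans (c_le p.1) (b1 p)) H.
have [v2 [v2E n2]] := weight_dom (fun p => le_trans (d_le p.2) (b2 p)) H.
have [v3 [v3E n3]] := weight_dom (fun p => le_trans (d_le p.1) (b1 p)) H.
have [v4 [v4E n4]] := weight_dom (fun p => le_trans (c_le p.2) (b2 p)) H.
pose q1 (p : nat * nat) := if (m <= p.1)%N then Some ((p.1 - m)%N, p.2) else None.
pose q2 (p : nat * nat) := Some (p.1, (p.2 + m)%N).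
pose q3 (p : nat * nat) := Some ((p.1 + m)%N, p.2).
pose q4 (p : nat * nat) := if (m <= p.2)%N then Some (p.1, (p.2 - m)%N) else None.
have i1 i j k : q1 i = Some k -> q1 j = Some k -> i = j.
  case: i j => [i i'] [j j']; rewrite /q1 /=; case: ifP => // im [<-]; case: ifP => // jm [].
  by move=> /(congr1 (addn^~ m)); rewrite !subnK// => -> ->.
have i2 i j k : q2 i = Some k -> q2 j = Some k -> i = j.
  by case: i j => [i i'] [j j'] [<-] [] -> /addIn ->.
have i3 i j k : q3 i = Some k -> q3 j = Some k -> i = j.
  by case: i j => [i i'] [j j'] [<-] [] /addIn -> ->.
have i4 i j k : q4 i = Some k -> q4 j = Some k -> i = j.
  case: i j => [i i'] [j j']; rewrite /q4 /=; case: ifP => // im [<-]; case: ifP => // jm [->].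
  by move=> /(congr1 (addn^~ m)); rewrite !subnK// => ->.
have [s1 s1E] := hs_shift v1 (q := q1) i1; have [s2 s2E] := hs_shift v2 (q := q2) i2.
have [s3 s3E] := hs_shift v3 (q := q3) i3; have [s4 s4E] := hs_shift v4 (q := q4) i4.
have N1 := le_trans (hs_norm_le_shift (q := q1) s1E i1) n1.
have N2 := le_trans (hs_norm_le_shift (q := q2) s2E i2) n2.
have N3 := le_trans (hs_norm_le_shift (q := q3) s3E i3) n3.
have N4 := le_trans (hs_norm_le_shift (q := q4) s4E i4) n4.
have dE k : d (k + m) = c k by rewrite /fall_sqrt leq_addl addnK.
have sc (r t : R) (x : L) : r * t = 1 -> r%:C *: (t%:C *: x) = x.
  by move=> rt; rewrite scalerA -rmorphM/= rt scale1r.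
exists (s1 + (- lam^-1)%:C *: (lam%:C *: s2), s3 + (- lam)%:C *: ((lam^-1)%:C *: s4)).
split; first split => /=.
- exists s1, ((- lam^-1)%:C *: (lam%:C *: s2)); split => //=.
    exists ((lam^-1)%:C *: s1); last by rewrite sc// divff.
    apply/lift_X_P => j k; rewrite hs_coefZ s1E /q1 /=; case: ifP => _; last by rewrite mulr0.
    by rewrite v1E /= !mulrA -rmorphM/= mulrA mulVf// mul1r.
  exists (lam%:C *: s2) => //; apply/opj_Xadj_P => j k.
  by rewrite hs_coefZ s2E /q2 /= v2E /= dE !mulrA -rmorphM/= mulrA divff// mul1r.
- exists s3, ((- lam)%:C *: ((lam^-1)%:C *: s4)); split => //=.
    exists (lam%:C *: s3); last by rewrite sc// mulVf.
    apply/lift_Xadj_P => j k.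
    by rewrite hs_coefZ s3E /q3 /= v3E /= dE !mulrA -rmorphM/= mulrA divff// mul1r.
  exists ((lam^-1)%:C *: s4) => //; apply/opj_X_P => j k.
  rewrite hs_coefZ s4E /q4 /=; case: ifP => _; last by rewrite mulr0.
  by rewrite v4E /= !mulrA -rmorphM/= mulrA mulVf// mul1r.
rewrite (prod_hnorm_sqr hL hL) [(_, _).1]/= [(_, _).2]/=.
have E2 : (- lam^-1)%:C *: (lam%:C *: s2) = - s2.
  by rewrite scalerA -rmorphM/= mulNr mulVf// rmorphN/= scaleN1r.
have E4 : (- lam)%:C *: ((lam^-1)%:C *: s4) = - s4.
  by rewrite scalerA -rmorphM/= mulNr divff// rmorphN/= scaleN1r.
rewrite E2 E4.
have Y := le_trans (ler_hnormB hL s1 s2) (lerD N1 N2).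
have Z := le_trans (ler_hnormB hL s3 s4) (lerD N3 N4).
exact: (sqr_add_le8 (hnorm_ge0 _ _) (hnorm_ge0 _ _) Y Z).
Qed.

Lemma pregradP eta y z : pregrad (eta, (y, z)) <->
  [/\ exists zeta, Mul weight (eta, zeta),
      forall p, coef y p = grad1 (coef eta) p
    & forall p, coef z p = grad2 (coef eta) p].
Proof.
split=> [H|[[zeta /pregrad_ex[[y' z'] [H _]]] Hy Hz]].
  by have [? ?] := pregrad_coef H; split => //; exact: pregrad_weight H.
have [Hy' Hz'] := pregrad_coef H.
have -> : y = y' by apply: hs_coef_ext => j k; rewrite Hy Hy'.
by have -> : z = z' by apply: hs_coef_ext => j k; rewrite Hz Hz'.
Qed.

Lemma grad1_lin (t : R[i]) a a' p :
  grad1 (fun p => t * a p + a' p) p = t * grad1 a p + grad1 a' p.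
Proof. by rewrite /grad1; case: ifP => _; ring. Qed.

Lemma grad2_lin (t : R[i]) a a' p :
  grad2 (fun p => t * a p + a' p) p = t * grad2 a p + grad2 a' p.
Proof. by rewrite /grad2; case: ifP => _; ring. Qed.

Lemma pregrad_lin : lin_graph pregrad.
Proof.
have ML := mulop_lin hL oL weight.
split.
- move=> t x [y z] x' [y' z'] /pregradP[[u Hu] Hy Hz] /pregradP[[u' Hu'] Hy' Hz'].
  apply/pregradP; split.
  + by exists (t *: u + u'); exact: (lin_graph_lin ML).
  + by move=> p; rewrite hs_coefD hs_coefZ Hy Hy' -grad1_lin.
  + by move=> p; rewrite hs_coefD hs_coefZ Hz Hz' -grad2_lin.
- apply/pregradP; split; first by exists 0; exact: (lin_graph0 ML).
  + by move=> p; rewrite /grad1; case: ifP => _; rewrite !mulr0 subrr.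
  + by move=> p; rewrite /grad2; case: ifP => _; rewrite !mulr0 subrr.
- move=> [y z] /pregradP[_ Hy Hz].
  have -> : y = 0.
    by apply: hs_coef_ext => j k; rewrite Hy /grad1; case: ifP => _; rewrite !mulr0 subrr.
  have -> // : z = 0.
  by apply: hs_coef_ext => j k; rewrite Hz /grad2; case: ifP => _; rewrite !mulr0 subrr.
Qed.

Lemma pregrad_bound eta w zeta : pregrad (eta, w) -> Mul weight (eta, zeta) ->
  hnorm pip w ^+ 2 <= 8 * N[zeta] ^+ 2.
Proof.
move=> H /pregrad_ex[w' [H' B]].
by rewrite (lgF pregrad_lin H H').
Qed.

Lemma coef_lim_Re (u : nat -> L) x p (t : R[i]) : hcvg (@hsip R) u x ->
  (fun n => Re (t * coef (u n) p)) @ \oo --> Re (t * coef x p).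
Proof.
move=> ux; have := hcvg_rip hL (hcvgZ hL t ux) (hcvg_cst hL (Emx R p)).
rewrite (ipZ hL) hsip_E (_ : (fun n => Re (hsip (t *: u n) (Emx R p))) =
  (fun n => Re (t * coef (u n) p)))//.
by apply/funext => n; rewrite (ipZ hL) hsip_E.
Qed.

Definition grad : set (L * (L * L)) := gclosure (@hsip R) pip pregrad.

(** Entries are continuous and each formula involves two of them, so the closure acts by the same
    formulas. It is therefore single-valued: the form is closable. *)
Lemma grad_coef eta y z : grad (eta, (y, z)) ->
  (forall p, coef y p = grad1 (coef eta) p) /\ (forall p, coef z p = grad2 (coef eta) p).
Proof.
move=> [u [v [/= Huv ux vw]]].
have vy := prod_hcvg_fst hL hL vw; have vz := prod_hcvg_snd hL hL vw.
have Huv' n : (forall p, coef (v n).1 p = grad1 (coef (u n)) p) /\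
    (forall p, coef (v n).2 p = grad2 (coef (u n)) p).
  by apply: pregrad_coef; rewrite -surjective_pairing.
split=> p; apply: complex_ext => t.
  apply: cvgn_uniq (coef_lim_Re (p := p) (t := t) vy) _.
  rewrite (_ : (fun n => _) = (fun n => Re (t * (if (m <= p.1)%N then (lam * c (p.1 - m))%:C else 0) *
    coef (u n) ((p.1 - m)%N, p.2)) + Re (t * (- (lam^-1 * c p.2)%:C) * coef (u n) (p.1, (p.2 + m)%N)))).
    rewrite /grad1 (_ : Re _ = Re (t * (if (m <= p.1)%N then (lam * c (p.1 - m))%:C else 0) *
    coef eta ((p.1 - m)%N, p.2)) + Re (t * (- (lam^-1 * c p.2)%:C) * coef eta (p.1, (p.2 + m)%N))).
      by apply: cvgnD; exact: coef_lim_Re.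
    by rewrite -raddfD; congr Re; case: ifP => _; ring.
  apply/funext => n; rewrite (Huv' n).1 /grad1 -raddfD; congr Re.
  by case: ifP => _; ring.
apply: cvgn_uniq (coef_lim_Re (p := p) (t := t) vz) _.
rewrite (_ : (fun n => _) = (fun n => Re (t * (- (if (m <= p.2)%N then (lam * c (p.2 - m))%:C else 0)) *
    coef (u n) (p.1, (p.2 - m)%N)) + Re (t * ((lam^-1 * c p.1)%:C) * coef (u n) ((p.1 + m)%N, p.2)))).
  rewrite /grad2 (_ : Re _ = Re (t * (- (if (m <= p.2)%N then (lam * c (p.2 - m))%:C else 0)) *
    coef eta (p.1, (p.2 - m)%N)) + Re (t * ((lam^-1 * c p.1)%:C) * coef eta ((p.1 + m)%N, p.2))).
    by apply: cvgnD; exact: coef_lim_Re.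
  by rewrite -raddfD; congr Re; case: ifP => _; ring.
apply/funext => n; rewrite (Huv' n).2 /grad2 -raddfD; congr Re.
by case: ifP => _; ring.
Qed.

Lemma grad_lin : lin_graph grad.
Proof.
apply: (gclosure_lin hL hP pregrad_lin) => -[y z] /grad_coef[Hy Hz].
have -> : y = 0.
  by apply: hs_coef_ext => j k; rewrite Hy /grad1; case: ifP => _; rewrite !mulr0 subrr.
have -> // : z = 0.
by apply: hs_coef_ext => j k; rewrite Hz /grad2; case: ifP => _; rewrite !mulr0 subrr.
Qed.

Lemma H_gram : H_ m lam = gram (@hsip R) pip grad.
Proof.
rewrite /H_ /dirichlet_form pre_dirichlet_formE (qclosure_gform _ hP pregrad_lin).
exact: (qoper_gform _ hP grad_lin).
Qed.

Definition supported (n : nat) : set L := [set eta | forall p, p \notin square n -> coef eta p = 0].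

Lemma proj_supported n eta : supported n (proj (@hsip R) (@Emx R) (square n) eta).
Proof.
move=> p pn; rewrite -hsip_E (coef_fsum hL oL) ?(onb_uniq oL)//.
by rewrite (negbTE pn).
Qed.

Lemma supported_proj n eta : supported n eta ->
  eta = proj (@hsip R) (@Emx R) (square n) eta.
Proof.
move=> H; apply: hs_coef_ext => j k; rewrite -[RHS]hsip_E (coef_fsum hL oL) ?(onb_uniq oL)//.
by rewrite hsip_E; case: ifP => // /negbT /H.
Qed.

(** Truncation to a corner commutes with the multiplication by [weight], and [pregrad_bound] turns
    convergence of the weighted matrices into convergence of gradients. *)
Lemma grad_core : grad `<=` gclosure (@hsip R) pip
  [set p | grad p /\ exists n, supported n p.1].
Proof.
pose F := [set p | pregrad p /\ exists n, supported n p.1].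
have FG : F `<=` [set p | grad p /\ exists n, supported n p.1].
  by move=> p [Hp ?]; split => //; exact: gclosure_sub hL hP _ _ Hp.
move=> p Gp; apply: (gclosure_mono FG); apply: (gclosure_idem hL hP).
move: p Gp; apply: gclosure_mono => -[eta w] H.
have [zeta Hz] := pregrad_weight H.
pose P n x := proj (@hsip R) (@Emx R) (square n) x.
have HPz n : Mul weight (P n eta, P n zeta).
  by apply: (mulop_proj hL oL Hz); exact: (onb_uniq oL).
have /choice[v Hv] : forall n, exists v, pregrad (P n eta, v).
  by move=> n; have [v [Hv _]] := pregrad_ex (HPz n); exists v.
exists (fun n => P n eta), v; split => /=.
- by move=> n; split => //; exists n; exact: proj_supported.
- exact: (proj_cvg hL oL).
(* The factor 3 serves to stay rational: [8 <= 3 ^ 2]. *)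
apply: (hcvg_le (f := fun n => 3 * N[P n zeta - zeta])) => [n|].
  have B := pregrad_bound (lgB pregrad_lin (Hv n) H) (lgB (mulop_lin hL oL weight) (HPz n) Hz).
  have := hnorm_ge0 pip (v n - w); have := hnorm_ge0 (@hsip R) (P n zeta - zeta).
  move: B; set x := hnorm pip _; set y := hnorm _ _ => B y0 x0.
  rewrite -(@ler_pXn2r _ 2)// ?nnegrE ?mulr_ge0//; apply: le_trans B _.
  by rewrite exprMn ler_wpM2r ?sqr_ge0//; lra.
by rewrite -(mulr0 3); apply: cvgnZ; exact: (proj_cvg hL oL).
Qed.

(* [eta |-> X^* eta X + X eta X^*] *)
Definition jump (a : nat * nat -> R[i]) (p : nat * nat) : R[i] :=
  (c p.1 * c p.2)%:C * a ((p.1 + m)%N, (p.2 + m)%N) +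
  (if (m <= p.1)%N && (m <= p.2)%N then
     (c (p.1 - m) * c (p.2 - m))%:C * a ((p.1 - m)%N, (p.2 - m)%N) else 0).

Definition Hcoef (a : nat * nat -> R[i]) (p : nat * nat) : R[i] :=
  (b p.1 + b p.2)%:C * a p - 2 * jump a p.

Lemma coef_Emx (q p : nat * nat) : coef (Emx R q) p = (p == q)%:R.
Proof. by rewrite /coef EmxE; case: q p => [? ?] [? ?]. Qed.

(** The gradient of a matrix unit has at most four entries. In the pairing the squares collect to
    [b j + b k], and each jump entry arises twice with coefficient [- lam * lam^-1 = -1], whence the
    factor 2 in [Hcoef]. *)
Lemma grad_pairing z w p : grad (z, w) -> exists2 v, grad (Emx R p, v) &
  pip w v = Hcoef (coef z) p.
Proof.
move: w p => [y1 y2] [j k] /grad_coef[H1 H2].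
pose v1 : L := (lam * c j)%:C *: Emx R ((j + m)%N, k) -
  (if (m <= k)%N then (lam^-1 * c (k - m))%:C *: Emx R (j, (k - m)%N) else 0).
pose v2 : L := (if (m <= j)%N then (lam^-1 * c (j - m))%:C *: Emx R ((j - m)%N, k) else 0)
  - (lam * c k)%:C *: Emx R (j, (k + m)%N).
exists (v1, v2).
  apply: (gclosure_sub hL hP); apply/pregradP; split.
  - exists ((weight (j, k))%:C *: Emx R (j, k)); apply/Mul_coef => p; rewrite hs_coefZ coef_Emx.
    by case: eqP => [->//|_]; rewrite !mulr0.
  - move=> [j' k']; rewrite hs_coefB hs_coefZ coef_Emx /grad1 !coef_Emx !xpair_eqE; congr (_ - _).
      case: leqP => mj.
        rewrite (_ : (j' == j + m)%N = (j' - m == j)%N); last by rewrite -[RHS](eqn_add2r m) subnK.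
        by case: eqP => [->|_]//=; rewrite !mulr0.
      rewrite (_ : (j' == j + m)%N = false) ?mulr0//; apply/negbTE.
      by rewrite neq_ltn (leq_trans mj) ?leq_addl.
    case: leqP => mk.
      rewrite hs_coefZ coef_Emx xpair_eqE (_ : (k' + m == k)%N = (k' == k - m)%N); last first.
        by rewrite -[RHS](eqn_add2r m) subnK.
      by case: (k' =P _) => [->//|_]; rewrite andbF !mulr0.
    rewrite (_ : (k' + m == k)%N = false) ?andbF ?mulr0//; apply/negbTE.
    by rewrite neq_ltn (leq_trans mk) ?leq_addl ?orbT.
  - move=> [j' k']; rewrite hs_coefB hs_coefZ coef_Emx /grad2 !coef_Emx !xpair_eqE; congr (_ - _).
      case: leqP => mj.
        rewrite hs_coefZ coef_Emx xpair_eqE (_ : (j' + m == j)%N = (j' == j - m)%N); last first.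
          by rewrite -[RHS](eqn_add2r m) subnK.
        by case: (j' =P _) => [->//|_]; rewrite !mulr0.
      rewrite (_ : (j' + m == j)%N = false) ?mulr0//; apply/negbTE.
      by rewrite neq_ltn (leq_trans mj) ?leq_addl ?orbT.
    case: leqP => mk.
      rewrite (_ : (k' == k + m)%N = (k' - m == k)%N); last by rewrite -[RHS](eqn_add2r m) subnK.
      by case: (_ =P k) => [->//|_]; rewrite andbF !mulr0.
    rewrite (_ : (k' == k + m)%N = false) ?andbF ?mulr0//; apply/negbTE.
    by rewrite neq_ltn (leq_trans mk) ?leq_addl.
have pZ x (t : R) q : hsip x (t%:C *: Emx R q) = t%:C * coef x q.
  by rewrite (ipZrR hL) hsip_E.
rewrite /prod_ip /v1 /v2 !(ipBr hL) !pZ !H1 !H2 /grad1 /grad2 /= !leq_addl !addnK.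
rewrite /Hcoef /jump /Bev /fall_sqrt /=.
have cV : (lam : R)%:C * (lam^-1)%:C = 1 by rewrite -rmorphM/= divff.
have cV2 : (lam ^- 2)%:C = (lam^-1)%:C * (lam^-1)%:C by rewrite -rmorphM/= expr2 invfM.
case: leqP => mk; case: leqP => mj /=;
  rewrite ?(ip0r hL) ?pZ ?H1 ?H2 /grad1 /grad2 /= ?subnK ?mk ?mj ?(leqNgt m) ?mk ?mj //=.
all: rewrite ?expr0n /= !(rmorphM, rmorphD, rmorphXn, rmorph0) /= ?cV2.
all: by ring: cV.
Qed.

End DirichletForm.

(** * Positive kernels *)

Section PositiveKernels.
Context (R : realType).
Local Notation Re := complex.Re.
Local Notation Im := complex.Im.
Local Notation h := (l2 R).
Local Notation L := (hs R).
Local Notation hV := (@l2_hilbert R).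
Local Notation oV := (@l2_onb R).
Local Notation kernel := (nat * nat -> R[i]).
Implicit Types (a : kernel) (v : nat -> R[i]) (s : seq nat) (f : nat -> R).

Definition kform s v a : R[i] :=
  \sum_(j <- s) \sum_(k <- s) a (j, k) * (v k * (v j)^*).

(** Stated for arbitrary arrays: the entries of [jump] need not be square summable, yet their
    positivity is used. Finite sections also make the notion stable under entrywise limits. *)
Definition kpos a : Prop := forall s v, 0 <= kform s v a.

Lemma cge0P (z : R[i]) : 0 <= z <-> Im z = 0 /\ 0 <= Re z.
Proof.
rewrite lecE; split=> [/andP[/eqP -> //]|[H1 H2]].
by apply/andP; split=> //; apply/eqP.
Qed.

Lemma cge0_sum (I : Type) (r : seq I) (P : pred I) (F : I -> R[i]) :
  (forall i, P i -> 0 <= F i) -> 0 <= \sum_(i <- r | P i) F i.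
Proof. by move=> H; apply: sumr_ge0. Qed.

Lemma sqmod_ge0C (z : R[i]) : 0 <= z * z^*.
Proof. by rewrite mul_conjC_ge0. Qed.

Lemma realC_ge0 (r : R) : 0 <= r -> 0 <= r%:C :> R[i].
Proof. by move=> r0; apply/cge0P. Qed.

Lemma kposD a a' : kpos a -> kpos a' -> kpos (fun p => a p + a' p).
Proof.
move=> H H' s v; rewrite (_ : kform s v _ = kform s v a + kform s v a').
  by rewrite addr_ge0.
rewrite /kform -big_split; apply: eq_bigr => j _; rewrite -big_split.
by apply: eq_bigr => k _; rewrite /= mulrDl.
Qed.

Lemma kposZ (r : R) a : 0 <= r -> kpos a -> kpos (fun p => r%:C * a p).
Proof.
move=> r0 H s v; rewrite (_ : kform s v _ = r%:C * kform s v a).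
  by rewrite mulr_ge0// realC_ge0.
rewrite /kform mulr_sumr; apply: eq_bigr => j _; rewrite mulr_sumr.
apply: eq_bigr => k _; rewrite /=.
by rewrite [RHS]mulrA.
Qed.

Lemma kpos_ext a a' : (forall p, a p = a' p) -> kpos a -> kpos a'.
Proof. by move=> H; rewrite (_ : a = a')//; apply/funext. Qed.

Lemma kpos_congruence f a : kpos a -> kpos (fun p => (f p.1 * f p.2)%:C * a p).
Proof.
move=> H s v; rewrite (_ : kform s v _ = kform s (fun k => (f k)%:C * v k) a)//.
apply: eq_bigr => j _; apply: eq_bigr => k _; rewrite /= !rmorphM/= conjR; ring.
Qed.

Lemma kpos_shift_down m a : kpos a -> kpos (fun p => a ((p.1 + m)%N, (p.2 + m)%N)).
Proof.
move=> H s v; rewrite (_ : kform s v _ =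
  kform (map (addn^~ m) s) (fun k => v (k - m)%N) a)//.
rewrite /kform big_map; apply: eq_bigr => j _; rewrite big_map.
by apply: eq_bigr => k _; rewrite /= !addnK.
Qed.

Lemma kpos_shift_up m a : kpos a ->
  kpos (fun p => if (m <= p.1)%N && (m <= p.2)%N then a ((p.1 - m)%N, (p.2 - m)%N) else 0).
Proof.
move=> H s v; rewrite (_ : kform s v _ =
  kform (map (subn^~ m) [seq k <- s | (m <= k)%N]) (fun k => v (k + m)%N) a)//.
rewrite /kform big_map big_filter [RHS]big_mkcond; apply: eq_bigr => j _.
rewrite big_map big_filter; case: (leqP m j) => mj.
  rewrite [RHS]big_mkcond; apply: eq_bigr => k _ /=; case: (leqP m k) => mk.
    by rewrite !subnK.
  by rewrite mul0r.
by rewrite big1// => k _; rewrite /= mul0r.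
Qed.

Lemma kpos0 : kpos (fun=> 0).
Proof.
by move=> s v; rewrite /kform big1// => j _; rewrite big1// => k _; rewrite mul0r.
Qed.

Lemma kpos_diag f : (forall k, 0 <= f k) -> kpos (fun p => if p.1 == p.2 then (f p.1)%:C else 0).
Proof.
move=> f0 s v; apply: cge0_sum => j _; apply: cge0_sum => k _ /=.
case: eqP => [->|_]; last by rewrite mul0r.
by rewrite mulr_ge0 ?realC_ge0 ?sqmod_ge0C.
Qed.

Lemma cvgn_sum (I : Type) (r : seq I) (F : nat -> I -> R) (G : I -> R) :
  (forall i, F^~ i @ \oo --> G i) ->
  (fun n => \sum_(i <- r) F n i) @ \oo --> \sum_(i <- r) G i.
Proof.
move=> H; elim: r => [|i r IH].
  by rewrite big_nil (_ : (fun n => _) = fun=> 0); [exact: cvg_cst|apply/funext => n; rewrite big_nil].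
rewrite big_cons (_ : (fun n => _) = (fun n => F n i + \sum_(i <- r) F n i)).
  by apply: cvgnD => //; exact: H.
by apply/funext => n; rewrite big_cons.
Qed.

Lemma kpos_lim (u : nat -> kernel) a :
  (forall p (t : R[i]), (fun n => Re (t * u n p)) @ \oo --> Re (t * a p)) ->
  (exists N, forall n, (N <= n)%N -> kpos (u n)) -> kpos a.
Proof.
move=> H [N HN] s v.
have C (t : R[i]) : (fun n => Re (t * kform s v (u n))) @ \oo --> Re (t * kform s v a).
  have E a' : Re (t * kform s v a') =
      \sum_(j <- s) \sum_(k <- s) Re ((t * (v k * (v j)^*)) * a' (j, k)).
    rewrite /kform mulr_sumr raddf_sum; apply: eq_bigr => j _ /=.
    rewrite mulr_sumr raddf_sum; apply: eq_bigr => k _ /=; congr Re; ring.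
  rewrite E (_ : (fun n => _) = (fun n => \sum_(j <- s) \sum_(k <- s)
    Re ((t * (v k * (v j)^*)) * u n (j, k)))); last by apply/funext => n; rewrite E.
  by do 2!(apply: cvgn_sum => ?); exact: H.
have P n : (N <= n)%N -> Im (kform s v (u n)) = 0 /\ 0 <= Re (kform s v (u n)).
  by move=> /HN K; apply/cge0P; exact: K.
apply/cge0P; split.
  have E (z : R[i]) : Im z = Re ((- 'i) * z) by case: z => ? ? /=; ring.
  rewrite E; apply: cvgn_uniq (C _) _; apply/cvgn_subP => e e0; exists N => n /P[I0 _].
  by rewrite -E I0 subrr normr0.
have := C 1; rewrite mul1r => C1; apply: (cvgn_le (cvg_cst 0) C1).
by exists N => n /P[_]; rewrite mul1r.
Qed.

Lemma kpos_limB (u w : nat -> kernel) a a' :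
  (forall p (t : R[i]), (fun n => Re (t * u n p)) @ \oo --> Re (t * a p)) ->
  (forall p (t : R[i]), (fun n => Re (t * w n p)) @ \oo --> Re (t * a' p)) ->
  (exists N, forall n, (N <= n)%N -> kpos (fun p => u n p - w n p)) ->
  kpos (fun p => a p - a' p).
Proof.
move=> ua wa'; apply: kpos_lim => p t.
have E (z z' : R[i]) : Re (t * (z - z')) = Re (t * z) + Re (- t * z').
  by rewrite -raddfD; congr Re; ring.
rewrite E (_ : (fun n => _) = (fun n => Re (t * u n p) + Re (- t * w n p))).
  exact: cvgnD.
by apply/funext => n; rewrite E.
Qed.

(* The Cauchy kernel through the Cayley transform [k = (x - 1) / (x + 1)]:
   [1 / (x + y) = 2 / ((x + 1) (y + 1)) * \sum_N (k(x) k(y)) ^ N]. *)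
Lemma kpos_lyapunov f a : (forall k, 0 < f k) -> kpos a ->
  kpos (fun p => ((f p.1 + f p.2)^-1)%:C * a p).
Proof.
move=> f0 Ha; pose kap k := (f k - 1) / (f k + 1).
have f1 k : f k + 1 != 0 by rewrite gt_eqF// addr_gt0.
have ff j k : f j + f k != 0 by rewrite gt_eqF// addr_gt0.
(* Partial sums of the series in closed form, by the identity [1 - kap j * kap k = 2 (f j + f k) /
   ((f j + 1) (f k + 1))]. Each new term is a congruence by [kap ^ N / (f + 1)]. *)
pose u N (p : nat * nat) := ((1 - (kap p.1 * kap p.2) ^+ N) / (f p.1 + f p.2))%:C * a p.
have kap1 k : `|kap k| < 1.
  rewrite /kap normf_div ltr_pdivrMr ?normr_gt0// mul1r.
  have := f0 k => fk; rewrite (gtr0_norm (addr_gt0 fk ltr01)) ltr_norml.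
  by apply/andP; split; lra.
have up N : kpos (u N).
  elim: N => [|N IH].
    by apply: kpos_ext kpos0 => p; rewrite /u expr0 subrr mul0r mul0r.
  have Hc := kpos_congruence (fun k => kap k ^+ N / (f k + 1)) Ha.
  apply: kpos_ext (kposD IH (kposZ (ler0n R 2) Hc)) => -[j k]; rewrite /u /=.
  rewrite mulrA -rmorphM/= -mulrDl -rmorphD/=; congr (_%:C * _).
  rewrite exprS exprMn /kap; move: (f1 j) (f1 k) (ff j k).
  move: (kap j ^+ N) (kap k ^+ N); rewrite /kap.
  by move: (f j) (f k) => x y s t x1 y1 xy; field; rewrite x1 y1 xy.
apply: (@kpos_lim u); last by exists 0%N.
move=> [j k] t; rewrite /u /=.
have E (r : R) : Re (t * (r%:C * a (j, k))) = r * Re (t * a (j, k)).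
  by rewrite mulrCA ReZ.
rewrite E (_ : (fun n => _) = (fun n =>
  ((1 - (kap j * kap k) ^+ n) * (f j + f k)^-1) * Re (t * a (j, k)))); last first.
  by apply/funext => n; rewrite E.
apply: cvgnM; last exact: cvg_cst.
rewrite -[X in _ --> X]mul1r; apply: cvgnM; last exact: cvg_cst.
rewrite -[X in _ --> X]subr0; apply: (@cvgB _ R^o); first exact: cvg_cst.
apply: cvg_expr; rewrite normrM; apply: le_lt_trans (kap1 j).
by rewrite ler_piMr// ltW.
Qed.

Lemma hs_cvg (eta : L) (u : nat -> h) x : hcvg (@l2ip R) u x ->
  hcvg (@l2ip R) (fun n => eta (u n)) (eta x).
Proof.
move=> ux; have [el [M HM]] := hs_bounded eta.
apply: (hcvg_le (f := fun n => `|M| * hnorm (@l2ip R) (u n - x))) => [n|].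
  have -> : eta (u n) - eta x = eta (u n - x).
    by rewrite [u n - x]addrC -(scaleN1r x) el scaleN1r addrC.
  apply: le_trans (HM _) _; rewrite ler_wpM2r ?hnorm_ge0//; exact: ler_norm.
by rewrite -(mulr0 `|M|); apply: cvgnZ.
Qed.

Lemma ip_hs_fsum (eta : L) s v :
  l2ip (eta (fsum (@e_ R) s v)) (fsum (@e_ R) s v) = kform s v (coef eta).
Proof.
have E : eta (fsum (@e_ R) s v) = \sum_(k <- s) v k *: eta (e_ k).
  rewrite /fsum; elim: (s) => [|k t IH]; last by rewrite !big_cons hs_linear IH.
  by rewrite !big_nil; have := hs_linear eta (-1) 0 0; rewrite scaler0 addr0 scaleN1r addNr.
rewrite E (ip_fsum hV) /kform; apply: eq_bigr => j _.
rewrite (ip_sum hV) mulr_sumr; apply: eq_bigr => k _.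
by rewrite (ipZ hV) l2ip_e /coef; ring.
Qed.

(** Finite combinations of basis vectors see exactly the finite sections; they are dense, and [eta]
    is continuous. *)
Lemma hs_posP (eta : L) : hs_pos eta <-> kpos (coef eta).
Proof.
split=> [H s v|H x]; first by rewrite -ip_hs_fsum; exact: H.
have px := proj_cvg hV oV x; have ex := hs_cvg eta px.
have P n : Im (l2ip (eta (proj (@l2ip R) (@e_ R) (iota 0 n) x)) (proj (@l2ip R) (@e_ R) (iota 0 n) x)) = 0
   /\ 0 <= Re (l2ip (eta (proj (@l2ip R) (@e_ R) (iota 0 n) x)) (proj (@l2ip R) (@e_ R) (iota 0 n) x)).
  by apply/cge0P; rewrite ip_hs_fsum; exact: H.
apply/cge0P; split; last first.
  apply: (cvgn_le (cvg_cst 0) (hcvg_rip hV ex px)); exists 0%N => n _; exact: (P n).2.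
rewrite (Im_ip hV); apply: cvgn_uniq (hcvg_rip hV ex (hcvgZ hV 'i px)) _.
apply/cvgn_subP => e e0; exists 0%N => n _.
by rewrite -(Im_ip hV) (P n).1 subrr normr0.
Qed.

Lemma hs_leP (xi eta : L) : hs_le xi eta <-> kpos (fun p => coef eta p - coef xi p).
Proof. by rewrite /hs_le hs_posP. Qed.

Lemma hs_pos_cvg (u : nat -> L) x : hcvg (@hsip R) u x -> (forall n, hs_pos (u n)) -> hs_pos x.
Proof.
move=> ux H; apply/hs_posP; apply: (@kpos_lim (fun n => coef (u n))).
  by move=> p t; exact: coef_lim_Re.
by exists 0%N => n _; apply/hs_posP.
Qed.

End PositiveKernels.

(** * Positivity of the resolvents *)

Section FiniteSums.
Context (R : realType) (I : eqType).
Implicit Types (s t : seq I) (F : I -> R).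

Lemma sum_subset_le s t F : uniq s -> uniq t -> {subset t <= s} ->
  (forall i, 0 <= F i) -> \sum_(i <- t) F i <= \sum_(i <- s) F i.
Proof.
move=> us ut ts F0; rewrite [leRHS](bigID (fun i => i \in t))/= -[leLHS]addr0.
apply: lerD; last by rewrite sumr_ge0.
rewrite -[leRHS]big_filter; apply/ler_of_eq/perm_big.
apply: uniq_perm; rewrite ?filter_uniq// => i.
by rewrite mem_filter; case: (boolP (i \in t)) => //= /ts ->.
Qed.

(** For shifts that may leave the corner [s]: the terms that fall outside vanish. *)
Lemma sum_injective_le s t F (q : I -> I) : uniq s -> uniq t ->
  {in t &, injective q} -> (forall i, 0 <= F i) -> (forall i, i \notin s -> F i = 0) ->
  \sum_(i <- t) F (q i) <= \sum_(i <- s) F i.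
Proof.
move=> us ut qi F0 Fs; rewrite -(big_map q xpredT F).
have um : uniq (map q t) by rewrite map_inj_in_uniq.
apply: le_trans (_ : \sum_(i <- [seq i <- map q t | i \in s]) F i <= _).
  rewrite big_filter [leRHS]big_mkcond; apply: ler_sum => i _.
  by case: (boolP (i \in s)) => // /Fs ->.
apply: sum_subset_le; rewrite ?filter_uniq// => i.
by rewrite mem_filter => /andP[].
Qed.

End FiniteSums.

(** The product of [2 |x y| <= x ^ 2 + y ^ 2] and [2 |w| <= l u + l^-1 v]; the latter holds as the
    two summands have product [u v]. The parameter [l] will be [lam ^ 2] or its inverse, to match
    the two parts of [Bev]. *)
Lemma amgm_shift (R : realType) (x y l u v w : R) : 0 < l -> 0 <= u -> 0 <= v ->
  w ^+ 2 <= u * v ->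
  2 * (x * y * w) <= 2^-1 * ((x ^+ 2 + y ^+ 2) * (l * u + l^-1 * v)).
Proof.
move=> l0 u0 v0 wuv.
have lv : 0 < l^-1 by rewrite invr_gt0.
have T0 : 0 <= l * u + l^-1 * v by rewrite addr_ge0// mulr_ge0// ltW.
have W : `|w| * 2 <= l * u + l^-1 * v.
  rewrite -(@ler_pXn2r _ 2)// ?nnegrE ?mulr_ge0//.
  rewrite exprMn real_normK ?num_real//.
  have : l * l^-1 = 1 by rewrite divff// gt_eqF.
  move: lv; set k := l^-1 => k0 lk.
  have -> : (l * u + k * v) ^+ 2 = (l * u - k * v) ^+ 2 + 4 * (l * k) * (u * v) by ring.
  by rewrite lk; have := sqr_ge0 (l * u - k * v); lra.
have X : `|x * y| * 2 <= x ^+ 2 + y ^+ 2.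
  rewrite normrM; have := sqr_ge0 (`|x| - `|y|).
  by rewrite sqrrB !real_normK ?num_real//; lra.
have : `|x * y * w| = `|x * y| * `|w| by rewrite normrM.
have := ler_norm (x * y * w); move: X W T0.
set P := _ ^+ 2 + _; set T := _ * u + _; have := normr_ge0 (x * y); have := normr_ge0 w.
move: `|x * y| `|w| (x * y * w) => A B D B0 A0 X W T0 DA E; rewrite E in DA.
have : (A * 2) * (B * 2) <= P * T by apply: ler_pM => //; rewrite mulr_ge0.
by lra.
Qed.

Lemma Re_double (R : realType) (r : R) (z w : R[i]) :
  complex.Re (2 * (r%:C * z) * w) = 2 * (r * complex.Re (z * w)).
Proof. by rewrite -mulrA mulr_natl raddfMn/= -mulrA ReZ mulr_natl. Qed.

(** * The resolvent equation in a corner *)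

Section Galerkin.
Context (R : realType) (m : nat) (lam : R).
Hypotheses (m_gt0 : (0 < m)%N) (lam_gt0 : 0 < lam).
Local Notation Re := complex.Re.
Local Notation L := (hs R).
Local Notation hL := (@hs_hilbert R).
Local Notation oL := (@hs_onb R).
Local Notation "N[ x ]" := (hnorm (@hsip R) x) (at level 0, format "N[ x ]").
Local Notation pip := (prod_ip (@hsip R) (@hsip R)).
Local Notation hP := (prod_hilbert hL hL).
Local Notation c := (rfact_sqrt R m).
Local Notation d := (fall_sqrt R m).
Local Notation b := (Bev m lam).
Implicit Types (eta zeta xi y : L) (p : nat * nat) (n : nat).

Definition G1ev p : R := b p.1 + b p.2.

Lemma G1ev_ge0 p : 0 <= G1ev p.
Proof. by rewrite addr_ge0// Bev_ge0. Qed.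

Lemma grad_supported n eta : supported n eta -> exists w, grad m lam (eta, w).
Proof.
move=> /supported_proj ->; have := mulop_fsum hL oL (weight m lam)
  (fun p => hsip eta (Emx R p)) (onb_uniq oL n).
by move=> /(pregrad_ex m_gt0 lam_gt0)[w [Hw _]]; exists w; exact: (gclosure_sub hL hP).
Qed.

(** Both sides of the weak equation are antilinear in the test vector and matrix units span the
    corner, so the entrywise equations imply the hypothesis of [galerkin]. *)
Lemma H_galerkin e y (x : nat -> L) : 0 < e -> (forall n, supported n (x n)) ->
  (forall n p, p \in square n -> coef (x n) p + e%:C * Hcoef m lam (coef (x n)) p = coef y p) ->
  exists2 x0, hcvg (@hsip R) x x0 & H_ m lam (x0, (e^-1)%:C *: (y - x0)).
Proof.
move=> e0 xs xE; rewrite (H_gram m_gt0 lam_gt0).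
have gl := grad_lin m_gt0 lam_gt0.
have /choice[w Hw] : forall n, exists w, grad m lam (x n, w).
  by move=> n; exact: grad_supported (xs n).
apply: (@galerkin _ _ _ _ _ hL hP _ (supported (R:=R)) _ _ _ w gl _ e0) => //.
- exact: (gclosure_idem hL hP).
- move=> n p np eta H q qp; apply: H; apply: contra qp.
  exact: (onb_mono oL np).
- move=> n z w' /supported_proj zE Gz.
  have key s (a : nat * nat -> R[i]) : {subset s <= square n} ->
      exists2 v, grad m lam (fsum (@Emx R) s a, v) &
      hsip (x n) (fsum (@Emx R) s a) + e%:C * pip (w n) v = hsip y (fsum (@Emx R) s a).
    elim: s => [|p s IH] sn.
      exists 0; first by rewrite /fsum big_nil; exact: (lin_graph0 gl).
      by rewrite /fsum big_nil !(ip0r hL) (ip0r hP) mulr0 addr0.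
    have [|v Gv vE] := IH; first by move=> q qs; apply: sn; rewrite in_cons qs orbT.
    have [u Gu uE] := grad_pairing m_gt0 lam_gt0 p (Hw n).
    exists (a p *: u + v).
      rewrite /fsum big_cons; exact: (lin_graph_lin gl (a p) Gu Gv).
    rewrite /fsum big_cons -/(fsum (@Emx R) s a) !(ipDr hL) !(ipZr hL) (ipDr hP) (ipZr hP).
    have pn : p \in square n by apply: sn; rewrite in_cons eqxx.
    by rewrite -vE !hsip_E -(xE n p pn) uE; ring.
  have [v Gv vE] := key (square n) (fun p => hsip z (Emx R p)) (fun _ => id).
  rewrite -/(proj _ _ _ _) -zE in Gv vE.
  by rewrite (lgF gl Gz Gv).
- exact: (grad_core m_gt0 lam_gt0).
Qed.

(** With [l = lam ^ 2] for the entry above and [l = lam ^- 2] for the one below, the terms in [z']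
    add up to [G1ev]. If one index is below [m], the second part of [Bev] is merely a nonnegative
    surplus. *)
Lemma jump_pointwise (z z' : nat * nat -> R[i]) j k :
  Re (2 * jump m z (j, k) * ((z' (j, k))^*)%R) <=
  2^-1 * (G1ev (j, k) * sqmod (z' (j, k)) +
    lam ^- 2 * ((c j ^+ 2 + c k ^+ 2) * sqmod (z ((j + m)%N, (k + m)%N))) +
    (if (m <= j)%N && (m <= k)%N then
      lam ^+ 2 * ((c (j - m) ^+ 2 + c (k - m) ^+ 2) * sqmod (z ((j - m)%N, (k - m)%N))) else 0)).
Proof.
have l2 : 0 < lam ^+ 2 by rewrite exprn_gt0.
have l2V : 0 < lam ^- 2 by rewrite invr_gt0.
have CSc (u v : R[i]) : (Re (u * (v^*)%R)) ^+ 2 <= sqmod v * sqmod u.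
  have := sqmodM u (v^*)%R; rewrite sqmodJ [sqmod u * _]mulrC => <-.
  by rewrite /sqmod lerDl sqr_ge0.
have A1 := amgm_shift (c j) (c k) l2 (sqmod_ge0 _) (sqmod_ge0 _)
  (CSc (z ((j + m)%N, (k + m)%N)) (z' (j, k))).
have J1 : Re (2 * ((c j * c k)%:C * z ((j + m)%N, (k + m)%N)) * ((z' (j, k))^*)%R) =
   2 * (c j * c k * Re (z ((j + m)%N, (k + m)%N) * ((z' (j, k))^*)%R)).
  exact: Re_double.
rewrite /jump /= mulrDr mulrDl raddfD/= J1 /G1ev /Bev /=.
case: ifP => [/andP[mj mk]|_].
  have A2 := amgm_shift (c (j - m)) (c (k - m)) l2V (sqmod_ge0 _) (sqmod_ge0 _)
    (CSc (z ((j - m)%N, (k - m)%N)) (z' (j, k))).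
  have J2 : Re (2 * ((c (j - m) * c (k - m))%:C * z ((j - m)%N, (k - m)%N)) * ((z' (j, k))^*)%R) =
     2 * (c (j - m) * c (k - m) * Re (z ((j - m)%N, (k - m)%N) * ((z' (j, k))^*)%R)).
    exact: Re_double.
  rewrite J2 /fall_sqrt mj mk; apply: le_trans (lerD A1 A2) _.
  by apply: ler_of_eq; rewrite invrK; ring.
rewrite mulr0 mul0r addr0 addr0; apply: le_trans A1 _.
rewrite ler_pM2l ?invr_gt0// -subr_ge0.
rewrite (_ : _ - _ = lam ^- 2 * (d j ^+ 2 + d k ^+ 2) * sqmod (z' (j, k))); last by ring.
apply: mulr_ge0; last exact: sqmod_ge0.
by apply: mulr_ge0; [exact: ltW|rewrite addr_ge0// sqr_ge0].
Qed.

(** The inequality [2 K <= G1] in polarized form, as the contraction estimate pairs the old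
    difference with the new one. Shifting the neighbours back to [z] turns their weights into the
    two parts of [G1ev]. *)
Lemma jump_form_le n (z z' : nat * nat -> R[i]) :
  (forall p, p \notin square n -> z p = 0) ->
  \sum_(p <- square n) Re (2 * jump m z p * ((z' p)^*)%R) <=
  2^-1 * (\sum_(p <- square n) G1ev p * sqmod (z p) +
          \sum_(p <- square n) G1ev p * sqmod (z' p)).
Proof.
move=> zs; have un := onb_uniq oL n.
pose F1 p : R := lam ^- 2 * ((d p.1 ^+ 2 + d p.2 ^+ 2) * sqmod (z p)).
pose F2 p : R := lam ^+ 2 * ((c p.1 ^+ 2 + c p.2 ^+ 2) * sqmod (z p)).
have F10 p : 0 <= F1 p.
  apply: mulr_ge0; first by rewrite invr_ge0 sqr_ge0.
  by apply: mulr_ge0; [rewrite addr_ge0// sqr_ge0|exact: sqmod_ge0].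
have F20 p : 0 <= F2 p.
  apply: mulr_ge0; first by rewrite sqr_ge0.
  by apply: mulr_ge0; [rewrite addr_ge0// sqr_ge0|exact: sqmod_ge0].
have sq0 : sqmod (0 : R[i]) = 0 by rewrite /sqmod /= expr0n addr0.
have F1s p : p \notin square n -> F1 p = 0 by move=> /zs; rewrite /F1 => ->; rewrite sq0 !mulr0.
have F2s p : p \notin square n -> F2 p = 0 by move=> /zs; rewrite /F2 => ->; rewrite sq0 !mulr0.
pose up p := ((p.1 + m)%N, (p.2 + m)%N); pose dn p := ((p.1 - m)%N, (p.2 - m)%N).
pose big p := (m <= p.1)%N && (m <= p.2)%N.
have S1 : \sum_(p <- square n) F1 (up p) <= \sum_(p <- square n) F1 p.
  apply: sum_injective_le => // -[j k] [j' k'] _ _ []; by move=> /addIn -> /addIn ->.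
have S2 : \sum_(p <- square n | big p) F2 (dn p) <= \sum_(p <- square n) F2 p.
  rewrite -big_filter; apply: sum_injective_le; rewrite ?filter_uniq//.
  move=> [j k] [j' k']; rewrite !mem_filter => /andP[/andP[/= a a'] _] /andP[/andP[/= e e'] _] [].
  move=> /(congr1 (addn^~ m)); rewrite !subnK// => ->.
  by move=> /(congr1 (addn^~ m)); rewrite !subnK// => ->.
have E p : G1ev p * sqmod (z p) = F1 p + F2 p by rewrite /G1ev /F1 /F2 /Bev; ring.
have -> : \sum_(p <- square n) G1ev p * sqmod (z p) =
    \sum_(p <- square n) F1 p + \sum_(p <- square n) F2 p.
  by rewrite -big_split; apply: eq_bigr => p _; exact: E.
apply: le_trans (_ : 2^-1 * (\sum_(p <- square n) G1ev p * sqmod (z' p) +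
   \sum_(p <- square n) F1 (up p) + \sum_(p <- square n | big p) F2 (dn p)) <= _); last first.
  rewrite ler_pM2l ?invr_gt0//.
  by apply: le_trans (lerD (lerD (lexx _) S1) S2) _; rewrite -addrA addrC.
rewrite [X in _ + X]big_mkcond -!big_split mulr_sumr; apply: ler_sum => -[j k] _.
have := jump_pointwise z z' j k; rewrite /F1 /F2 /up /dn /big /= /fall_sqrt.
by rewrite !leq_addl !addnK.
Qed.

Section Iteration.
Variables (n : nat) (e : R) (y : L).
Hypothesis e_gt0 : 0 < e.

Definition resw p : R := 1 + e * G1ev p.

Lemma resw_ge1 p : 1 <= resw p.
Proof. by rewrite lerDl mulr_ge0 ?G1ev_ge0// ltW. Qed.

Lemma resw_gt0 p : 0 < resw p.
Proof. exact: lt_le_trans ltr01 (resw_ge1 p). Qed.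

Definition step eta : L := fsum (@Emx R) (square n)
  (fun p => ((resw p)^-1)%:C * (coef y p + e%:C * (2 * jump m (coef eta) p))).

Lemma coef_step eta p : coef (step eta) p = if p \in square n then
  ((resw p)^-1)%:C * (coef y p + e%:C * (2 * jump m (coef eta) p)) else 0.
Proof. by rewrite -hsip_E (coef_fsum hL oL)//; exact: (onb_uniq oL). Qed.

Lemma step_supported eta : supported n (step eta).
Proof. by move=> p pn; rewrite coef_step (negbTE pn). Qed.

(** The form of [1 + e G1] on the corner: the norm in which the inequality between forms makes
    [step] a contraction. *)
Let energy eta := \sum_(p <- square n) resw p * sqmod (coef eta p).

Lemma jumpB (a a' : nat * nat -> R[i]) p :
  jump m (fun p => a p - a' p) p = jump m a p - jump m a' p.
Proof. by rewrite /jump; case: ifP => _; ring. Qed.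

Lemma step_contraction : exists2 q : R, 0 <= q < 1 & forall eta zeta,
  supported n eta -> supported n zeta ->
  energy (step eta - step zeta) <= q * energy (eta - zeta).
Proof.
(* A crude bound for all [e * G1ev p] in the corner; then [e * G1ev p / resw p] is at most
   [q = M / (1 + M)]. *)
pose M := e * \sum_(p <- square n) G1ev p.
have M0 : 0 <= M by rewrite mulr_ge0 ?(ltW e_gt0)// sumr_ge0// => p _; exact: G1ev_ge0.
have M1 : 0 < 1 + M by rewrite ltr_pwDl.
pose q := M / (1 + M).
have q0 : 0 <= q by rewrite divr_ge0// ltW.
have q1 : q < 1 by rewrite ltr_pdivrMr// mul1r ltrDr.
exists q; first by rewrite q0.
move=> eta zeta es zs.
have Gq p : p \in square n -> e * G1ev p <= q * resw p.
  move=> pn; have Mp : e * G1ev p <= M.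
    rewrite ler_pM2l// (big_rem p)//= lerDl sumr_ge0// => r _; exact: G1ev_ge0.
  rewrite /q mulrAC ler_pdivlMr// /resw.
  have := G1ev_ge0 p; move: (G1ev p) Mp e_gt0 M0 => g; nra.
pose z p := coef (eta - zeta) p; pose z' p := coef (step eta - step zeta) p.
have zz p : p \notin square n -> z p = 0.
  by move=> pn; rewrite /z hs_coefB es// zs// subrr.
have K := jump_form_le z' zz.
have Ez' p : p \in square n -> (resw p)%:C * z' p = e%:C * (2 * jump m z p).
  move=> pn; rewrite /z' hs_coefB !coef_step pn -(mulrBr (((resw p)^-1)%:C : R[i])) [LHS]mulrA -rmorphM/= divff ?gt_eqF ?resw_gt0//.
  rewrite mul1r opprD addrACA subrr add0r -mulrBr; congr (_ * _); rewrite -mulrBr; congr (_ * _).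
  by rewrite -jumpB.
(* The weight cancels the inverse inside [step], so the energy of the new difference is the jump
   form between old and new differences. *)
have E1 : energy (step eta - step zeta) =
    e * \sum_(p <- square n) Re (2 * jump m z p * ((z' p)^*)%R).
  rewrite /energy mulr_sumr big_seq [RHS]big_seq; apply: eq_bigr => p pn.
  rewrite -ReZ mulrA -Ez'// -mulrA ReZ sqmodE//.
have E2 (x : L) : e * \sum_(p <- square n) G1ev p * sqmod (coef x p) <= q * energy x.
  rewrite /energy !mulr_sumr big_seq [leRHS]big_seq; apply: ler_sum => p pn.
  by rewrite !mulrA ler_wpM2r ?sqmod_ge0//; exact: Gq.
have en0 (x : L) : 0 <= energy x.
  by rewrite /energy sumr_ge0// => p _; rewrite mulr_ge0 ?sqmod_ge0// ltW ?resw_gt0.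
have B1 := E2 (eta - zeta); have B2 := E2 (step eta - step zeta).
have := en0 (eta - zeta); have := en0 (step eta - step zeta).
(* With [S] and [S'] the old and new energies this is [S' <= q / 2 (S + S')], so that
   [S' <= q / (2 - q) S <= q S]. *)
have {K} : energy (step eta - step zeta) <= 2^-1 * (q * energy (eta - zeta) + q * energy (step eta - step zeta)).
  rewrite {1}E1; apply: le_trans (_ : e * (2^-1 * (\sum_(p <- square n) G1ev p * sqmod (z p) +
          \sum_(p <- square n) G1ev p * sqmod (z' p))) <= _); first by rewrite ler_pM2l.
  rewrite mulrCA ler_pM2l ?invr_gt0// mulrDr; exact: lerD.
move: (energy _) (energy (eta - zeta)) q0 q1 => S' S; clearbody q; nra.
Qed.

Definition iterate i : L := iter i step 0.

Lemma iterate_supported i : supported n (iterate i).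
Proof.
case: i => [|i]; last exact: step_supported.
by move=> p _; rewrite /coef.
Qed.

(** As [resw] is at least 1, energy dominates the squared norm, and the increments decay
    geometrically with ratio [sqrt q]. *)
Lemma iterate_cvg : exists x, hcvg (@hsip R) iterate x.
Proof.
have [q /andP[q0 q1] Hq] := step_contraction.
pose C := energy (iterate 1 - iterate 0).
have C0 : 0 <= C.
  by rewrite /C /energy sumr_ge0// => p _; rewrite mulr_ge0 ?sqmod_ge0// ltW ?resw_gt0.
have D i : energy (iterate i.+1 - iterate i) <= C * q ^+ i.
  elim: i => [|i IH]; first by rewrite expr0 mulr1.
  apply: le_trans (Hq _ _ (iterate_supported i.+1) (iterate_supported i)) _.
  by rewrite exprS mulrCA ler_wpM2l.
have Nle i : N[iterate i.+1 - iterate i] <= Num.sqrt C * Num.sqrt q ^+ i.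
  have s0 : 0 <= Num.sqrt C * Num.sqrt q ^+ i by rewrite mulr_ge0 ?exprn_ge0 ?sqrtr_ge0.
  have sE : (Num.sqrt C * Num.sqrt q ^+ i) ^+ 2 = C * q ^+ i.
    by rewrite exprMn sqr_sqrtr// -exprM mulnC exprM sqr_sqrtr.
  rewrite -(@ler_pXn2r _ 2)// ?nnegrE ?hnorm_ge0// sE; apply: le_trans (D i).
  have sup : supported n (iterate i.+1 - iterate i).
    by move=> p pn; rewrite hs_coefB !iterate_supported// subrr.
  rewrite (supported_proj sup) (fsum_norm hL oL) ?(onb_uniq oL)// -(supported_proj sup).
  apply: ler_sum => p _; rewrite hsip_E ler_peMl ?sqmod_ge0//; exact: resw_ge1.
pose r := Num.sqrt q; have r0 : 0 <= r by exact: sqrtr_ge0.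
have r1 : r < 1 by rewrite /r -sqrtr1 ltr_sqrt.
have rp : 0 < 1 - r by rewrite subr_gt0.
have Dist i k : N[iterate (i + k)%N - iterate i] <= Num.sqrt C / (1 - r) * (r ^+ i - r ^+ (i + k)).
  elim: k => [|k IH]; first by rewrite addn0 !subrr (hnorm0 hL) mulr0.
  apply: le_trans (ler_hdistD hL (iterate (i + k)%N) _ _) _.
  rewrite addnS; apply: le_trans (lerD (Nle _) IH) _; rewrite -/r exprS.
  apply: ler_of_eq.
  have v1 : 1 - r != 0 by rewrite gt_eqF.
  by move: (r ^+ i) (r ^+ (i + k)) => s t; field.
have K0 : 0 <= Num.sqrt C / (1 - r) by rewrite divr_ge0 ?sqrtr_ge0 ?(ltW rp).
apply: (@bounded_increments_cvg _ _ _ hL (fun i => - (Num.sqrt C / (1 - r) * r ^+ i)) 0 1 1) => //.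
  by move=> i; rewrite oppr_le0 mulr_ge0// exprn_ge0.
by move=> i k /subnKC <-; rewrite mul1r; apply: le_trans (Dist _ _) _; rewrite mulrBr opprK addrC.
Qed.

End Iteration.

End Galerkin.

(** * Order bounds for the corner solutions *)

Section ResolventPositivity.
Context (R : realType) (m : nat) (lam : R).
Hypotheses (m_gt0 : (0 < m)%N) (lam_gt0 : 0 < lam).
Local Notation Re := complex.Re.
Local Notation L := (hs R).
Local Notation b := (Bev m lam).
Local Notation c := (rfact_sqrt R m).
Local Notation G1ev := (@G1ev R m lam).
Local Notation resw := (@resw R m lam).
Implicit Types (eta zeta xi y : L) (p : nat * nat) (n : nat) (e : R).

Lemma jump_kpos (a : nat * nat -> R[i]) : kpos a -> kpos (jump m a).
Proof.
move=> Ha; apply: kposD.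
  exact: (kpos_congruence c (kpos_shift_down m Ha)).
have := kpos_shift_up m (kpos_congruence c Ha).
by apply: kpos_ext => p /=.
Qed.

(** Sharing the constant 1 equally between the indices writes [resw] as [f j + f k] with positive
    [f], the shape of [kpos_lyapunov]. *)
Lemma resw_kpos e (a : nat * nat -> R[i]) : 0 < e -> kpos a -> kpos (fun p => ((resw e p)^-1)%:C * a p).
Proof.
move=> e0; pose f k := 2^-1 + e * b k.
have f0 k : 0 < f k by rewrite ltr_pwDl ?invr_gt0// mulr_ge0 ?Bev_ge0// ltW.
move=> /(kpos_lyapunov f0); apply: kpos_ext => p; congr (_^-1%:C * _).
by rewrite /f /resw /G1ev; field.
Qed.

(** Restriction to a corner is the compression by a coordinate projection. *)
Lemma trunc_kpos n (a : nat * nat -> R[i]) : kpos a -> kpos (fun p => if p \in square n then a p else 0).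
Proof.
move=> /(kpos_congruence (fun k => (k < n)%:R)); apply: kpos_ext => p.
rewrite mem_square; case: (p.1 < n)%N; case: (p.2 < n)%N => /=;
  by rewrite ?mul1r ?mulr1 ?mul0r ?mulr0 ?mul1r ?mul0r.
Qed.

Lemma coef_step_split e y n eta p : coef (step m lam n e y eta) p =
  (if p \in square n then ((resw e p)^-1)%:C * coef y p else 0) +
  (if p \in square n then ((resw e p)^-1)%:C * (e%:C * (2%:C * jump m (coef eta) p)) else 0).
Proof.
rewrite coef_step; case: ifP => _; last by rewrite addr0.
rewrite mulrDr (_ : 2%:C = 2)//.
by apply/eqP; rewrite eq_complex/= addr0 !eqxx.
Qed.

Lemma jump_term_kpos e n eta : 0 < e -> kpos (coef eta) ->
  kpos (fun p => if p \in square n then ((resw e p)^-1)%:C * (e%:C * (2%:C * jump m (coef eta) p)) else 0).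
Proof.
move=> e0 H; apply: trunc_kpos; apply: resw_kpos => //.
apply: kposZ; first exact: ltW.
by apply: kposZ; [exact: ler0n|exact: jump_kpos].
Qed.

Lemma iterate_kpos e n y i : 0 < e -> kpos (coef y) ->
  kpos (coef (iterate m lam n e y i)).
Proof.
move=> e0 Hy; elim: i => [|i IH]; first by apply: kpos_ext (@kpos0 R) => p.
apply: kpos_ext (fun p => esym (coef_step_split e y n (iterate m lam n e y i) p)) _.
apply: kposD; last exact: jump_term_kpos.
by apply: trunc_kpos; exact: resw_kpos.
Qed.

(** What is subtracted is the truncated resolvent of [G1], the rest of a step being a positive jump
    term. The index is [i.+1] because the iteration starts at 0. *)
Lemma iterate_ge e n y i : 0 < e -> kpos (coef y) ->
  kpos (fun p => coef (iterate m lam n e y i.+1) p -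
    (if p \in square n then ((resw e p)^-1)%:C * coef y p else 0)).
Proof.
move=> e0 Hy; have := jump_term_kpos n e0 (iterate_kpos n i e0 Hy).
apply: kpos_ext => p; rewrite [coef (iterate _ _ _ _ _ _) _]coef_step_split.
by rewrite addrC addKr.
Qed.

(** All that is needed of the Gibbs vector. The ratio is [lam ^+ 2] and not its square because [xi]
    is the square root of the density matrix. *)
Definition gibbs_like (s : nat -> R) xi : Prop :=
  (forall p, coef xi p = if p.1 == p.2 then (s p.1)%:C else 0) /\
  (forall k, 0 <= s k) /\ (forall k, s (k + m)%N = lam ^+ 2 * s k).

(* detailed balance: [H xi = 0] entrywise *)
Lemma jump_gibbs s xi p : gibbs_like s xi ->
  2 * jump m (coef xi) p = (G1ev p)%:C * coef xi p.
Proof.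
have lam0 : lam != 0 by rewrite gt_eqF.
move=> [xE [s0 sm]]; case: p => j k; rewrite /jump /G1ev /Bev !xE /=.
rewrite eqn_add2r; case: eqP => [<-|jk]; last first.
  rewrite !mulr0 add0r; case: ifP => [/andP[mj mk]|_]; rewrite ?mulr0//.
  rewrite (_ : (j - m == k - m)%N = false) ?mulr0//; apply/negbTE/eqP => E; apply: jk.
  by rewrite -(subnK mj) E subnK.
rewrite andbb eqxx sm /fall_sqrt; case: ifP => [mj|_].
  have -> : s j = lam ^+ 2 * s (j - m)%N by rewrite -sm subnK.
  have cV2 : (lam ^- 2)%:C * ((lam ^+ 2)%:C) = 1 :> R[i].
    by rewrite -rmorphM/= mulVf// expf_neq0.
  have lM : ((lam ^- 2 * c (j - m) ^+ 2)%:C : R[i]) = (lam ^- 2)%:C * (c (j - m) * c (j - m))%:C.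
    by rewrite -rmorphM/= expr2.
  rewrite !rmorphD/= lM !rmorphM/=; rewrite rmorphM/= in cV2.
  by ring: cV2.
by rewrite expr0n !mulr0 !addr0 !rmorphD/= !rmorphM/=; ring.
Qed.

(** By detailed balance [xi] is reproduced by the step with data [xi]. In the corner, [xi] minus the
    new iterate is thus the resolvent of [G1] applied to [xi - y] plus the jump of [xi] minus the
    old iterate. *)
Lemma iterate_le e n y s xi i : 0 < e -> gibbs_like s xi ->
  kpos (fun p => coef xi p - coef y p) ->
  kpos (fun p => coef xi p - coef (iterate m lam n e y i) p).
Proof.
move=> e0 gx Hy; have [xE [s0 _]] := gx.
have xpos : kpos (coef xi) by apply: kpos_ext (kpos_diag s0) => p; rewrite xE.
elim: i => [|i IH]; first by apply: kpos_ext xpos => p; rewrite [X in _ - X](_ : _ = 0) ?subr0.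
pose z : L := xi - iterate m lam n e y i.
(* Removing a corner does not preserve positivity in general; here the rest is a nonnegative
   diagonal matrix. *)
have H1 : kpos (fun p => if p \in square n then 0 else coef xi p).
  have := kpos_diag (f := fun k => if (k < n)%N then 0 else s k).
  move=> K; apply: kpos_ext (K _) => [p|k]; last by case: ifP.
  rewrite mem_square xE; case: eqP => [<-|_]; last by case: ifP.
  by rewrite andbb; case: ifP.
have H2 : kpos (fun p => if p \in square n then ((resw e p)^-1)%:C * (coef xi p - coef y p) else 0).
  by apply: (trunc_kpos n (a := fun p => ((resw e p)^-1)%:C * (coef xi p - coef y p))); exact: resw_kpos.
have H3 := jump_term_kpos n e0 (eta := z) IH.
apply: kpos_ext (kposD H1 (kposD H2 H3)) => p.
rewrite [coef (iterate _ _ _ _ _ _) _]coef_step_split; case: ifP => pn; last first.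
  by rewrite !addr0 subr0.
have W0 : resw e p != 0 by rewrite gt_eqF// resw_gt0.
have two : 2%:C = 2 :> R[i] by apply/eqP; rewrite eq_complex/= addr0 !eqxx.
rewrite two (jumpB m (coef xi) (coef (iterate m lam n e y i)) p : jump m (coef z) p = _).
have J := jump_gibbs p gx.
have X : coef xi p = ((resw e p)^-1)%:C * (coef xi p + e%:C * (2 * jump m (coef xi) p)).
  rewrite J -{2}[coef xi p]mul1r mulrA -rmorphM/= -mulrDl -rmorphD/= mulrA -rmorphM/=.
  by rewrite mulVf// mul1r.
rewrite [in RHS]X; ring.
Qed.

(** A step reads only two entries of its argument, so the fixed point equation passes to the limit
    entry by entry, and the two order bounds do so by [kpos_limB]. *)
Lemma galerkin_solution e n y : 0 < e -> exists x : L, [/\ supported n x,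
    forall p, p \in square n -> coef x p + e%:C * Hcoef m lam (coef x) p = coef y p,
    kpos (coef y) -> kpos (fun p => coef x p -
      (if p \in square n then ((resw e p)^-1)%:C * coef y p else 0))
  & forall s xi, gibbs_like s xi -> kpos (fun p => coef xi p - coef y p) ->
      kpos (fun p => coef xi p - coef x p)].
Proof.
move=> e0; have [x Hx] := iterate_cvg m lam_gt0 n y e0.
have Cx p (t : R[i]) := coef_lim_Re (p := p) (t := t) Hx.
exists x; split.
- move=> p pn; apply: complex_ext => t; rewrite mulr0; apply: cvgn_uniq (Cx p t) _.
  apply/cvgn_subP => e' e'0; exists 0%N => i _.
  by rewrite iterate_supported// mulr0 subrr normr0.
- move=> p pn.
  have W0 : resw e p != 0 by rewrite gt_eqF// resw_gt0.
  have E : (resw e p)%:C * coef x p = coef y p + e%:C * (2 * jump m (coef x) p).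
    apply: complex_ext => t; rewrite mulrA.
    have H1 := Cx p (t * (resw e p)%:C).
    rewrite -(cvg_shiftS (fun i => Re (t * (resw e p)%:C * coef (iterate m lam n e y i) p))) in H1.
    apply: cvgn_uniq H1 _.
    rewrite (_ : (fun i => _) = (fun i => Re (t * coef y p) +
      (Re (t * e%:C * 2 * (c p.1 * c p.2)%:C * coef (iterate m lam n e y i) ((p.1 + m)%N, (p.2 + m)%N)) +
       Re (t * e%:C * 2 * (if (m <= p.1)%N && (m <= p.2)%N then (c (p.1 - m) * c (p.2 - m))%:C else 0)
           * coef (iterate m lam n e y i) ((p.1 - m)%N, (p.2 - m)%N))))).
      rewrite [X in _ --> X](_ : _ = Re (t * coef y p) +
      (Re (t * e%:C * 2 * (c p.1 * c p.2)%:C * coef x ((p.1 + m)%N, (p.2 + m)%N)) +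
       Re (t * e%:C * 2 * (if (m <= p.1)%N && (m <= p.2)%N then (c (p.1 - m) * c (p.2 - m))%:C else 0)
           * coef x ((p.1 - m)%N, (p.2 - m)%N)))).
        by apply: cvgnD; [exact: cvg_cst|apply: cvgnD; exact: Cx].
      by rewrite -!raddfD; congr Re; rewrite /jump; case: ifP => _; ring.
    apply/funext => i; rewrite [coef (iterate _ _ _ _ _ _) _]coef_step pn -!raddfD; congr Re.
    have cV : (resw e p)%:C * ((resw e p)^-1)%:C = 1 :> R[i] by rewrite -rmorphM/= divff.
    rewrite /jump; case: ifP => _; ring: cV.
  have -> : coef y p = (resw e p)%:C * coef x p - e%:C * (2 * jump m (coef x) p).
    by rewrite E addrK.
  have rE : (resw e p)%:C = 1 + e%:C * (b p.1 + b p.2)%:C by rewrite -rmorphM/= -(rmorph1 (real_complex R)) -rmorphD.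
  by rewrite /Hcoef rE; ring.
- move=> Hy; apply: (@kpos_limB _ (fun i => coef (iterate m lam n e y i)) (fun=> fun p =>
      if p \in square n then ((resw e p)^-1)%:C * coef y p else 0)).
  - exact: Cx.
  - by move=> p t; exact: cvg_cst.
  by exists 1%N => -[|i] // _; exact: iterate_ge.
- move=> s xi gx Hy; apply: (@kpos_limB _ (fun=> coef xi) (fun i => coef (iterate m lam n e y i))).
  - by move=> p t; exact: cvg_cst.
  - exact: Cx.
  by exists 0%N => i _; exact: (iterate_le n i e0 gx Hy).
Qed.

End ResolventPositivity.

(** * From resolvents to semigroups *)

Section Domination.
Context (R : realType) (m : nat) (lam : R).
Hypotheses (m_gt0 : (0 < m)%N) (lam_gt0 : 0 < lam).
Local Notation Re := complex.Re.
Local Notation L := (hs R).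
Local Notation hL := (@hs_hilbert R).
Local Notation oL := (@hs_onb R).
Local Notation Mul f := (mulop (@hsip R) (@Emx R) f).
Local Notation G1ev := (@G1ev R m lam).
Local Notation resw := (@resw R m lam).
Local Notation H := (H_ m lam).
Local Notation G := (Mul G1ev).
Implicit Types (eta zeta xi y : L) (p : nat * nat) (n : nat) (e t : R).

(** Surjectivity and the order bounds are stated together because they come from one Galerkin
    sequence; the resolvent of [H] can be used only once the range is known. *)
Lemma H_range e y : 0 < e -> exists x : L, [/\ H (x, (e^-1)%:C *: (y - x)),
    kpos (coef y) -> kpos (fun p => coef x p - ((resw e p)^-1)%:C * coef y p)
  & forall s xi, gibbs_like m lam s xi -> kpos (fun p => coef xi p - coef y p) ->
      kpos (fun p => coef xi p - coef x p)].
Proof.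
move=> e0; have [u Hu] := choice (fun n => galerkin_solution m lam_gt0 n y e0).
have [x ux Hx] := H_galerkin m_gt0 lam_gt0 e0 (fun n => let: And4 a _ _ _ := Hu n in a)
  (fun n => let: And4 _ a _ _ := Hu n in a).
exists x; split=> //.
  move=> Hy; apply: (@kpos_limB _ (fun n => coef (u n)) (fun n p =>
      if p \in square n then ((resw e p)^-1)%:C * coef y p else 0)).
  - by move=> p t; exact: @coef_lim_Re ux.
  (* A fixed entry lies in all large corners, so the truncation is eventually invisible. *)
  - move=> p t; apply/cvgn_subP => d d0; exists (maxn p.1 p.2).+1 => n; rewrite gtn_max => /andP[p1 p2].
    by rewrite mem_square p1 p2 subrr normr0.
  by exists 0%N => n _; have [_ _ + _] := Hu n; apply.
move=> s xi gx Hy; apply: (@kpos_limB _ (fun=> coef xi) (fun n => coef (u n))).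
- by move=> p t; exact: cvg_cst.
- by move=> p t; exact: @coef_lim_Re ux.
by exists 0%N => n _; have [_ _ _ K] := Hu n; exact: K gx Hy.
Qed.

Lemma add_scale_resolvent e (x y : L) : 0 < e -> x + e%:C *: ((e^-1)%:C *: (y - x)) = y.
Proof.
move=> e0; rewrite scalerA -rmorphM/= divff ?gt_eqF// scale1r.
by rewrite addrC subrK.
Qed.

Lemma H_accretive : accretive (@hsip R) H.
Proof.
rewrite H_gram//; apply: gram_accretive.
- exact: hL.
- exact: prod_hilbert hL hL.
- exact: grad_lin.
- move=> x; exists (fun n => proj (@hsip R) (@Emx R) (square n) x); last exact: (@proj_cvg _ _ _ hL _ _ _ oL).
  by move=> n; apply: (@grad_supported _ _ _ m_gt0 lam_gt0 n); exact: proj_supported.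
- move=> e e0 y; have [x [Hx _ _]] := H_range y e0.
  by exists x, ((e^-1)%:C *: (y - x)); split; [rewrite -H_gram|exact: add_scale_resolvent].
Qed.

Lemma G_accretive : accretive (@hsip R) G.
Proof. by apply: (mulop_accretive hL oL) => p; exact: G1ev_ge0. Qed.

Lemma H_resolvent e y : 0 < e ->
  (kpos (coef y) -> kpos (fun p => coef (resolvent H e y) p - ((resw e p)^-1)%:C * coef y p)) /\
  (forall s xi, gibbs_like m lam s xi -> kpos (fun p => coef xi p - coef y p) ->
      kpos (fun p => coef xi p - coef (resolvent H e y) p)).
Proof.
move=> e0; have [x [Hx H1 H2]] := H_range y e0.
have := res_uniq hL H_accretive (ltW e0) Hx.
by rewrite add_scale_resolvent// => ->.
Qed.

Lemma G_resolvent_coef e y p : 0 < e ->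
  coef (resolvent G e y) p = ((resw e p)^-1)%:C * coef y p.
Proof.
move=> e0; rewrite -!hsip_E; by apply: (mulop_resolvent hL oL); [move=> q; exact: G1ev_ge0|exact: ltW].
Qed.

Lemma hs_pos_zero : hs_pos (0 : L).
Proof. by apply/hs_posP; apply: kpos_ext (@kpos0 R) => p; rewrite [coef _ _](_ : _ = 0). Qed.

Lemma hs_posD eta zeta : hs_pos eta -> hs_pos zeta -> hs_pos (eta + zeta).
Proof.
move=> /hs_posP a /hs_posP b; apply/hs_posP; apply: kpos_ext (kposD a b) => p.
by rewrite hs_coefD.
Qed.

Lemma hs_le_trans eta zeta xi : hs_le eta zeta -> hs_le zeta xi -> hs_le eta xi.
Proof. by move=> a b; have := hs_posD b a; rewrite addrA subrK. Qed.

Lemma hs_le0 eta : hs_le 0 eta <-> hs_pos eta.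
Proof. by rewrite /hs_le subr0. Qed.

Lemma G_resolvent_pos e y : hs_pos y -> hs_pos (resolvent G e y).
Proof.
have [e0|e0] := leP e 0; first by rewrite res0.
move=> /hs_posP Hy; apply/hs_posP; apply: kpos_ext (resw_kpos m lam e0 Hy) => p.
by rewrite G_resolvent_coef.
Qed.

Lemma G_resolvent_mono e eta zeta : hs_le eta zeta -> hs_le (resolvent G e eta) (resolvent G e zeta).
Proof.
have [e0|e0] := leP e 0; first by rewrite !res0.
by move=> /(G_resolvent_pos e); rewrite (resB hL G_accretive)// ltW.
Qed.

Lemma resolvent_le e y : hs_pos y -> hs_le (resolvent G e y) (resolvent H e y).
Proof.
have [e0|e0] := leP e 0.
  by rewrite !res0// /hs_le subrr => _; exact: hs_pos_zero.
move=> /hs_posP Hy; apply/hs_leP; apply: kpos_ext (proj1 (H_resolvent y e0) Hy) => p.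
by rewrite G_resolvent_coef.
Qed.

Lemma H_resolvent_le e y s xi : gibbs_like m lam s xi -> hs_le y xi -> hs_le (resolvent H e y) xi.
Proof.
have [e0|e0] := leP e 0; first by rewrite res0.
by move=> gx /hs_leP Hy; apply/hs_leP; exact: (proj2 (H_resolvent y e0) s xi gx Hy).
Qed.

Lemma hs_le_cvg (u v : nat -> L) eta zeta : hcvg (@hsip R) u eta -> hcvg (@hsip R) v zeta ->
  (forall n, hs_le (u n) (v n)) -> hs_le eta zeta.
Proof. by move=> ue vz uv; exact: hs_pos_cvg (hcvgB hL vz ue) uv. Qed.

(** Along the Euler steps, with [g <= v] the iterates for [G] and [H], one has
    [res G g <= res G v <= res H v]. The second inequality needs [v] positive, so positivity of [g]
    is carried in the induction. *)
Lemma expN_domination t eta : 0 <= t -> hs_pos eta ->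
  hs_le (expN (@hsip R) G t eta) (expN (@hsip R) H t eta).
Proof.
move=> t0 e0; apply: hs_le_cvg (expN_euler hL G_accretive eta t0) (expN_euler hL H_accretive eta t0) _ => k.
suff: hs_pos (euler G k t eta) /\ hs_le (euler G k t eta) (euler H k t eta) by case.
rewrite /euler; elim: (2 ^ k)%N => [|i [IH1 IH2]].
  by split=> //; rewrite /hs_le subrr; exact: hs_pos_zero.
split; rewrite !iterS; first exact: G_resolvent_pos.
apply: hs_le_trans (G_resolvent_mono _ IH2) (resolvent_le _ _).
rewrite -[iter _ (resolvent H _) _](subrK (iter i (resolvent G (t / 2 ^+ k)) eta)).
exact: hs_posD IH2 IH1.
Qed.

Lemma expN_G_pos t eta : 0 <= t -> hs_pos eta -> hs_pos (expN (@hsip R) G t eta).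
Proof.
move=> t0 e0; apply: hs_pos_cvg (expN_euler hL G_accretive eta t0) _ => k.
by rewrite /euler; elim: (2 ^ k)%N => // i IH; rewrite iterS; exact: G_resolvent_pos.
Qed.

(** Positivity for [H] comes for free: the semigroup dominates a positive one. *)
Lemma expN_H_pos t eta : 0 <= t -> hs_pos eta -> hs_pos (expN (@hsip R) H t eta).
Proof.
move=> t0 e0; rewrite -[expN _ H t eta](subrK (expN (@hsip R) G t eta)).
exact: hs_posD (expN_domination t0 e0) (expN_G_pos t0 e0).
Qed.

Lemma expN_H_le t s xi eta : 0 <= t -> gibbs_like m lam s xi -> hs_le eta xi ->
  hs_le (expN (@hsip R) H t eta) xi.
Proof.
move=> t0 gx Hx.
apply: hs_le_cvg (expN_euler hL H_accretive eta t0) (hcvg_cst hL xi) _ => k.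
by rewrite /euler; elim: (2 ^ k)%N => // i IH; rewrite iterS; exact: H_resolvent_le gx IH.
Qed.

Lemma H_markovian s xi : gibbs_like m lam s xi -> markovian xi (expN (@hsip R) H).
Proof.
move=> gx; split; first exact: (proj1 (expNP hL H_accretive)).
  exact: expN_H_pos.
move=> t eta t0 /hs_le0 e0 ex; split; last exact: expN_H_le gx ex.
exact/hs_le0/expN_H_pos.
Qed.

(** The upper bound by [xi] is inherited from [H] through domination. *)
Lemma G_markovian s xi : gibbs_like m lam s xi -> markovian xi (expN (@hsip R) G).
Proof.
move=> gx; split; first exact: (proj1 (expNP hL G_accretive)).
  exact: expN_G_pos.
move=> t eta t0 /hs_le0 e0 ex; split; first exact/hs_le0/expN_G_pos.
exact: hs_le_trans (expN_domination t0 e0) (expN_H_le t0 gx ex).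
Qed.

End Domination.

(** * The Gibbs vector *)

Section GibbsVector.
Context (R : realType) (beta : R).
Hypothesis beta_gt0 : 0 < beta.
Local Notation L := (hs R).

Lemma gibbs_ge0 k : 0 <= gibbs beta k.
Proof. by rewrite mulr_ge0 ?expR_ge0// subr_ge0 -[leRHS]expR0 ler_expR oppr_le0 ltW. Qed.

(** The sums stay below 1, so the square root of the density is Hilbert-Schmidt and [xi_] is not the
    default value. *)
Lemma gibbs_sum n : \sum_(0 <= k < n) gibbs beta k = 1 - expR (- (beta * n%:R)).
Proof.
elim: n => [|n IH]; first by rewrite big_nil mulr0 oppr0 expR0 subrr.
rewrite big_nat_recr//= IH /gibbs -natr1 mulrDr mulr1 opprD expRD; ring.
Qed.

(** Entries describe [xi] on basis vectors only. Moving [xi] to the other side of the pairing as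
    [J xi], which is evaluated at [e_ k], gives every coordinate of [xi x]. *)
Lemma xi_diag (xi : L) (s : nat -> R) : (forall j k, coef xi (j, k) = if j == k then (s j)%:C else 0) ->
  opgraph xi = diag s.
Proof.
move=> xiE.
have JE k : J xi (e_ k) = (s k)%:C *: e_ k.
  apply: l2_ext => j; rewrite l2valZ eE.
  rewrite (_ : J xi (e_ k) j = coef (J xi) (j, k))// coefJ xiE.
  by have [_|_] := eqVneq j k; rewrite ?mulr1 ?mulr0 ?conjR ?rmorph0.
have xE x k : xi x k = (s k)%:C * x k.
  by rewrite -l2ip_e JP JE (ipZrR (@l2_hilbert R)) l2ip_e.
apply/seteqP; split=> -[x y].
  by move=> yE k; rewrite -xE; have -> : xi x = y by exact/esym/yE.
by move=> yE; apply: l2_ext => k; rewrite xE; exact: yE.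
Qed.

Lemma xi_coef p : coef (xi_ beta) p = if p.1 == p.2 then (Num.sqrt (gibbs beta p.1))%:C else 0.
Proof.
have [eta etaE] : exists eta : L, forall k, eta (e_ k) = (Num.sqrt (gibbs beta k))%:C *: e_ k.
  apply: hs_ex; exists 1 => n; rewrite (eq_bigr (gibbs beta)) ?gibbs_sum.
    by rewrite gerBl expR_ge0.
  move=> k _; rewrite (hnormZ (@l2_hilbert R)) exprMn real_normK ?num_real//.
  rewrite sqr_sqrtr ?gibbs_ge0// (hnorm_sqr (@l2_hilbert R)) l2ip_e eE eqxx.
  by rewrite mulr1.
have etaC j k : coef eta (j, k) = if j == k then (Num.sqrt (gibbs beta j))%:C else 0.
  rewrite (_ : coef eta (j, k) = eta (e_ k) j)// etaE l2valZ eE.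
  by case: eqP => [->|_]; rewrite ?mulr1 ?mulr0.
have xiE : opgraph (xi_ beta) = diag (fun k => Num.sqrt (gibbs beta k)).
  exact: (@xgetI _ (0 : L) [set xi : L | opgraph xi = diag (fun k => Num.sqrt (gibbs beta k))]
    eta (xi_diag etaC)).
have xiX x : xi_ beta x = eta x.
  have : opgraph (xi_ beta) (x, xi_ beta x) by [].
  by rewrite [opgraph _]xiE -(xi_diag etaC).
by case: p => j k; rewrite -etaC (hs_ext0 xiX).
Qed.

Lemma gibbs_shift m k : gibbs beta (k + m) = expR (- (m%:R * beta)) * gibbs beta k.
Proof. by rewrite /gibbs natrD mulrDr opprD expRD [beta * m%:R]mulrC; ring. Qed.

Lemma xi_gibbs_like m lam : lam ^+ 2 = expR (- (m%:R * beta / 2)) ->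
  gibbs_like m lam (fun k => Num.sqrt (gibbs beta k)) (xi_ beta).
Proof.
move=> lamE; split; first exact: xi_coef.
split=> k; first exact: sqrtr_ge0.
(* The density has ratio [exp (- m beta) = lam ^ 4] over [m] levels, and its square root has ratio
   [lam ^ 2]. *)
rewrite gibbs_shift (_ : expR _ = (lam ^+ 2) ^+ 2).
  by rewrite sqrtrM ?sqr_ge0// sqrtr_sqr ger0_norm// sqr_ge0.
by rewrite lamE expr2 -expRD; congr expR; field.
Qed.

End GibbsVector.

(** * The form sum: domain, closedness and exponential *)

Section FormSum.
Context (R : realType) (m : nat) (lam : R).
Hypotheses (m_gt0 : (0 < m)%N) (lam_gt0 : 0 < lam).
Local Notation L := (hs R).
Local Notation h := (l2 R).
Local Notation hL := (@hs_hilbert R).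
Local Notation oL := (@hs_onb R).
Local Notation hl := (@l2_hilbert R).
Local Notation ol := (@l2_onb R).
Local Notation Mul f := (mulop (@hsip R) (@Emx R) f).
Local Notation b := (Bev m lam).
Local Notation G1ev := (@G1ev R m lam).
Local Notation pw k := (k%:R `^ m%:R : R).
Local Notation Nm := (Npow (m%:R : R)).
Implicit Types (eta zeta : L).

Lemma G1_E : G1_ m lam = Mul G1ev.
Proof. by rewrite /G1_ B_E// opform_lift_sum// => k; exact: Bev_ge0. Qed.

Lemma Mul_dom (f g : nat * nat -> R) eta zeta (K : R) : Mul f (eta, zeta) -> 0 <= K ->
  (forall p, g p ^+ 2 <= K * (1 + f p ^+ 2)) -> exists z, forall p, coef z p = (g p)%:C * coef eta p.
Proof.
move=> H K0 HK; have [z Hz] := mulop_dom hL oL H K0 HK.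
by exists z; apply/Mul_coef.
Qed.

Lemma lift_B_dom : opdom (lift_op (B_ m lam)) = opdom (lift_op Nm).
Proof.
rewrite B_E// !lift_diag; apply/seteqP; split=> eta [zeta Hz].
  have [K K0 HK] := expn_le_Bev m lam_gt0.
  by exact: (mulop_dom hL oL Hz K0 (fun p => HK p.1)).
have [K K0 HK] := Bev_le_expn m lam_gt0.
by exact: (mulop_dom hL oL Hz K0 (fun p => HK p.1)).
Qed.

Lemma J_weighted (f : nat -> R) eta zeta :
  (forall p, coef zeta p = (f p.1)%:C * coef (J eta) p) ->
  forall p, coef (J zeta) p = (f p.2)%:C * coef eta p.
Proof.
by move=> H [j k]; rewrite coefJ H rmorphM/= coefJ conjR conjCK.
Qed.

(** As the eigenvalues are nonnegative, [b j + b k] dominates each summand, which gives one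
    inclusion. For the other, the images under left and right multiplication are added. *)
Lemma G1_dom : opdom (G1_ m lam) = opdom (lift_op Nm) `&` @J R @` opdom (lift_op Nm).
Proof.
rewrite G1_E lift_diag; apply/seteqP; split=> eta.
  move=> [zeta Hz]; have [K K0 HK] := expn_le_Bev m lam_gt0.
  have b0 := Bev_ge0 m lam.
  have K1 p : pw p.1 ^+ 2 <= K * (1 + G1ev p ^+ 2).
    apply: le_trans (HK p.1) _; apply: ler_wpM2l => //; rewrite lerD2l lerXn2r ?nnegrE//.
      by rewrite addr_ge0.
    by rewrite lerDl.
  have K2 p : pw p.2 ^+ 2 <= K * (1 + G1ev p ^+ 2).
    apply: le_trans (HK p.2) _; apply: ler_wpM2l => //; rewrite lerD2l lerXn2r ?nnegrE//.
      by rewrite addr_ge0.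
    by rewrite lerDr.
  split; first exact: (mulop_dom hL oL Hz K0 K1).
  exists (J eta); last exact: JK.
  have [z Hz2] := Mul_dom Hz K0 K2.
  exists (J z); apply/Mul_coef => -[j k].
  by rewrite !coefJ Hz2 rmorphM/= conjR.
move=> [[z1 H1] [zeta [z2 H2] zE]]; have [K K0 HK] := Bev_le_expn m lam_gt0.
have [w1 W1] := Mul_dom H1 K0 (fun p => HK p.1).
have [w2 W2] := Mul_dom H2 K0 (fun p => HK p.1).
exists (w1 + J w2); apply/Mul_coef => p; rewrite hs_coefD W1.
rewrite -zE; rewrite (@J_weighted b (J zeta) w2); last by move=> q; rewrite JK; exact: W2.
by rewrite -mulrDl -rmorphD.
Qed.

Lemma G1_closed : opclosed (@hsip R) (G1_ m lam).
Proof.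
rewrite G1_E => u v x y Huv ux vy.
have K : gclosure (@hsip R) (@hsip R) (Mul G1ev) (x, y).
  by exists u, v; split; [exact: Huv|exact: ux|exact: vy].
exact: (mulop_closed hL K).
Qed.

Section Exponentials.
Variable t : R.
Hypothesis t_ge0 : 0 <= t.
Let T : h -> h := expN (@l2ip R) (B_ m lam) t.
Let w (k : nat) : R := expR (- (t * b k)).

Lemma B_accretive : accretive (@l2ip R) (B_ m lam).
Proof.
rewrite B_E// diagE; apply: (mulop_accretive hl ol) => k; exact: Bev_ge0.
Qed.

Let TE x k : T x k = (w k)%:C * x k.
Proof.
rewrite /T B_E// diagE -!l2ip_e; apply: (mulop_expN hl ol) => //; exact: Bev_ge0.
Qed.

Let T_graph : opgraph T = diag w.
Proof.
apply/seteqP; split=> -[x y].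
  by move=> yE k; rewrite -TE; have -> : T x = y by exact/esym/yE.
by move=> yE; apply: l2_ext => k; rewrite TE; exact: yE.
Qed.

Let T_sym x y : l2ip (T x) y = l2ip x (T y).
Proof. by have [[_ S _ _ _] _] := expNP hl B_accretive; exact: S. Qed.

Lemma expN_G1_coef eta p :
  coef (expN (@hsip R) (G1_ m lam) t eta) p = (expR (- (t * G1ev p)))%:C * coef eta p.
Proof.
rewrite G1_E -!hsip_E; apply: (mulop_expN hL oL) => // q; exact: G1ev_ge0.
Qed.

(** The exponential of [b j + b k] factors into a row and a column weight. The intermediate matrix
    [y] carries the column weight, so it is the image of [eta] under the right action. *)
Lemma expN_G1_formula eta :
  opcomp (lift_op (opgraph T)) (opj (lift_op (opgraph T)))
    (eta, expN (@hsip R) (G1_ m lam) t eta) /\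
  forall x, expN (@hsip R) (G1_ m lam) t eta x = T (eta (T x)).
Proof.
have w01 k : 0 <= w k <= 1.
  by rewrite expR_ge0 -[leRHS]expR0 ler_expR oppr_le0 mulr_ge0// Bev_ge0.
have [y yE] : exists y : L, forall p, coef y p = (w p.2)%:C * coef eta p.
  apply: (@hs_dominated _ _ eta eta 1) => // p; rewrite sqmodM mul1r.
  have /andP[w0 w1] := w01 p.2.
  apply: le_trans (_ : 1 * sqmod (coef eta p) <= _); last by rewrite mul1r lerDl sqmod_ge0.
  apply: ler_wpM2r; first exact: sqmod_ge0.
  by rewrite /sqmod /= expr0n addr0 exprn_ile1.
have Jy : lift_op (opgraph T) (J eta, J y).
  rewrite T_graph lift_diag; apply/Mul_coef => -[j k].
  by rewrite !coefJ yE rmorphM/= conjR.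
have Ey : lift_op (opgraph T) (y, expN (@hsip R) (G1_ m lam) t eta).
  rewrite T_graph lift_diag; apply/Mul_coef => p.
  by rewrite expN_G1_coef yE mulrA -rmorphM/= -expRD mulrDr opprD.
split; first by exists y.
have JyE x : J y x = T (J eta x) by exact: Jy.
(* Pairing with [e_ k] moves [y] to [J y], which is [T] after [J eta]; symmetry of [T] brings it
   back onto [x]. *)
have yT x : y x = eta (T x) by apply: l2_ext => k; rewrite -!l2ip_e !JP JyE T_sym.
by move=> x; rewrite -yT; exact: Ey.
Qed.

End Exponentials.
End FormSum.

Theorem theorem5p3 (R : realType) (beta lam : R) (m : nat)
    (beta_gt0 : 0 < beta) (m_ge1 : (1 <= m)%N) (lam_gt0 : 0 < lam)
    (lamE : lam ^+ 2 = expR (- (m%:R * beta / 2))) :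
  let B := B_ m lam in
  let G1 := G1_ m lam in
  let H := H_ m lam in
  let expB := expN (@l2ip R) B in
  let expG1 := expN (@hsip R) G1 in
  let expH := expN (@hsip R) H in
  [/\ opdom B = opdom (Npow m%:R),
      opdom (lift_op B) = opdom (lift_op (Npow m%:R)),
      selfadjoint (@hsip R) (lift_op B),
      oppositive (@hsip R) (lift_op B)
    & affiliated (lift_op B)] /\
  [/\ opdom G1 = opdom (lift_op (Npow m%:R)) `&` @J R @` opdom (lift_op (Npow m%:R)),
      opclosed (@hsip R) G1
    & selfadjoint (@hsip R) G1] /\
  [/\ is_exp_semigroup (@l2ip R) B expB,
      is_exp_semigroup (@hsip R) G1 expG1,
      is_exp_semigroup (@hsip R) H expH,
      markovian (xi_ beta) expG1
    & markovian (xi_ beta) expH] /\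
  (forall (t : R) (eta : hs R), 0 <= t -> hs_pos eta ->
     hs_le (expG1 t eta) (expH t eta)) /\
  (forall (t : R) (eta : hs R), 0 <= t ->
     opcomp (lift_op (opgraph (expB t))) (opj (lift_op (opgraph (expB t))))
       (eta, expG1 t eta) /\
     forall x : l2 R, expG1 t eta x = expB t (eta (expB t x))).
Proof.
move=> B G1 H expB expG1 expH.
have hL := @hs_hilbert R; have oL := @hs_onb R.
have b0 := Bev_ge0 m lam.
have gx := xi_gibbs_like beta_gt0 lamE.
have GE := G1_E m_ge1 lam_gt0.
split; [|split; [|split; [|split]]].
- split.
  + exact: B_dom.
  + exact: lift_B_dom.
  + rewrite /B B_E// lift_diag; exact: (mulop_selfadjoint hL oL).
  + by rewrite /B B_E// lift_diag; apply: Mul_oppositive => p; exact: b0.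
  + by rewrite /B B_E//; exact: lift_diag_affiliated.
- split.
  + exact: G1_dom.
  + exact: G1_closed.
  + rewrite /G1 GE; exact: (mulop_selfadjoint hL oL).
- split.
  + exact: (expNP (@l2_hilbert R) (B_accretive m_ge1 lam_gt0)).
  + by rewrite /expG1 /G1 GE; exact: (expNP hL (G_accretive m lam)).
  + exact: (expNP hL (H_accretive m_ge1 lam_gt0)).
  + by rewrite /expG1 /G1 GE; exact: (G_markovian m_ge1 lam_gt0 gx).
  + exact: (H_markovian m_ge1 lam_gt0 gx).
- by move=> t eta t0 eta0; rewrite /expG1 /G1 GE; exact: expN_domination.
- by move=> t eta t0; exact: expN_G1_formula.
Qed.
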